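(* Let $(\nu_k,T_k)_{k=1}^K$ and $V_{\min}$ be the outputs of the synthetic generation procedure described in the context, for inputs as described there, and let $V(\mu)=\sum_{k=1}^Kw_k\mathcal W_2(\mu,\nu_k)^2$ for $\mu\in\mathcal P_2(\mathbb R^d)$. In the case where $\mathtt{TRUNCATE}=\mathtt{False}$: (i) $\nu_k\in\mathcal P_{2,\mathrm{ac}}(\mathbb R^d)$ for $k=1,\dots,K$, and $\bar\mu$ is the unique $\mathcal W_2$-barycenter of $\nu_1,\dots,\nu_K$ with weights $w_1,\dots,w_K$. (ii) $V_{\min}=V(\bar\mu)$. In the case where $\mathtt{TRUNCATE}=\mathtt{True}$, assume in addition that $\bar\mu\in\mathcal M^q_{\mathrm{full}}(\mathbb R^d)$ for some $q\in\mathbb N_0$ and that $\mathcal Y_1,\dots,\mathcal Y_K\in\mathcal S^q(\mathbb R^d)$. Then: (iii) $\nu_k\in\mathcal M^q(\mathbb R^d)$ for $k=1,\dots,K$. (iv) For any $\mathcal Y_1,\dots,\mathcal Y_K\in\mathcal S^q(\mathbb R^d)$, the term $\epsilon(\mathcal Y_1,\dots,\mathcal Y_K)$ defined explicitly in the context lies in $(0,\infty)$ and satisfies $$V(\bar\mu)\le\inf_{\mu\in\mathcal P_2(\mathbb R^d)}V(\mu)+\epsilon(\mathcal Y_1,\dots,\mathcal Y_K),\qquad\Big|V_{\min}-\inf_{\mu\in\mathcal P_2(\mathbb R^d)}V(\mu)\Big|\le\epsilon(\mathcal Y_1,\dots,\mathcal Y_K).$$ (v) For $k=1,\dots,K$ let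 $(\mathcal Y_{k,r})_{r\in\mathbb N}$ satisfy $\mathcal Y_{k,r}\in\mathcal S^q(\mathbb R^d)$, $\mathcal Y_{k,r}\subseteq\mathcal Y_{k,r+1}$ for all $r\in\mathbb N$, and $\bigcup_{r\in\mathbb N}\mathcal Y_{k,r}=\mathbb R^d$. Then $\lim_{r\to\infty}\epsilon(\mathcal Y_{1,r},\dots,\mathcal Y_{K,r})=0$.
   Context: Notation. $\|\cdot\|$ Euclidean norm; $\mathcal P_2(\mathbb R^d)$: Borel probability measures with finite second moment; $\mathcal P_{2,\mathrm{ac}}(\mathbb R^d)$: those absolutely continuous; $\mathcal W_2(\mu,\nu)=(\inf_\pi\int\|x-y\|^2d\pi)^{1/2}$ over couplings; a $\mathcal W_2$-barycenter of $\nu_1,\dots,\nu_K$ with weights $w_k$ is a minimizer of $V$ over $\mathcal P_2(\mathbb R^d)$. $T\sharp\mu=\mu\circ T^{-1}$; $\rho|_{\mathcal X}(A)=\rho(A\cap\mathcal X)/\rho(\mathcal X)$. $e_{\max}$ is the largest eigenvalue, $I_d$ the identity matrix. Classes. For bounded open $U$, $\mathcal C^{q,\alpha}(\mathrm{cl}(U))$: continuous real functions on $\mathrm{cl}(U)$, $q$ times continuously differentiable on $U$, with finite Hölder norm (derivatives up to order $q$ bounded, those of order $q$ $\alpha$-Hölder). $\mathcal C^{\mathrm{loc},q,\alpha}(\mathbb R^d)$: functions whose restriction to the closure of every bounded open set is in $\mathcal C^{q,\alpha}$. $\mathcal S^q(\mathbb R^d)$: sets $\mathrm{cl}(\mathcal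 Y)$ with $\mathcal Y$ non-empty, open, bounded, with $\mathcal C^{q+2}$-boundary (locally the graph of a $\mathcal C^{q+2}$ function) and uniformly convex (second fundamental form uniformly positive on the boundary). $\mathcal M^q(\mathbb R^d)$: $\mu\in\mathcal P_{2,\mathrm{ac}}(\mathbb R^d)$ with $\mathrm{supp}(\mu)\in\mathcal S^q(\mathbb R^d)$ and a density $f_\mu\in\mathcal C^{q,\alpha}(\mathrm{supp}(\mu))$ for some $\alpha\in(0,1)$ with $\zeta^{-1}\le f_\mu\le\zeta$ on $\mathrm{supp}(\mu)$ for some $\zeta\ge1$. $\mathcal M^q_{\mathrm{full}}(\mathbb R^d)$: $\rho\in\mathcal P_{2,\mathrm{ac}}(\mathbb R^d)$ with support $\mathbb R^d$ and an everywhere positive density in $\mathcal C^{\mathrm{loc},q,\alpha}(\mathbb R^d)$ for some $\alpha\in(0,1)$. Inputs. $\bar\mu\in\mathcal P_{2,\mathrm{ac}}(\mathbb R^d)$; $K\ge2$; $w_1,\dots,w_K>0$ with $\sum_kw_k=1$; $\widetilde K\ge2$ with $2\widetilde K\ge K$; for $i=1,\dots,\widetilde K$: $\underline\lambda_i>0$, $\gamma_i>0$, $\alpha_i>0$, $n_i\in\mathbb N$, $(g_{i,j})_{j=1}^{n_i}\subset\mathbb R$, $(y_{i,j})_{j=1}^{n_i}\subset\mathbb R^d$; a surjection $\Phi:\{1,\dots,\widetilde K,-1,\dots,-\widetilde K\}\to\{1,\dots,K\}$; symmetric positive definite $A_1,\dots,A_K\in\mathbb R^{d\times d}$ and $b_1,\dots,b_K\in\mathbb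 R^d$ with $\sum_kw_kA_k=I_d$, $\sum_kw_kb_k=0$; $\xi\in[0,1)$; $\mathtt{TRUNCATE}\in\{\mathtt{True},\mathtt{False}\}$; closed sets $\mathcal Y_1,\dots,\mathcal Y_K\subseteq\mathbb R^d$. Procedure. For $i=1,\dots,\widetilde K$ and $x\in\mathbb R^d$ let $\eta_{i,j}(x)=\frac{\exp((g_{i,j}+\langle y_{i,j},x\rangle)/\gamma_i)}{\sum_{j'=1}^{n_i}\exp((g_{i,j'}+\langle y_{i,j'},x\rangle)/\gamma_i)}$, $\eta_i(x)=(\eta_{i,1}(x),\dots,\eta_{i,n_i}(x))^{\mathsf T}$, and $\mathbf Y_i\in\mathbb R^{d\times n_i}$ the matrix with columns $y_{i,1},\dots,y_{i,n_i}$. Choose $\overline\lambda_i\ge\frac1{\gamma_i}\max_{x\in\mathbb R^d}e_{\max}\big(\mathbf Y_i(\mathrm{diag}(\eta_i(x))-\eta_i(x)\eta_i(x)^{\mathsf T})\mathbf Y_i^{\mathsf T}\big)+2\underline\lambda_i$. Let $\widetilde T_i(x)=\sum_j\eta_{i,j}(x)y_{i,j}+\underline\lambda_ix$ and $\widetilde T_{-i}(x)=\overline\lambda_ix-\widetilde T_i(x)$. Set $\beta_{-i}=(1-\xi)\alpha_i\big(\sum_{i'=1}^{\widetilde K}w_{\Phi(-i')}\alpha_{i'}\overline\lambda_{i'}\big)^{-1}$ and $\beta_i=\frac{w_{\Phi(-i)}}{w_{\Phi(i)}}\beta_{-i}$. For $k=1,\dots,K$ let $T_k(x)=\sum_{s\in\Phi^{-1}(k)}\beta_s\widetilde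 T_s(x)+\xi(A_kx+b_k)$, and $\nu_k=(T_k\sharp\bar\mu)|_{\mathcal Y_k}$ if $\mathtt{TRUNCATE}=\mathtt{True}$, $\nu_k=T_k\sharp\bar\mu$ if $\mathtt{TRUNCATE}=\mathtt{False}$. Finally $V_{\min}=\int\sum_{k=1}^Kw_k\|x-T_k(x)\|^2d\bar\mu(x)$. Outputs: $(\nu_k,T_k)_{k=1}^K$, $V_{\min}$. Definition of $\epsilon$. For $i=1,\dots,\widetilde K$ let $\widetilde\varphi_i(x)=\gamma_i\log\big(\sum_{j=1}^{n_i}\exp((g_{i,j}+\langle y_{i,j},x\rangle)/\gamma_i)\big)+\frac{\underline\lambda_i}2\|x\|^2$, $\widetilde\varphi_{-i}(x)=\frac{\overline\lambda_i}2\|x\|^2-\widetilde\varphi_i(x)$; for $k=1,\dots,K$ let $\varphi_k(x)=\sum_{s\in\Phi^{-1}(k)}\beta_s\widetilde\varphi_s(x)+\xi\langle\frac12A_kx+b_k,x\rangle$ and $\varphi_k^*(y)=\sup_x\{\langle y,x\rangle-\varphi_k(x)\}$. With $\pi_k=T_k\sharp\bar\mu$ and $h_k(x)=\frac{1-\pi_k(\mathcal Y_k)}{\pi_k(\mathcal Y_k)}+\mathbf 1_{\mathbb R^d\setminus\mathcal Y_k}(x)$, let $\epsilon_{1,k}(\mathcal Y_k)=\int2\|x\|^2h_k\,d\pi_k$, $\epsilon_{2,k}(\mathcal Y_k)=\int\big|\|x\|^2-2\varphi_k^*(x)\big|h_k\,d\pi_k$, and $$\epsilon(\mathcal Y_1,\dots,\mathcal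 Y_K)=\sum_{k=1}^Kw_k\big(2\mathcal W_2(\bar\mu,\pi_k)\,\epsilon_{1,k}(\mathcal Y_k)^{1/2}+\epsilon_{1,k}(\mathcal Y_k)+\epsilon_{2,k}(\mathcal Y_k)\big).$$ *)

(* Defs.v *)
From HB Require Import structures.
From mathcomp Require Import all_boot all_order all_algebra.
From mathcomp Require Import all_classical all_reals all_analysis.
From mathcomp Require Import measurable_realfun.

Set Implicit Arguments.
Unset Strict Implicit.
Unset Printing Implicit Defensive.

Import Order.TTheory GRing.Theory Num.Theory.
Import numFieldNormedType.Exports.

Local Open Scope classical_set_scope.
Local Open Scope ring_scope.

HB.instance Definition _ (R : realType) (m n : nat) :=
  Measurable.copy 'M[R]_(m, n) (g_sigma_algebraType (@open 'M[R]_(m, n))).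

Section borel.
Context {R : realType}.

Lemma open_measurable_mx (m n : nat) (A : set 'M[R]_(m, n)) :
  open A -> measurable A.
Proof. by move=> oA; apply: sub_sigma_algebra. Qed.

Lemma continuous_measurable_mx (m n m' n' : nat)
    (f : 'M[R]_(m, n) -> 'M[R]_(m', n')) :
  continuous f -> measurable_fun [set: 'M[R]_(m, n)] f.
Proof.
move=> /continuousP cf.
apply: (measurability (@open 'M[R]_(m', n'))) => //.
move=> _ [A oA <-]; rewrite setTI; apply: open_measurable_mx; exact: cf.
Qed.

Lemma measurable_coord (m n : nat) (i : 'I_m) (j : 'I_n) :
  measurable_fun [set: 'M[R]_(m, n)] (fun x : 'M[R]_(m, n) => x i j).
Proof.
apply: (measurability _ (RGenOpens.measurableE R)).
move=> _ [_ [a [b ->] <-]]; rewrite setTI; apply: open_measurable_mx.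
have /continuousP := @coord_continuous R m n i j.
by apply; exact: interval_open.
Qed.

Lemma measurable_fun_rV d (T : measurableType d) (n : nat)
    (f : T -> 'rV[R]_n) :
  (forall i, measurable_fun [set: T] (fun t => f t ord0 i)) ->
  measurable_fun [set: T] f.
Proof.
move=> mf; apply: (measurability (@open 'rV[R]_n)) => //.
move=> _ [A oA <-]; rewrite setTI.
pose box (p : 'rV[rat]_n * nat) : set 'rV[R]_n :=
  [set x | forall i, `|x ord0 i - ratr (p.1 ord0 i)| < p.2.+1%:R^-1].
have AE : A = \bigcup_(p in [set p | box p `<=` A]) box p.
  apply/seteqP; split=> [x Ax|x [p pA px]]; last exact: pA.
  have : nbhs x A by rewrite nbhsE /=; exists A.
  rewrite -nbhs_ballE => -[e /= e0 xeA].
  have [k _ ke] : \forall k \near \oo, k.+1%:R^-1 < e / 2.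
    by apply: near_infty_natSinv_lt (PosNum (_ : 0 < e / 2)); rewrite divr_gt0.
  have {}ke := ke k (leqnn k).
  have /choice[q xq] : forall i, exists q : rat,
      `|x ord0 i - ratr q| < k.+1%:R^-1.
    move=> i; have /rat_in_itvoo[q] :
        x ord0 i - k.+1%:R^-1 < x ord0 i + k.+1%:R^-1.
      by rewrite ltrBlDr -addrA ltrDl addr_gt0 // invr_gt0.
    by move=> q1; exists q; rewrite distrC ltr_distl; rewrite in_itv /= in q1.
  exists (\row_i q i, k) => /=; last by move=> i /=; rewrite mxE.
  move=> y /= yq; apply: xeA; split => // a i; rewrite ord1.
  have := xq i; have := yq i; rewrite mxE distrC => h1 h2.
  apply: (le_lt_trans (ler_distD (ratr (q i)) _ _)).
  by rewrite (splitr e) ltrD // (lt_trans _ ke).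
rewrite [in X in measurable X]AE preimage_bigcup.
rewrite bigcup_mkcond; apply: countable_bigcupT_measurable => // p.
case: ifPn => // _; rewrite [X in measurable X](_ : _ =
  \bigcap_(i in [set: 'I_n]) ((fun t => f t ord0 i) @^-1`
    [set z | `|z - ratr (p.1 ord0 i)| < p.2.+1%:R^-1])); last first.
  by apply/seteqP; split=> [t /= tp i _|t /= tp i]; exact: tp.
apply: fin_bigcap_measurable => // i _.
rewrite -[X in measurable X]setTI; apply: mf => //.
rewrite [X in measurable X](_ : _ =
  `](ratr (p.1 ord0 i) - p.2.+1%:R^-1),
    (ratr (p.1 ord0 i) + p.2.+1%:R^-1)[%classic);
  first exact: measurable_itv.
by apply/seteqP; split=> z /=; rewrite in_itv /= ltr_distl.
Qed.

(* The isomorphism (v, a) |-> (a, v) of R^n x R with R^(n+1). *)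
Definition consr (n : nat) (va : 'rV[R]_n * R) : 'rV[R]_n.+1 :=
  \row_(i < n.+1) oapp (va.1 ord0) va.2 (unlift ord0 i).

Lemma measurable_consr (n : nat) :
  measurable_fun [set: 'rV[R]_n * R] (@consr n).
Proof.
apply: measurable_fun_rV => i.
under eq_fun do rewrite mxE.
case: (unlift ord0 i) => [j|] /=; last exact: measurable_snd.
exact: (measurableT_comp (measurable_coord ord0 j)).
Qed.

HB.instance Definition _ (n : nat) :=
  isMeasurableFun.Build _ _ _ _ (@consr n) (@measurable_consr n).

End borel.

Section lebesgue.
Context {R : realType}.

Section lebS.
Variables (n : nat) (m : {measure set 'rV[R]_n -> \bar R}).

Definition lebS : set 'rV[R]_n.+1 -> \bar R :=
  pushforward (m \x lebesgue_measure)%E (@consr R n).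

Let lebS0 : lebS set0 = 0%E.
Proof. by rewrite /lebS /pushforward preimage_set0 measure0. Qed.

Let lebS_ge0 A : (0 <= lebS A)%E.
Proof. by rewrite /lebS /pushforward. Qed.

Let lebS_sigma_additive : semi_sigma_additive lebS.
Proof.
exact: (@measure_semi_sigma_additive _ _ _
  (measure_function_pushforward__canonical__measure_function_Measure
    (m \x lebesgue_measure)%E (@measurable_consr R n))).
Qed.

HB.instance Definition _ := isMeasure.Build _ _ _ lebS
  lebS0 lebS_ge0 lebS_sigma_additive.
End lebS.

(* d-dimensional Lebesgue measure, as the d-fold product of the one-dimensional
   one; see leb_cbox for its value on boxes. *)
Fixpoint leb (n : nat) : {measure set 'rV[R]_n -> \bar R} :=
  if n is m.+1 then lebS (leb m) else \d_(0 : 'rV[R]_0).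

Definition cbox (n : nat) (a b : 'rV[R]_n) : set 'rV[R]_n :=
  [set x | forall i, a ord0 i <= x ord0 i <= b ord0 i].

Lemma measurable_cbox (n : nat) (a b : 'rV[R]_n) : measurable (cbox a b).
Proof.
rewrite (_ : cbox a b = \bigcap_(i in [set: 'I_n])
    ((fun x : 'rV[R]_n => x ord0 i) @^-1` `[a ord0 i, b ord0 i]%classic)).
  apply: fin_bigcap_measurable => // i _.
  by rewrite -[X in measurable X]setTI; apply: measurable_coord.
apply/seteqP; split=> [x xab i _|x xab i].
  by rewrite /= in_itv /=; exact: xab.
by have := xab i Logic.I; rewrite /= in_itv.
Qed.

Lemma leb_cbox (n : nat) (a b : 'rV[R]_n) :
  (forall i, a ord0 i <= b ord0 i) ->
  leb n (cbox a b) = (\prod_(i < n) (b ord0 i - a ord0 i))%:E.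
Proof.
elim: n a b => [a b _|n IH a b ab].
  by rewrite big_ord0 /= diracE mem_set //; case.
pose a' := \row_i a ord0 (lift ord0 i) : 'rV[R]_n.
pose b' := \row_i b ord0 (lift ord0 i) : 'rV[R]_n.
rewrite /= /lebS /pushforward.
rewrite [X in (_ \x _)%E X](_ : _ =
    cbox a' b' `*` `[a ord0 ord0, b ord0 ord0]%classic); last first.
  apply/seteqP; split=> [[v t] vt|[v t] /= [vab tab] i].
    split=> [i|] /=.
      by have := vt (lift ord0 i); rewrite !mxE liftK.
    by have := vt ord0; rewrite !mxE unlift_none in_itv.
  rewrite mxE; case: unliftP => [j ->|->] /=.
    by have := vab j; rewrite !mxE.
  by rewrite in_itv in tab.
rewrite product_measure1E //; last exact: measurable_cbox.
have -> : leb n (cbox a' b') = (\prod_(i < n) (b' ord0 i - a' ord0 i))%:E.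
  by apply: IH => i; rewrite !mxE.
rewrite [X in (_ * X)%E](@lebesgue_measure_itv R `[a ord0 ord0, b ord0 ord0]).
rewrite /= lte_fin.
rewrite big_ord_recl mulrC EFinM; congr (_%:E * _)%E.
  by apply: eq_bigr => i _; rewrite !mxE.
case: ltP => // ba.
by have /eqP -> : a ord0 ord0 == b ord0 ord0;
  [rewrite eq_le ab ba|rewrite subrr].
Qed.
End lebesgue.

(* Vectors of R^d are row vectors. The norm `|x| that the library puts on
   matrices is the max norm: it induces the same topology and the same bounded
   sets as the Euclidean norm enorm. *)
Section euclidean.
Context {R : realType}.

Definition dotp (d : nat) (x y : 'rV[R]_d) : R := \sum_(i < d) x 0 i * y 0 i.

Definition enorm (d : nat) (x : 'rV[R]_d) : R := Num.sqrt (dotp x x).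

(* The vector A x, for a row vector x. *)
Definition mxact (d : nat) (A : 'M[R]_d) (x : 'rV[R]_d) : 'rV[R]_d :=
  x *m A^T.

Definition symmetric_posdef (d : nat) (A : 'M[R]_d) : Prop :=
  A^T = A /\ forall x : 'rV[R]_d, x != 0 -> 0 < dotp x (mxact A x).

(* Largest eigenvalue; the set is finite, and for d > 0 it is non-empty when M
   is symmetric. *)
Definition emax (d : nat) (M : 'M[R]_d) : R := sup [set a | eigenvalue M a].

End euclidean.

Section wasserstein.
Context {R : realType} {d : nat}.
Local Notation E := 'rV[R]_d.
Local Open Scope ereal_scope.

Definition P2 (mu : probability E R) : Prop :=
  \int[mu]_x (enorm x ^+ 2)%:E < +oo.

Definition P2ac (mu : probability E R) : Prop := P2 mu /\ mu `<< leb d.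

Definition coupling (mu nu : probability E R) :
    set (probability (E * E)%type R) :=
  [set p | (forall A, measurable A -> p (A `*` [set: E]) = mu A) /\
           (forall B, measurable B -> p ([set: E] `*` B) = nu B)].

Definition W2 (mu nu : probability E R) : \bar R :=
  (ereal_inf [set \int[p]_z (enorm (z.1 - z.2) ^+ 2)%:E | p in coupling mu nu])
    `^ (2^-1).

Definition barycenter_obj (K : nat) (w : 'I_K -> R)
    (nu : 'I_K -> probability E R) (mu : probability E R) : \bar R :=
  \sum_(k < K) (w k)%:E * W2 mu (nu k) ^+ 2.

Definition is_barycenter (K : nat) (w : 'I_K -> R)
    (nu : 'I_K -> probability E R) (mu : probability E R) : Prop :=
  P2 mu /\
  forall mu', P2 mu' -> barycenter_obj w nu mu <= barycenter_obj w nu mu'.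

(* mu|_Y = mu (. `&` Y) / mu Y. When mu Y = 0 or Y is not measurable the
   value is the junk value mu; see truncateE. *)
Definition truncate (mu : probability E R) (Y : set E) : probability E R :=
  match pselect (measurable Y) with
  | left mY => mnormalize (mrestr mu mY) mu
  | right _ => mu
  end.

Lemma truncateE (mu : probability E R) (Y A : set E) :
  measurable Y -> mu Y != 0 ->
  truncate mu Y A = mu (A `&` Y) * (fine (mu Y))^-1%:E.
Proof.
move=> mY muY; rewrite /truncate; case: pselect => // mY'.
rewrite /= /mnormalize /= /mrestr setTI (negbTE muY) /=.
by rewrite lt_eqF // (le_lt_trans (probability_le1 mu mY)) // ltry.
Qed.

Definition supp (mu : probability E R) : set E :=
  [set x | forall U : set E, open U -> U x -> 0 < mu U].

Definition is_density (mu : probability E R) (f : E -> R) : Prop :=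
  [/\ measurable_fun [set: E] f, (forall x, (0 <= f x)%R) &
      forall A, measurable A -> mu A = \int[leb d]_(x in A) (f x)%:E].

End wasserstein.

Section classes.
Context {R : realType}.

(* Iterated partial derivative: pderiv [:: i1; ...; im] f is
   d_(i1) (... (d_(im) f)). *)
Definition pderiv (d : nat) (s : seq 'I_d) (f : 'rV[R]_d -> R) :
    'rV[R]_d -> R :=
  foldr (fun i (g : 'rV[R]_d -> R) => 'D_(delta_mx 0 i) g) f s.

(* f is q times continuously differentiable on the open set U. *)
Definition Cdiff (d q : nat) (U : set 'rV[R]_d) (f : 'rV[R]_d -> R) : Prop :=
  (forall (s : seq 'I_d) i x, (size s < q)%N -> U x ->
     derivable (pderiv s f) x (delta_mx 0 i)) /\
  (forall (s : seq 'I_d) x, (size s <= q)%N -> U x ->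
     {for x, continuous (pderiv s f)}).

(* f belongs to C^(q,alpha) (closure U), for a bounded open U. *)
Definition Cholder (d q : nat) (alpha : R) (U : set 'rV[R]_d)
    (f : 'rV[R]_d -> R) : Prop :=
  [/\ {within closure U, continuous f},
      Cdiff q U f,
      (forall s : seq 'I_d, (size s <= q)%N ->
         exists C : R, forall x, U x -> `|pderiv s f x| <= C) &
      (forall s : seq 'I_d, size s = q ->
         exists C : R, forall x y, U x -> U y ->
           `|pderiv s f x - pderiv s f y| <= C * enorm (x - y) `^ alpha)].

Definition Cholder_loc (d q : nat) (alpha : R) (f : 'rV[R]_d -> R) : Prop :=
  forall U : set 'rV[R]_d, open U -> bounded_set U -> Cholder q alpha U f.

Section boundary.
Context {d : nat}.
Local Notation E := 'rV[R]_d.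

(* Near x0, the open set Y is, up to relabelling and reorienting the axes, the
   strict epigraph of the C^m function h of the d-1 coordinates other than the
   i-th one. *)
Definition graph_chart (m : nat) (Y : set E) (x0 : E) (i : 'I_d) (o : bool)
    (r : R) (h : 'rV[R]_d.-1 -> R) : Prop :=
  [/\ 0 < r, Cdiff m setT h &
      forall x, enorm (x - x0) < r ->
        (Y x <-> h (col' i x) < (-1) ^+ o * x 0 i)].

Definition has_C_boundary (m : nat) (Y : set E) : Prop :=
  forall x0, (closure Y `\` Y°) x0 ->
    exists i o r h, graph_chart m Y x0 i o r h.

(* In a chart as above, the vector with coordinates t and dh(p).t is tangent to
   the graph of h above p, and the second fundamental form (with respect to the
   normal pointing out of the epigraph) is
   D^2h(p)[t,t] / sqrt (1 + |grad h(p)|^2) there. *)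
Definition tangent_sqnorm (h : 'rV[R]_d.-1 -> R) (p t : 'rV[R]_d.-1) : R :=
  dotp t t + (\sum_j t 0 j * pderiv [:: j] h p) ^+ 2.

Definition second_form (h : 'rV[R]_d.-1 -> R) (p t : 'rV[R]_d.-1) : R :=
  (\sum_j \sum_l t 0 j * t 0 l * pderiv [:: j; l] h p) /
  Num.sqrt (1 + \sum_j pderiv [:: j] h p ^+ 2).

(* Meaningful for Y with a C^2 boundary. The value of the second fundamental
   form does not depend on the chart. *)
Definition unif_convex (Y : set E) : Prop :=
  convex_set Y /\
  exists2 c : R, 0 < c &
    forall x0 i o r h, (closure Y `\` Y°) x0 -> graph_chart 2 Y x0 i o r h ->
      forall t,
        c * tangent_sqnorm h (col' i x0) t <= second_form h (col' i x0) t.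

Definition Sdom (q : nat) (Y : set E) : Prop :=
  [/\ Y !=set0, open Y, bounded_set Y, has_C_boundary q.+2 Y & unif_convex Y].

Definition Sclass (q : nat) (S : set E) : Prop :=
  exists2 Y, Sdom q Y & S = closure Y.

Definition Mclass (q : nat) (mu : probability E R) : Prop :=
  P2ac mu /\
  exists Y f alpha zeta,
    [/\ Sdom q Y /\ supp mu = closure Y,
        is_density mu f,
        0 < alpha < 1 /\ Cholder q alpha Y f &
        1 <= zeta /\ forall x, supp mu x -> zeta^-1 <= f x <= zeta].

Definition Mfull (q : nat) (rho : probability E R) : Prop :=
  [/\ P2ac rho, supp rho = setT &
      exists f alpha,
        [/\ is_density rho f, (forall x, 0 < f x),
            0 < alpha < 1 & Cholder_loc q alpha f]].

End boundary.
End classes.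

(* Inputs of the generation procedure other than mubar, TRUNCATE and the sets
   Y_k. The index set {1, ..., Kt, -1, ..., -Kt} is 'I_Kt + 'I_Kt, with inl i
   for i and inr i for -i. *)
Record gen_input (R : realType) (d : nat) := GenInput {
  gK : nat;
  gw : 'I_gK -> R;
  gKt : nat;
  glam : 'I_gKt -> R;
  ggam : 'I_gKt -> R;
  galp : 'I_gKt -> R;
  gn : 'I_gKt -> nat;
  gg : forall i, 'I_(gn i) -> R;
  gy : forall i, 'I_(gn i) -> 'rV[R]_d;
  gLam : 'I_gKt -> R;
  gPhi : 'I_gKt + 'I_gKt -> 'I_gK;
  gA : 'I_gK -> 'M[R]_d;
  gb : 'I_gK -> 'rV[R]_d;
  gxi : R
}.
Arguments gw {R d} g.
Arguments glam {R d} g.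
Arguments ggam {R d} g.
Arguments galp {R d} g.
Arguments gn {R d} g.
Arguments gg {R d} g.
Arguments gy {R d} g.
Arguments gLam {R d} g.
Arguments gPhi {R d} g.
Arguments gA {R d} g.
Arguments gb {R d} g.

Section procedure.
Context {R : realType} {d : nat} (D : gen_input R d).
Local Notation E := 'rV[R]_d.
Local Notation idx := ('I_(gKt D) + 'I_(gKt D))%type.

Definition score (i : 'I_(gKt D)) (j : 'I_(gn D i)) (x : E) : R :=
  expR ((gg D i j + dotp (gy D i j) x) / ggam D i).

(* The transpose of the column vector eta_i(x). *)
Definition eta (i : 'I_(gKt D)) (x : E) : 'rV[R]_(gn D i) :=
  \row_j (score j x / \sum_(j' < gn D i) score j' x).

Definition Ymx (i : 'I_(gKt D)) : 'M[R]_(d, gn D i) :=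
  \matrix_(a, j) gy D i j 0 a.

Definition softcov (i : 'I_(gKt D)) (x : E) : 'M[R]_d :=
  Ymx i *m (diag_mx (eta i x) - (eta i x)^T *m eta i x) *m (Ymx i)^T.

(* In the choice of gLam the maximum over x of the largest eigenvalue need not
   be attained, so it is read as a supremum. The natural numbers gn D i are
   positive: eta_i is undefined otherwise. *)
Definition gen_valid : Prop :=
  [/\ [/\ (2 <= gK D)%N, (2 <= gKt D)%N & (gK D <= 2 * gKt D)%N],
      (forall k, 0 < gw D k) /\ \sum_k gw D k = 1,
      (forall i, [/\ 0 < glam D i, 0 < ggam D i, 0 < galp D i &
                     (0 < gn D i)%N]),
      (forall k, exists s, gPhi D s = k) &
      [/\ (forall k, symmetric_posdef (gA D k)),
          \sum_k gw D k *: gA D k = 1%:M,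
          \sum_k gw D k *: gb D k = 0,
          0 <= gxi D < 1 &
          forall i,
            (ggam D i)^-1 * sup (range (fun x => emax (softcov i x)))
              + 2 * glam D i <= gLam D i]].

Definition Tplus (i : 'I_(gKt D)) (x : E) : E :=
  \sum_(j < gn D i) eta i x 0 j *: gy D i j + glam D i *: x.

Definition Ttil (s : idx) (x : E) : E :=
  match s with
  | inl i => Tplus i x
  | inr i => gLam D i *: x - Tplus i x
  end.

Definition betaminus (i : 'I_(gKt D)) : R :=
  (1 - gxi D) * galp D i /
  \sum_(i' < gKt D) gw D (gPhi D (inr i')) * galp D i' * gLam D i'.

Definition betaw (s : idx) : R :=
  match s with
  | inl i => gw D (gPhi D (inr i)) / gw D (gPhi D (inl i)) * betaminus i
  | inr i => betaminus i
  end.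

Definition Tmap (k : 'I_(gK D)) (x : E) : E :=
  \sum_(s : idx | gPhi D s == k) betaw s *: Ttil s x
    + gxi D *: (mxact (gA D k) x + gb D k).

Lemma measurable_dotp (y : E) : measurable_fun [set: E] (dotp y).
Proof.
apply: measurable_sum => i; apply: measurable_funM => //.
exact: measurable_coord.
Qed.

Lemma measurable_score (i : 'I_(gKt D)) (j : 'I_(gn D i)) :
  measurable_fun [set: E] (score j).
Proof.
apply: (measurableT_comp (@measurable_expR R)).
apply: measurable_funM => //; apply: measurable_funD => //.
exact: measurable_dotp.
Qed.

Lemma measurable_eta (i : 'I_(gKt D)) (j : 'I_(gn D i)) :
  measurable_fun [set: E] (fun x => eta i x 0 j).
Proof.
under eq_fun do rewrite mxE.
apply: measurable_funM; first exact: measurable_score.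
have sum_ge0 x : 0 <= \sum_(j' < gn D i) score j' x.
  by apply: sumr_ge0 => j' _; exact: expR_ge0.
under eq_fun do rewrite -powR_inv1 //.
apply: (measurableT_comp (measurable_powR _)).
by apply: measurable_sum => j'; exact: measurable_score.
Qed.

Lemma measurable_Tplus (i : 'I_(gKt D)) (a : 'I_d) :
  measurable_fun [set: E] (fun x => Tplus i x 0 a).
Proof.
under eq_fun do rewrite mxE summxE mxE.
apply: measurable_funD; last first.
  apply: measurable_funM => //; exact: measurable_coord.
apply: measurable_sum => j; under eq_fun do rewrite mxE.
apply: measurable_funM => //; exact: measurable_eta.
Qed.

Lemma measurable_Ttil (s : idx) (a : 'I_d) :
  measurable_fun [set: E] (fun x => Ttil s x 0 a).
Proof.
case: s => i /=; first exact: measurable_Tplus.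
under eq_fun do rewrite mxE mxE mxE.
apply: measurable_funB; last exact: measurable_Tplus.
apply: measurable_funM => //; exact: measurable_coord.
Qed.

Lemma measurable_Tmap (k : 'I_(gK D)) : measurable_fun [set: E] (Tmap k).
Proof.
apply: measurable_fun_rV => a.
under eq_fun do rewrite mxE summxE mxE mxE [in X in _ + X]mxE.
apply: measurable_funD.
  under eq_fun do rewrite big_mkcond /=.
  apply: measurable_sum => s; case: (gPhi D s == k); last exact: measurable_cst.
  under eq_fun do rewrite mxE.
  by apply: measurable_funM => //; exact: measurable_Ttil.
apply: measurable_funM => //; apply: measurable_funD => //.
apply: measurable_sum => b; apply: measurable_funM => //.
exact: measurable_coord.
Qed.

HB.instance Definition _ (k : 'I_(gK D)) :=
  isMeasurableFun.Build _ _ _ _ (Tmap k) (measurable_Tmap k).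

Context (mub : probability E R).

(* T_k # mubar *)
Definition pik (k : 'I_(gK D)) : probability E R := distribution mub (Tmap k).

Definition nuk (trunc : bool) (Y : 'I_(gK D) -> set E) (k : 'I_(gK D)) :
    probability E R :=
  if trunc then truncate (pik k) (Y k) else pik k.

Definition Vobj (trunc : bool) (Y : 'I_(gK D) -> set E)
    (mu : probability E R) : \bar R :=
  barycenter_obj (gw D) (nuk trunc Y) mu.

Definition Vinf (trunc : bool) (Y : 'I_(gK D) -> set E) : \bar R :=
  ereal_inf [set Vobj trunc Y mu | mu in [set mu | P2 mu]].

Definition Vmin : \bar R :=
  \int[mub]_x (\sum_(k < gK D) gw D k * enorm (x - Tmap k x) ^+ 2)%:E.

Definition phiplus (i : 'I_(gKt D)) (x : E) : R :=
  ggam D i * ln (\sum_(j < gn D i) score j x) + glam D i / 2 * enorm x ^+ 2.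

Definition phitil (s : idx) (x : E) : R :=
  match s with
  | inl i => phiplus i x
  | inr i => gLam D i / 2 * enorm x ^+ 2 - phiplus i x
  end.

Definition phik (k : 'I_(gK D)) (x : E) : R :=
  \sum_(s : idx | gPhi D s == k) betaw s * phitil s x
    + gxi D * dotp (2^-1 *: mxact (gA D k) x + gb D k) x.

Definition phik_conj (k : 'I_(gK D)) (y : E) : \bar R :=
  ereal_sup (range (fun x => (dotp y x - phik k x)%:E)).

Definition hk (k : 'I_(gK D)) (Y : set E) (x : E) : R :=
  (1 - fine (pik k Y)) / fine (pik k Y) + \1_(~` Y) x.

Local Open Scope ereal_scope.

Definition eps1 (k : 'I_(gK D)) (Y : set E) : \bar R :=
  \int[pik k]_x (2 * enorm x ^+ 2 * hk k Y x)%:E.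

Definition eps2 (k : 'I_(gK D)) (Y : set E) : \bar R :=
  \int[pik k]_x
    (`| (enorm x ^+ 2)%:E - 2%:E * phik_conj k x | * (hk k Y x)%:E).

Definition epsilon (Y : 'I_(gK D) -> set E) : \bar R :=
  \sum_(k < gK D) (gw D k)%:E *
    (2%:E * W2 mub (pik k) * eps1 k (Y k) `^ 2^-1
     + eps1 k (Y k) + eps2 k (Y k)).

End procedure.

(* Main.v *)
(** With c > 0 a strong monotonicity modulus of T_k = grad phi_k, the functions
    a_k(x) = |x|^2 - 2 phi_k(x) and b_k(y) = |y|^2 - 2 phi_k^*(y) satisfy
    a_k(x) + b_k(y) + c |x - T_k^(-1) y|^2 <= |x - y|^2, with equality when
    y = T_k x, and sum_k w_k a_k = 0. Hence V(mu) >= sum_k w_k int b_k dnu_k for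
    every mu, with equality for nu_k = pi_k and mu = mubar; the quadratic gap
    forces uniqueness. After truncation the lower bound moves by at most
    sum_k w_k eps_(2,k), and V(mubar) by at most the remaining part of epsilon,
    by coupling mubar with nu_k so that T_k x is kept whenever it lies in Y_k.
    Absolute continuity and the density of nu_k come from the change of
    variables along T_k, proved by induction on the dimension by integrating
    one coordinate at a time, which for strongly monotone maps needs neither
    the inverse function theorem nor a covering argument. *)

From HB Require Import structures.
Require Import Defs.
From mathcomp Require Import all_boot all_order all_algebra.
From mathcomp Require Import all_classical all_reals all_analysis.
From mathcomp Require Import measurable_realfun.
From mathcomp Require Import perm ring lra.

Set Implicit Arguments.
Unset Strict Implicit.
Unset Printing Implicit Defensive.

Import Order.TTheory GRing.Theory Num.Theory.
Import numFieldNormedType.Exports.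

Local Open Scope classical_set_scope.
Local Open Scope ring_scope.


(** The modulus c of T_k is the sum of beta_s lambda_|s| over the indices s sent to k. The condition
    on the upper lambda_i leaves the potential of index -i as strongly convex as that of index i,
    and surjectivity of Phi makes the sum non-empty. The betas are such that the log-sum-exp terms
    of i and -i cancel in sum_k w_k phi_k, which becomes |x|^2 / 2; this is the identity sum_k w_k
    a_k = 0. Existence of optimal couplings is never established. Uniqueness is drawn from nearly
    optimal ones: the gap makes |x - T_k^(-1) y| small in mean square, and laws that can be coupled
    at arbitrarily small cost agree on closed sets. Likewise the square root in epsilon comes from
    Young's inequality with an almost optimal parameter. The induction on the dimension works
    because freezing one coordinate of a strongly monotone map leaves a strongly monotone map with
    the same c. The same c makes the inverse globally Lipschitz, which starts the bootstrap for its
    higher derivatives and keeps the Hoelder exponent under composition. *)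

Lemma sum_continuous (R : realType) (T : topologicalType) (I : Type)
    (r : seq I) (P : pred I) (F : I -> T -> R) :
  (forall i, P i -> continuous (F i)) ->
  continuous (fun x => \sum_(i <- r | P i) F i x).
Proof.
apply: (@continuous_big R I +%R 0 P _ T r F).
by move=> x; exact: (@pseudometric_normed_Zmodule.add_continuous R R x).
Qed.

Lemma continuous_atP (R : realType) (V W : normedModType R) (f : V -> W) (x : V) :
  {for x, continuous f} <->
  (forall e : R, 0 < e -> exists2 r : R, 0 < r &
    forall y, `|y - x| < r -> `|f y - f x| < e).
Proof.
split=> [/cvgrPdist_lt cf e e0|h].
  have /nbhs_ballP[r /= r0 xr] := cf e e0.
  exists r => // y yx; rewrite distrC; apply: xr.
  by rewrite -ball_normE /ball_/= distrC.
apply/cvgrPdist_lt => e /h[r r0 xr]; apply/nbhs_ballP; exists r => //= y.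
by rewrite -ball_normE /ball_/= distrC [X in _ -> X < _]distrC => /xr.
Qed.

(** * Scalar product, Euclidean norm and max norm *)

Section euclidean_space.
Context {R : realType} {d : nat}.
Implicit Types x y z : 'rV[R]_d.

Lemma dotpC x y : dotp x y = dotp y x.
Proof. by apply: eq_bigr => i _; rewrite mulrC. Qed.

Lemma dotpDl x y z : dotp (x + y) z = dotp x z + dotp y z.
Proof. by rewrite -big_split; apply: eq_bigr => i _; rewrite mxE mulrDl. Qed.

Lemma dotpZl (a : R) x y : dotp (a *: x) y = a * dotp x y.
Proof. by rewrite big_distrr; apply: eq_bigr => i _ /=; rewrite mxE mulrA. Qed.

Lemma dotpNl x y : dotp (- x) y = - dotp x y.
Proof. by rewrite -scaleN1r dotpZl mulN1r. Qed.

Lemma dotpBl x y z : dotp (x - y) z = dotp x z - dotp y z.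
Proof. by rewrite dotpDl dotpNl. Qed.

Lemma dotp0l y : dotp 0 y = 0.
Proof. by rewrite -(scale0r (0 : 'rV[R]_d)) dotpZl mul0r. Qed.

Lemma dotpDr x y z : dotp x (y + z) = dotp x y + dotp x z.
Proof. by rewrite dotpC dotpDl !(dotpC x). Qed.

Lemma dotpZr (a : R) x y : dotp x (a *: y) = a * dotp x y.
Proof. by rewrite dotpC dotpZl dotpC. Qed.

Lemma dotpNr x y : dotp x (- y) = - dotp x y.
Proof. by rewrite dotpC dotpNl dotpC. Qed.

Lemma dotpBr x y z : dotp x (y - z) = dotp x y - dotp x z.
Proof. by rewrite dotpDr dotpNr. Qed.

Lemma dotp0r x : dotp x 0 = 0. Proof. by rewrite dotpC dotp0l. Qed.

Lemma dotp_suml (I : Type) (r : seq I) (P : pred I) (F : I -> 'rV[R]_d) y :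
  dotp (\sum_(i <- r | P i) F i) y = \sum_(i <- r | P i) dotp (F i) y.
Proof. by elim/big_ind2: _ => [|? ? ? ? <- <-|]; rewrite ?dotp0l ?dotpDl. Qed.

Lemma dotp_sqr_ge0 x : 0 <= dotp x x.
Proof. by apply: sumr_ge0 => i _; rewrite -expr2 sqr_ge0. Qed.

Lemma dotp_sqr_eq0 x : (dotp x x == 0) = (x == 0).
Proof.
apply/idP/eqP => [|->]; last by rewrite dotp0l.
rewrite psumr_eq0 => [/allP x0|i _]; last by rewrite -expr2 sqr_ge0.
apply/rowP => i; rewrite mxE; apply/eqP.
by have := x0 i (mem_index_enum _); rewrite mulf_eq0 orbb.
Qed.

Lemma enorm_sqr x : enorm x ^+ 2 = dotp x x.
Proof. by rewrite sqr_sqrtr // dotp_sqr_ge0. Qed.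

Lemma enorm_ge0 x : 0 <= enorm x. Proof. exact: sqrtr_ge0. Qed.

Lemma enormN x : enorm (- x) = enorm x.
Proof. by rewrite /enorm dotpNl dotpNr opprK. Qed.

Lemma enorm_distC x y : enorm (x - y) = enorm (y - x).
Proof. by rewrite -enormN opprB. Qed.

Lemma enormZ (a : R) x : enorm (a *: x) = `|a| * enorm x.
Proof. by rewrite /enorm dotpZl dotpZr mulrA -expr2 sqrtrM ?sqr_ge0// sqrtr_sqr. Qed.

(* Expand [|t x - y|^2 >= 0] and optimize over [t]. *)
Lemma dotp_young (t : R) x y : 0 < t ->
  2 * dotp x y <= t * dotp x x + t^-1 * dotp y y.
Proof.
move=> t0; have := dotp_sqr_ge0 (t *: x - y).
rewrite dotpBl !dotpBr !dotpZl !dotpZr (dotpC y x) => h.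
rewrite -(ler_pM2l t0) mulrDr mulVKf ?gt_eqF//; lra.
Qed.

Lemma dotp_le x y : dotp x y <= enorm x * enorm y.
Proof.
have [->|x0] := eqVneq x 0; first by rewrite dotp0l mulr_ge0 ?enorm_ge0.
have [->|y0] := eqVneq y 0; first by rewrite dotp0r mulr_ge0 ?enorm_ge0.
have p z : z != 0 -> 0 < enorm z.
  by move=> z0; rewrite sqrtr_gt0 lt_neqAle eq_sym dotp_sqr_eq0 z0 dotp_sqr_ge0.
have {}x0 := p _ x0; have {}y0 := p _ y0.
(* This parameter balances the two terms of Young's inequality, which then becomes
   Cauchy-Schwarz. *)
have := dotp_young x y (divr_gt0 y0 x0); rewrite invf_div -!enorm_sqr => h.
have -> : enorm x * enorm y = 2^-1 * (enorm y / enorm x * enorm x ^+ 2 +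
    enorm x / enorm y * enorm y ^+ 2) by field; rewrite ?gt_eqF.
lra.
Qed.

Lemma coord_le_norm x i : `|x 0 i| <= `|x|.
Proof.
rewrite [`|x|]/Num.Def.normr/= mx_normrE.
exact: (le_bigmax _ (fun ij => `|x ij.1 ij.2|) (0, i)).
Qed.

Lemma norm_le_coord x (M : R) : 0 <= M -> (forall i, `|x 0 i| <= M) -> `|x| <= M.
Proof.
move=> M0 xM; rewrite [`|x|]/Num.Def.normr/= mx_normrE.
by apply/bigmax_leP; split=> // -[a i] _; rewrite ord1.
Qed.

Lemma norm_le_enorm x : `|x| <= enorm x.
Proof.
apply: norm_le_coord => [|i]; first exact: enorm_ge0.
rewrite -sqrtr_sqr ler_sqrt ?dotp_sqr_ge0//.
rewrite /dotp (bigD1 i)//= -expr2 lerDl.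
by apply: sumr_ge0 => j _; rewrite -expr2 sqr_ge0.
Qed.

Lemma dotp_le_norm x y : `|dotp x y| <= d%:R * (`|x| * `|y|).
Proof.
apply: (le_trans (ler_norm_sum _ _ _)).
apply: (@le_trans _ _ (\sum_(i < d) `|x| * `|y|)).
  by apply: ler_sum => i _; rewrite normrM ler_pM// coord_le_norm.
by rewrite sumr_const card_ord mulr_natl.
Qed.

Lemma enorm_le_norm x : enorm x <= Num.sqrt d%:R * `|x|.
Proof.
have -> : `|x| = Num.sqrt (`|x| ^+ 2) by rewrite sqrtr_sqr normr_id.
rewrite -sqrtrM ?ler0n// ler_sqrt ?mulr_ge0 ?ler0n ?sqr_ge0//.
by apply: le_trans (ler_norm _) _; rewrite expr2 dotp_le_norm.
Qed.

End euclidean_space.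


Lemma continuous_row (R : realType) (V : normedModType R) (n : nat)
    (f : V -> 'rV[R]_n) :
  (forall i, continuous (fun x => f x 0 i)) -> continuous f.
Proof.
move=> cf x; apply/continuous_atP => e e0.
have e20 : 0 < e / 2 by rewrite divr_gt0.
have /choice[r r0] i : exists r : R,
    0 < r /\ forall y, `|y - x| < r -> `|f y 0 i - f x 0 i| < e / 2.
  by have /continuous_atP/(_ _ e20)[r r0 H] := cf i x; exists r.
exists (\big[Num.min/1]_i r i).
  by apply/bigmin_gtP; split => // i _; case: (r0 i).
move=> y /bigmin_gtP[_ yx].
apply: (@le_lt_trans _ _ (e / 2)); last by rewrite gtr_pMr// invf_lt1// ltr1n.
apply: norm_le_coord => [|i]; first exact: ltW.
by rewrite !mxE ltW//; case: (r0 i) => _; apply; exact: yx.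
Qed.

Lemma continuous_measurable_mxreal (R : realType) (d : nat) (f : 'rV[R]_d -> R) :
  continuous f -> measurable_fun [set: 'rV[R]_d] f.
Proof.
move=> cf; apply: (measurability _ (RGenOpens.measurableE R)).
move=> _ [_ [a [b ->] <-]]; rewrite setTI; apply: open_measurable_mx.
by move/continuousP : cf; apply; exact: interval_open.
Qed.

(** * Measures with a density and iterated integrals *)

Section density_measure.
Local Open Scope ereal_scope.
Context dT (T : measurableType dT) (R : realType).
Variables (m : {measure set T -> \bar R}) (g : T -> R).
Hypotheses (mg : measurable_fun [set: T] g) (g0 : forall x, (0 <= g x)%R).

Import HBNNSimple.

(** Both sides pass to increasing limits of simple functions and agree on indicators by hypothesis.
    [nu] is any measure with the prescribed values, so that laws built otherwise, such as truncated
    ones, are covered. *)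
Lemma ge0_integral_density (nu : {measure set T -> \bar R}) (h : T -> \bar R) :
  (forall A, measurable A -> nu A = \int[m]_(x in A) (g x)%:E) ->
  measurable_fun [set: T] h -> (forall x, 0 <= h x) ->
  \int[nu]_x h x = \int[m]_x (h x * (g x)%:E).
Proof.
move=> nuE mh h0.
pose h_ := nnsfun_approx measurableT mh.
have -> : \int[nu]_x h x = limn (fun n => \int[nu]_x (h_ n x)%:E).
  rewrite -monotone_convergence//.
  - apply: eq_integral => y _; apply/esym/cvg_lim => //.
    exact: cvg_nnsfun_approx.
  - by move=> n; exact/measurable_EFinP/measurable_funP.
  - by move=> n y _; rewrite lee_fin.
  - by move=> y _ i j ij; rewrite lee_fin; exact/lefP/nd_nnsfun_approx.
have -> : \int[m]_x (h x * (g x)%:E) =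
    limn (fun n => \int[m]_x ((h_ n x)%:E * (g x)%:E)).
  rewrite -monotone_convergence//.
  - apply: eq_integral => y _; apply/esym/cvg_lim => //.
    by apply: cvgeZr => //; exact: cvg_nnsfun_approx.
  - move=> n; apply: emeasurable_funM; apply/measurable_EFinP => //.
  - by move=> n y _; rewrite mule_ge0// lee_fin.
  - move=> y _ i j ij; rewrite lee_wpmul2r ?lee_fin//.
    exact/lefP/nd_nnsfun_approx.
suff intE n : \int[nu]_x (h_ n x)%:E = \int[m]_x ((h_ n x)%:E * (g x)%:E).
  by under eq_fun do rewrite intE.
transitivity (\int[nu]_x (\sum_(y \in range (h_ n))
    (y * \1_(h_ n @^-1` [set y]) x)%:E)).
  by apply: eq_integral => t _; rewrite /= fimfunE -fsumEFin.
have mi r : measurable_fun [set: T] (fun x => (r * \1_(h_ n @^-1` [set r]) x)%:E).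
  by apply/measurable_EFinP; exact: measurable_funM.
rewrite ge0_integral_fsum//; last by move=> r y _; exact: nnfun_muleindic_ge0.
transitivity (\int[m]_x (\sum_(y \in range (h_ n))
    (y * \1_(h_ n @^-1` [set y]) x)%:E * (g x)%:E)); last first.
  apply: eq_integral => t _.
  rewrite -ge0_mule_fsuml => [|y]; last exact: nnfun_muleindic_ge0.
  by rewrite fsumEFin// -(fimfunE _ t).
rewrite ge0_integral_fsum//; last 2 first.
  - by move=> r; apply: emeasurable_funM => //; exact/measurable_EFinP.
  - by move=> r y _; rewrite mule_ge0// ?lee_fin//; exact: nnfun_muleindic_ge0.
apply: eq_fsbigr => r /[!inE] -[t _ rE].
have r0 : (0 <= r)%R by rewrite -rE.
have mA : measurable (h_ n @^-1` [set r]) by exact: measurable_sfunP.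
under eq_integral do rewrite EFinM.
under [RHS]eq_integral do rewrite EFinM -muleA.
rewrite !ge0_integralZl ?lee_fin//; last 3 first.
- by apply: emeasurable_funM; exact/measurable_EFinP.
- by move=> x _; rewrite mule_ge0 ?lee_fin.
- exact/measurable_EFinP.
congr (_ * _); rewrite integral_indic// setIT nuE//.
rewrite integral_mkcond; apply: eq_integral => x _.
by rewrite patchE indicE; case: ifP => _; rewrite ?mul1e ?mul0e.
Qed.

Lemma exists_density_measure : exists nu : {measure set T -> \bar R},
  forall A, nu A = \int[m]_(x in A) (g x)%:E.
Proof.
pose nu (A : set T) := \int[m]_(x in A) (g x)%:E.
have nu0 : nu set0 = 0 by exact: integral_set0.
have nu_ge0 A : 0 <= nu A by apply: integral_ge0 => x _; rewrite lee_fin.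
have nu_sigma : semi_sigma_additive nu.
  move=> F mF tF mUF; rewrite /nu; apply: cvg_toP.
    apply: ereal_nondecreasing_is_cvgn => i j ij.
    apply: lee_sum_nneg_natr => // k _ _; apply: integral_ge0 => x _.
    by rewrite lee_fin.
  rewrite ge0_integral_bigcup//.
  - exact/measurable_funTS/measurable_EFinP.
  - by move=> x _; rewrite lee_fin.
pose nuM := isMeasure.Build _ _ _ nu nu0 nu_ge0 nu_sigma.
pose nu' : {measure set T -> \bar R} := HB.pack nu nuM.
by exists nu'.
Qed.

End density_measure.

(* [leb n] carries no sigma-finite structure; this repackages it so that the
   Fubini-Tonelli theorems apply. *)
Lemma sigma_finite_measureP dT (T : measurableType dT) (R : realType)
    (m : {measure set T -> \bar R}) :
  sigma_finite [set: T] m ->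
  exists m' : {sigma_finite_measure set T -> \bar R},
    m = m' :> {measure set T -> \bar R}.
Proof.
case: m => m [h1 h2] sf.
pose m1 : {measure set T -> \bar R} := HB.pack m h1 h2.
pose m2 : {sigma_finite_measure set T -> \bar R} :=
  HB.pack m h1 h2 (Measure_isSigmaFinite.Build _ _ _ m1 sf).
by exists m2; reflexivity.
Qed.

Section integration_leb.
Context {R : realType}.
Local Open Scope ereal_scope.

Lemma leb_sigma_finite n : sigma_finite [set: 'rV[R]_n] (leb n).
Proof.
exists (fun k => cbox (const_mx (- k%:R)%R) (const_mx k%:R%R)) => [|k]; last first.
  split; first exact: measurable_cbox.
  rewrite leb_cbox ?ltry// => i; rewrite !mxE.
  by rewrite (@le_trans _ _ 0%R)// ?oppr_le0 ler0n.
apply/esym/seteqP; split=> // x _; exists (Num.Def.truncn `|x|).+1 => // i.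
rewrite !mxE -ler_norml (le_trans (coord_le_norm x i))//.
by apply/ltW; exact: truncnS_gt.
Qed.

Section iterated.
Variables (n : nat) (F : 'rV[R]_n.+1 -> \bar R).
Hypotheses (mF : measurable_fun [set: 'rV[R]_n.+1] F) (F0 : forall x, 0 <= F x).

Let mFc : measurable_fun [set: 'rV[R]_n * R] (F \o @consr R n).
Proof. exact: measurableT_comp mF (@measurable_consr R n). Qed.

Let integral_lebS : \int[leb n.+1]_x F x =
  \int[leb n \x @lebesgue_measure R]_z (F \o @consr R n) z.
Proof.
by rewrite /= /lebS ge0_integral_pushforward//; exact: measurable_consr.
Qed.

Lemma integral_lebS_col :
  \int[leb n.+1]_x F x =
  \int[@lebesgue_measure R]_a \int[leb n]_v F (consr (v, a)).
Proof.
rewrite integral_lebS; have [m ->] := sigma_finite_measureP (leb_sigma_finite n).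
by rewrite fubini_tonelli2//= => z; exact: F0.
Qed.

Lemma integral_lebS_row :
  \int[leb n.+1]_x F x =
  \int[leb n]_v \int[@lebesgue_measure R]_a F (consr (v, a)).
Proof.
rewrite integral_lebS; have [m ->] := sigma_finite_measureP (leb_sigma_finite n).
by rewrite fubini_tonelli1//= => z; exact: F0.
Qed.
End iterated.

Lemma integral_swap_leb n (G : 'rV[R]_n * R -> \bar R) :
  measurable_fun [set: 'rV[R]_n * R] G -> (forall z, 0 <= G z) ->
  \int[@lebesgue_measure R]_a \int[leb n]_v G (v, a) =
  \int[leb n]_v \int[@lebesgue_measure R]_a G (v, a).
Proof.
move=> mG G0.
have [m ->] := sigma_finite_measureP (leb_sigma_finite n).
by rewrite -(@fubini_tonelli _ _ _ _ R m (@lebesgue_measure R) G).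
Qed.

End integration_leb.

(** * Substitution on the line *)

Lemma strictly_increasing_surj (R : realType) (q : R -> R) (c : R) :
  0 < c -> continuous q ->
  (forall a b, a <= b -> c * (b - a) <= q b - q a) ->
  forall y, exists x, q x = y.
Proof.
move=> c0 cq q_incr y.
(* Growth at rate [c] carries [q] from q 0 past [y] within distance [r], on either side. *)
pose r := `|y - q 0| / c.
have r0 : 0 <= r by rewrite divr_ge0// ltW.
have h1 : y - q 0 <= c * r by rewrite mulrC divfK ?gt_eqF// ler_norm.
have h2 : q 0 - y <= c * r.
  by rewrite mulrC divfK ?gt_eqF// distrC ler_norm.
have := q_incr _ _ r0; rewrite subr0 => h3.
have := q_incr (- r) 0; rewrite oppr_le0 sub0r opprK => /(_ r0) h4.
have rr : - r <= r by rewrite (le_trans _ r0)// oppr_le0.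
have [||x _ <-] := @IVT R q (- r) r y rr; last by exists x.
- exact: continuous_subspaceT.
- rewrite ge_min le_max; apply/andP; split; apply/orP; [left|right]; lra.
Qed.

Section substitution_line.
Context {R : realType}.
Variables (q dq : R -> R) (c : R).
Hypotheses (c0 : 0 < c) (q_dq : forall x : R, is_derive x (1:R) q (dq x)).
Hypotheses (cdq : continuous dq) (c_le : forall x, c <= dq x).

Let cq : continuous q.
Proof.
move=> x; apply: differentiable_continuous; apply/derivable1_diffP.
by have [] := q_dq x.
Qed.

Let q_incr a b : a <= b -> c * (b - a) <= q b - q a.
Proof.
move=> ab.
have [//|x _ ->] := MVT_segment ab (fun x _ => q_dq x).
  exact: continuous_subspaceT.
by rewrite ler_wpM2r// subr_ge0.
Qed.

Let q_lt a b : (q a < q b) = (a < b).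
Proof.
have h u v : u < v -> q u < q v.
  move=> uv; rewrite -subr_gt0 (lt_le_trans _ (q_incr (ltW uv)))//.
  by rewrite mulr_gt0// subr_gt0.
have [/h//|ba|->] := ltgtP a b; last by rewrite ltxx.
by apply/negbTE; rewrite -leNgt ltW// h.
Qed.

Let q_surj y : exists x, q x = y.
Proof. exact: strictly_increasing_surj c0 cq q_incr y. Qed.

(** The measure with density [dq], pushed forward by [q], gives []a, b]] mass b - a by the
    fundamental theorem of calculus, and this characterizes Lebesgue measure. *)
Lemma integral_substitution_line (F : R -> \bar R) :
  measurable_fun [set: R] F -> (forall x, 0 <= F x)%E ->
  (\int[@lebesgue_measure R]_x (F (q x) * (dq x)%:E) =
   \int[@lebesgue_measure R]_x F x)%E.
Proof.
move=> mF F0.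
have mdq : measurable_fun [set: R] dq by exact: continuous_measurable_fun.
have mq : measurable_fun [set: R] q by exact: continuous_measurable_fun.
have dq0 x : 0 <= dq x by rewrite (le_trans _ (c_le x))// ltW.
have mq' : measurable_fun [set: measurableTypeR R]
    (q : measurableTypeR R -> measurableTypeR R) by exact: mq.
have [nu nuE] := exists_density_measure (@lebesgue_measure R) mdq dq0.
pose nuq : {measure set (measurableTypeR R) -> \bar R} :=
  measure_function_pushforward__canonical__measure_function_Measure nu mq'.
have lebE A : measurable A -> (@lebesgue_measure R A = nuq A)%E.
  apply: lebesgue_measure_unique => _ [[a b] _ <-] /=.
  have [p pa] := q_surj a; have [p' pb] := q_surj b.
  have -> : nuq `]a, b]%classic = nu `]p, p']%classic.
    rewrite /nuq/= /pushforward; congr (nu _).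
    apply/seteqP; split=> x /=; rewrite !in_itv/= -pa -pb q_lt !leNgt q_lt//.
  rewrite nuE lebesgue_measure_itv/= lte_fin -{1}pa -{1}pb q_lt.
  case: ltP => pp'; last by rewrite set_itv_ge ?integral_set0// bnd_simp -leNgt.
  rewrite integral_itv_obnd_cbnd; last exact/measurable_EFinP/measurable_funTS.
  rewrite (@continuous_FTC2 R dq q p p')//.
  - by rewrite pa pb.
  - exact: continuous_subspaceT.
  - split; first by move=> x _; have [] := q_dq x.
    + by apply: cvg_at_right_filter; exact: cq.
    + by apply: cvg_at_left_filter; exact: cq.
  - by move=> x _; rewrite derive1E; have [] := q_dq x.
have E1 := @ge0_integral_density _ (measurableTypeR R) R (@lebesgue_measure R)
  dq mdq dq0 nu (F \o q) (fun A _ => nuE A) (measurableT_comp mF mq)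
  (fun x => F0 (q x)).
apply: (etrans (esym E1)).
have E2 := @ge0_integral_pushforward _ _ (measurableTypeR R)
  (measurableTypeR R) R q mq' nu setT F measurableT mF (fun x _ => F0 x).
rewrite preimage_setT in E2; apply: (etrans (esym E2)).
by apply: eq_measure_integral => A mA _; rewrite -[LHS]lebE.
Qed.

End substitution_line.

(** The difference quotient gives way to a remainder estimate that makes sense at h = 0 too, so that
    derivatives are later obtained by bounding remainders. *)
Lemma is_derive_epsP (R : realType) (V : normedModType R) (f : V -> R)
    (a v : V) (k : R) :
  is_derive a v f k <->
  (forall e : R, 0 < e -> exists2 r : R, 0 < r &
    forall h : R, `|h| < r -> `|f (a + h *: v) - f a - h * k| <= e * `|h|).
Proof.
have E (h : R) : h != 0 ->
    f (a + h *: v) - f a - h * k = h * (h^-1 *: (f (h *: v + a) - f a) - k).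
  move=> h0; rewrite (addrC a); set w := f _ - f a.
  by rewrite mulrBr (_ : h^-1 *: w = h^-1 * w)// mulrA divff// mul1r.
split=> [[df dfk] e e0|H].
  have : h^-1 *: (f (h *: v + a) - f a) @[h --> 0^'] --> k by rewrite -dfk.
  move=> /cvgrPdist_le/(_ _ e0)/nbhs_ballP[r /= r0 rE].
  exists r => // h hr; have [->|h0] := eqVneq h 0.
    by rewrite scale0r addr0 subrr mul0r subrr !normr0 mulr0.
  rewrite E// normrM mulrC ler_wpM2r// distrC; apply: rE => //.
  by rewrite -ball_normE /ball_/= sub0r normrN.
suff C : h^-1 *: (f (h *: v + a) - f a) @[h --> 0^'] --> k.
  by apply: DeriveDef; [apply/cvg_ex; exists k|exact: cvg_lim].
apply/cvgrPdist_le => e /H[r r0 rE]; apply/nbhs_ballP; exists r => //= h.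
rewrite -ball_normE /ball_/= sub0r normrN => hr h0.
by have := rE h hr; rewrite E// normrM mulrC ler_pM2r ?normr_gt0// distrC.
Qed.

Lemma prod_continuous (R : realType) (T : topologicalType) (I : Type)
    (r : seq I) (P : pred I) (F : I -> T -> R) :
  (forall i, P i -> continuous (F i)) ->
  continuous (fun x => \prod_(i <- r | P i) F i x).
Proof.
apply: (@continuous_big R I *%R 1 P _ T r F).
by move=> x; exact: mul_continuous.
Qed.

Lemma det_continuous (R : realType) (T : topologicalType) (n : nat)
    (A : T -> 'M[R]_n) :
  (forall i j, continuous (fun x => A x i j)) ->
  continuous (fun x => \det (A x)).
Proof.
move=> cA; apply: (@sum_continuous R T _ _ xpredT
  (fun (s : 'S_n) x => (-1) ^+ s * \prod_i A x i (s i))) => s _ x.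
apply: (@continuousM R T (fun=> (-1) ^+ s) (fun x => \prod_i A x i (s i))).
  exact: cst_continuous.
by apply: prod_continuous => i _; exact: cA.
Qed.

(** * Change of variables along strongly monotone maps *)

Section strongly_monotone_maps.
Context {R : realType}.

Definition strongly_monotone (n : nat) (c : R) (T : 'rV[R]_n -> 'rV[R]_n) :=
  forall x y, c * dotp (x - y) (x - y) <= dotp (T x - T y) (x - y).

(** Frechet differentiability. Vectors are rows and the matrix acts on the right, so entry (i, j) is
    the derivative of coordinate j along axis i: the transpose of the usual Jacobian matrix, with
    the same determinant. *)
Definition has_jac (m n : nat) (T : 'rV[R]_m -> 'rV[R]_n) (x : 'rV[R]_m)
    (J : 'M[R]_(m, n)) :=
  forall e : R, 0 < e -> exists2 r : R, 0 < r &
    forall y, `|y - x| < r -> `|T y - T x - (y - x) *m J| <= e * `|y - x|.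

Lemma strongly_monotone_lip n c (T : 'rV[R]_n -> 'rV[R]_n) x y : 0 < c ->
  strongly_monotone c T -> c * enorm (x - y) <= enorm (T x - T y).
Proof.
move=> c0 /(_ x y) mT; have [/eqP xy|xy] := eqVneq (enorm (x - y)) 0.
  by rewrite (eqP xy) mulr0 enorm_ge0.
have xy0 : 0 < enorm (x - y) by rewrite lt_neqAle eq_sym xy enorm_ge0.
rewrite -(ler_pM2r xy0) -mulrA -expr2 enorm_sqr (le_trans mT)//.
exact: dotp_le.
Qed.

Lemma strongly_monotone_inj n c (T : 'rV[R]_n -> 'rV[R]_n) : 0 < c ->
  strongly_monotone c T -> injective T.
Proof.
move=> c0 mT x y Txy; have := mT x y; rewrite Txy subrr dotp0l => h.
apply/eqP; rewrite -subr_eq0 -dotp_sqr_eq0 eq_le dotp_sqr_ge0 andbT.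
by rewrite -(ler_pM2l c0) mulr0.
Qed.

Lemma consrK n (x : 'rV[R]_n.+1) : consr (col' ord0 x, x 0 ord0) = x.
Proof.
apply/rowP => i; rewrite mxE; case: unliftP => [j|] -> //=.
by rewrite mxE; congr (x _ _); exact/val_inj.
Qed.

Lemma consr0 n (v : 'rV[R]_n) a : consr (v, a) 0 ord0 = a.
Proof. by rewrite mxE unlift_none. Qed.

Lemma consr_lift n (v : 'rV[R]_n) a j : consr (v, a) 0 (lift ord0 j) = v 0 j.
Proof. by rewrite mxE liftK/=; congr (v _ _); exact/val_inj. Qed.

Lemma col'_consr n (v : 'rV[R]_n) a : col' ord0 (consr (v, a)) = v.
Proof. by apply/rowP => j; rewrite mxE consr_lift. Qed.

Lemma rowB n (x y : 'rV[R]_n) i : (x - y) 0 i = x 0 i - y 0 i.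
Proof. by rewrite !mxE. Qed.

Lemma dotp_recl n (x y : 'rV[R]_n.+1) :
  dotp x y = x 0 ord0 * y 0 ord0 + dotp (col' ord0 x) (col' ord0 y).
Proof.
by rewrite /dotp big_ord_recl; congr (_ + _); apply: eq_bigr => i _; rewrite !mxE.
Qed.

Lemma col'B n (x y : 'rV[R]_n.+1) :
  col' ord0 (x - y) = col' ord0 x - col' ord0 y.
Proof. by apply/rowP => i; rewrite !mxE. Qed.

Lemma norm_col'_le n (x : 'rV[R]_n.+1) : `|col' ord0 x| <= `|x|.
Proof. by apply: norm_le_coord => // i; rewrite mxE coord_le_norm. Qed.

Section fibers.
Variables (n : nat) (c : R) (T : 'rV[R]_n.+1 -> 'rV[R]_n.+1).
Hypotheses (c0 : 0 < c) (mT : strongly_monotone c T) (cT : continuous T).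

(** Two points of a fiber share their first coordinate, which therefore drops out of both scalar
    products; the modulus is unchanged. *)
Lemma strongly_monotone_fiber (a : R) :
  strongly_monotone c (fun v => col' ord0 (T (consr (v, a)))).
Proof.
move=> v w; have := mT (consr (v, a)) (consr (w, a)).
by rewrite !dotp_recl !col'B !col'_consr !rowB !consr0 subrr !mulr0 !add0r.
Qed.

Lemma continuous_fiber (a : R) :
  continuous (fun v : 'rV[R]_n => col' ord0 (T (consr (v, a)))).
Proof.
move=> v; apply/continuous_atP => e e0.
have /continuous_atP/(_ _ e0)[r r0 H] := @cT (consr (v, a)).
exists r => // w wv; rewrite -col'B (le_lt_trans (norm_col'_le _))//.
apply: H; apply: le_lt_trans wv; apply: norm_le_coord => // i.
rewrite !mxE; case: (unlift ord0 i) => [j|] /=.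
  by have := coord_le_norm (w - v) j; rewrite !mxE; congr (`|w _ _ - v _ _| <= _).
by rewrite subrr normr0.
Qed.

(* [Th] inverts the fibers of [T]: with the first coordinate of [z] kept, it
   solves for the remaining ones. Then [T \o Th] changes the first coordinate only. *)
Variable Th : 'rV[R]_n.+1 -> 'rV[R]_n.+1.
Hypotheses (Th0 : forall z, Th z 0 ord0 = z 0 ord0)
  (ThT : forall z, col' ord0 (T (Th z)) = col' ord0 z).

(** [Th z] moved along the first axis into the fiber of [Th z']. Inside that fiber strong
    monotonicity compares it with [Th z'], while [T] at the shifted point is controlled by
    continuity at [Th z]. *)
Let shift (z z' : 'rV[R]_n.+1) : 'rV[R]_n.+1 :=
  Th z + (z' 0 ord0 - z 0 ord0) *: delta_mx 0 ord0.

Let shift_dist z z' : `|shift z z' - Th z| <= `|z' 0 ord0 - z 0 ord0|.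
Proof.
rewrite addrC addKr normrZ -[leRHS]mulr1 ler_wpM2l//.
apply: norm_le_coord => // i; rewrite !mxE eqxx/=.
by case: eqP; rewrite ?normr1 ?normr0.
Qed.

Let Th_shift z z' :
  c * enorm (Th z' - shift z z') <= enorm (col' ord0 z' - col' ord0 (T (shift z z'))).
Proof.
set w := shift z z'.
have w0 : (Th z' - w) 0 ord0 = 0.
  by rewrite rowB !mxE !Th0 !eqxx/=; ring.
have := mT (Th z') w; rewrite [X in _ <= X -> _]dotp_recl w0 mulr0 add0r => h.
have E : enorm (col' ord0 (Th z' - w)) = enorm (Th z' - w).
  by rewrite /enorm [in RHS]dotp_recl w0 mulr0 add0r.
have {}h := le_trans h (dotp_le _ _); rewrite E col'B ThT in h.
have [h0|h0] := eqVneq (enorm (Th z' - w)) 0; first by rewrite h0 mulr0 enorm_ge0.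
have {}h0 : 0 < enorm (Th z' - w) by rewrite lt_neqAle eq_sym h0 enorm_ge0.
by rewrite -(ler_pM2r h0) -mulrA -expr2 enorm_sqr.
Qed.

Let Th_dist z z' : `|Th z' - Th z| <= `|z' 0 ord0 - z 0 ord0| +
  c^-1 * (Num.sqrt n%:R * (`|z' - z| + `|T (shift z z') - T (Th z)|)).
Proof.
rewrite -(subrK (shift z z') (Th z')) -addrA addrC.
rewrite (le_trans (ler_normD _ _))// lerD ?shift_dist//.
rewrite ler_pdivlMl// (le_trans _ (le_trans (Th_shift z z') _))//.
  by rewrite ler_pM2l// norm_le_enorm.
rewrite (le_trans (enorm_le_norm _))// ler_wpM2l ?sqrtr_ge0//.
rewrite -(subrK (col' ord0 z) (col' ord0 z')) -addrA.
rewrite (le_trans (ler_normD _ _))// lerD//.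
  by rewrite -col'B norm_col'_le.
by rewrite distrC -(ThT z) -col'B norm_col'_le.
Qed.

Lemma continuous_fiber_inverse : continuous Th.
Proof.
move=> z; apply/continuous_atP => e e0.
(* The factor left by [Th_dist] when the three distances in it are bounded by [e1]. *)
pose K := 1 + c^-1 * (Num.sqrt n%:R * 2).
have K0 : 0 < K by rewrite ltr_pwDl// !mulr_ge0// ?invr_ge0 ?ltW ?sqrtr_ge0.
pose e1 := e / K.
have e10 : 0 < e1 by rewrite divr_gt0.
have /continuous_atP/(_ _ e10)[r r0 H] := @cT (Th z).
exists (Num.min r e1) => [|z']; first by rewrite lt_min r0.
rewrite lt_min => /andP[zr ze].
have z0 : `|z' 0 ord0 - z 0 ord0| <= `|z' - z|.
  by have := coord_le_norm (z' - z) ord0; rewrite !mxE.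
rewrite (le_lt_trans (Th_dist z z'))//.
have := H (shift z z') (le_lt_trans (shift_dist z z') (le_lt_trans z0 zr)).
set t := `|T _ - _| => te.
have -> : e = e1 + c^-1 * (Num.sqrt n%:R * (e1 + e1)).
  have {1}-> : e = K * e1 by rewrite mulrC divfK ?gt_eqF.
  by rewrite /K; ring.
rewrite ltr_leD ?(le_lt_trans z0)// ler_wpM2l ?invr_ge0 ?(ltW c0)//.
by rewrite ler_wpM2l ?sqrtr_ge0// lerD// ltW.
Qed.

Let line (u : 'rV[R]_n) (a : R) := T (Th (consr (u, a))) 0 ord0.

Lemma fiber_line_incr u a b : a <= b -> c * (b - a) <= line u b - line u a.
Proof.
move=> ab; have := mT (Th (consr (u, b))) (Th (consr (u, a))).
rewrite [X in _ <= X]dotp_recl col'B !ThT !col'_consr subrr dotp0l addr0.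
rewrite dotp_recl !rowB !Th0 !consr0 mulrDr.
move: ab; rewrite le_eqVlt => /predU1P[->|ab]; first by move=> _; rewrite !subrr mulr0.
have ba : 0 < b - a by rewrite subr_gt0.
move=> h; rewrite -(ler_pM2r ba); apply: le_trans h.
by rewrite mulrA lerDl mulr_ge0 ?dotp_sqr_ge0 ?ltW.
Qed.

Lemma fiber_line_continuous u : continuous (line u).
Proof.
move=> a; apply/continuous_atP => e e0.
have /continuous_atP/(_ _ e0)[r r0 H] := @cT (Th (consr (u, a))).
have /continuous_atP/(_ _ r0)[r' r'0 H'] := @continuous_fiber_inverse (consr (u, a)).
exists r' => // b ba; apply: le_lt_trans (H (Th (consr (u, b))) _).
  by have := coord_le_norm (T (Th (consr (u, b))) - T (Th (consr (u, a)))) ord0; rewrite !mxE.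
apply: H'; apply: le_lt_trans ba; apply: norm_le_coord => // i.
by rewrite !mxE; case: (unlift ord0 i) => [j|] //=; rewrite subrr normr0.
Qed.

Lemma fiber_surj y : exists x, T x = y.
Proof.
have [a aE] := strictly_increasing_surj c0 (fiber_line_continuous (u := col' ord0 y))
  (@fiber_line_incr (col' ord0 y)) (y 0 ord0).
exists (Th (consr (col' ord0 y, a))).
by rewrite -[LHS]consrK -[RHS]consrK ThT col'_consr; congr (consr (_, _)).
Qed.

Section line_derivative.
Variables (u : 'rV[R]_n) (a : R) (J : 'M[R]_n.+1).
Let x := Th (consr (u, a)).
Hypotheses (TJ : has_jac T x J) (detJP : 0 < \det (row' ord0 (col' ord0 J))).

(* Multiply the first-order expansion of [T] at [x] by [\adj J]: all coordinates
   of [T \o Th] but the first are constant along the line, so that only [\det J]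
   and one cofactor survive. *)
Lemma fiber_line_derive :
  is_derive a (1 : R) (line u) (\det J / \det (row' ord0 (col' ord0 J))).
Proof.
have := detJP; set D := \det (row' _ _) => D0.
apply/is_derive_epsP => e e0.
pose K := 1 + \sum_j `|\adj J j ord0|.
have K0 : 0 < K by rewrite ltr_pwDl// sumr_ge0.
pose N := `|(delta_mx 0 ord0 : 'rV[R]_n.+1) *m J|.
(* Lipschitz bound for [Th] at [x] along the line: [Th_dist], where a first-axis step of size |h|
   moves [T] by at most (N + 1) |h|, the 1 being the error allowed in [H1]. *)
pose M := 1 + c^-1 * (Num.sqrt n%:R * (1 + (N + 1))).
have M0 : 0 < M.
  have N0 : 0 <= 1 + (N + 1) by rewrite !addr_ge0 /N.
  by rewrite ltr_pwDl// mulr_ge0 ?invr_ge0 ?(ltW c0)// mulr_ge0 ?sqrtr_ge0.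
have [r1 r10 H1] := TJ ltr01.
(* The tolerance for which the final bound, K times it times M |h|, equals e D |h|. *)
have e20 : 0 < e * D / (K * M) by rewrite !mulr_gt0 ?invr_gt0 ?mulr_gt0.
have [r2 r20 H2] := TJ e20.
exists (Num.min r1 (r2 / M)) => [|h]; first by rewrite lt_min r10 divr_gt0.
rewrite lt_min => /andP[hr1 hr2]; rewrite [h *: _]mulr1.
pose z := consr (u, a); pose z' := consr (u, a + h); pose x' := Th z'.
have z0 : z' 0 ord0 - z 0 ord0 = h by rewrite !consr0 addrC addKr.
have zz : `|z' - z| <= `|h|.
  apply: norm_le_coord => // i; rewrite !mxE; case: (unlift ord0 i) => [j|] /=.
    by rewrite subrr normr0.
  by rewrite addrC addKr.
have Dx : `|x' - x| <= M * `|h|.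
  rewrite (le_trans (Th_dist z z'))// z0.
  have xw : `|shift z z' - x| <= `|h| by rewrite -z0; exact: shift_dist.
  have Tw : `|T (shift z z') - T x| <= (N + 1) * `|h|.
    have := H1 (shift z z') (le_lt_trans xw hr1); rewrite mul1r => H.
    rewrite -(subrK ((shift z z' - x) *m J) (_ - _)).
    rewrite (le_trans (ler_normD _ _))// mulrDl addrC lerD//.
      rewrite {1}/shift z0 -/x [_ + _ - _]addrC addKr -scalemxAl normrZ.
      by rewrite mulrC.
    by rewrite mul1r (le_trans H).
  rewrite /M mulrDl mul1r lerD2l -!mulrA ler_wpM2l ?invr_ge0 ?(ltW c0)//.
  rewrite ler_wpM2l ?sqrtr_ge0// mulrDl mul1r lerD//.
have xr2 : `|x' - x| < r2.
  by rewrite (le_lt_trans Dx)// mulrC -ltr_pdivlMr.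
have {}H2 := H2 _ xr2.
set rem := T x' - T x - (x' - x) *m J in H2.
have E : (line u (a + h) - line u a) * D - h * \det J =
    (rem *m \adj J) 0 ord0.
  rewrite mulmxBl -mulmxA mul_mx_adj mul_mx_scalar !mxE.
  rewrite -/z' -/z !Th0 z0 (mulrC h); congr (_ - _).
  rewrite big_ord_recl !mxE big1 => [|i _]; last first.
    have /rowP/(_ i) := ThT z'; have /rowP/(_ i) := ThT z.
    rewrite ![col' _ _ _ _]mxE !mxE !liftK/= /x' /x -/z -/z' => -> ->.
    by rewrite subrr mul0r.
  by rewrite addr0 /cofactor expr0 mul1r.
have adjK : `|(rem *m \adj J) 0 ord0| <= K * `|rem|.
  rewrite mxE (le_trans (ler_norm_sum _ _ _))// mulrDl mul1r big_distrl/=.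
  rewrite -[leLHS]add0r lerD//; apply: ler_sum => j _.
  by rewrite normrM mulrC ler_wpM2l// coord_le_norm.
rewrite -(ler_pM2r D0) -[X in _ * X <= _](gtr0_norm D0) -normrM.
have -> : (line u (a + h) - line u a - h * (\det J / D)) * D =
    (line u (a + h) - line u a) * D - h * \det J.
  by field; rewrite gt_eqF.
rewrite E (le_trans adjK)//.
apply: (@le_trans _ _ (K * (e * D / (K * M) * (M * `|h|)))).
  by rewrite ler_pM2l// (le_trans H2)// ler_wpM2l ?(ltW e20).
rewrite le_eqVlt; apply/orP; left; apply/eqP; field.
by rewrite !gt_eqF.
Qed.
End line_derivative.

End fibers.
End strongly_monotone_maps.

Lemma is_derive_ge (R : realType) (q : R -> R) (a k c : R) :
  is_derive a (1 : R) q k -> (forall b, a <= b -> c * (b - a) <= q b - q a) ->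
  c <= k.
Proof.
move=> /is_derive_epsP dq incr; apply/ler_addgt0Pr => e /dq[r r0 H].
have h0 : 0 < r / 2 by rewrite divr_gt0.
have := H (r / 2); rewrite gtr0_norm// gtr_pMr// invf_lt1// ltr1n => /(_ isT).
rewrite [_ *: 1]mulr1 ler_norml => /andP[_].
have := incr (a + r / 2); rewrite lerDl (ltW h0) addrAC subrr add0r => /(_ isT) h1 h2.
rewrite -(ler_pM2r h0); nra.
Qed.

Section strongly_monotone_substitution.
Context {R : realType}.

Lemma has_jac_continuous m n (T : 'rV[R]_m -> 'rV[R]_n) x J :
  has_jac T x J -> {for x, continuous T}.
Proof.
move=> /(_ _ ltr01)[r r0 H]; apply/continuous_atP => e e0.
pose M := 1 + \sum_j \sum_i `|J i j|.
have M0 : 0 < M by rewrite ltr_pwDl// !sumr_ge0// => i _; rewrite sumr_ge0.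
exists (Num.min r (e / M)) => [|y]; first by rewrite lt_min r0 divr_gt0.
rewrite lt_min => /andP[yr ye]; have {}H := H y yr.
rewrite -(subrK ((y - x) *m J) (T y - T x)).
rewrite (le_lt_trans (ler_normD _ _))//.
apply: (@le_lt_trans _ _ (`|y - x| * M)); last by rewrite -ltr_pdivlMr.
rewrite /M mulrDr mulr1 lerD//; first by rewrite mul1r in H.
apply: norm_le_coord => [|j].
  by rewrite mulr_ge0// sumr_ge0// => i _; rewrite sumr_ge0.
rewrite mxE (le_trans (ler_norm_sum _ _ _))// (bigD1 j)//= mulrDr.
rewrite -[leLHS]addr0 lerD ?mulr_ge0 ?sumr_ge0//; last first.
  by move=> i _; rewrite sumr_ge0.
rewrite big_distrr/=; apply: ler_sum => i _.
by rewrite normrM ler_wpM2r// coord_le_norm.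
Qed.

(** Fibers have one dimension less and the same modulus, so the induction hypothesis yields [Th];
    the first coordinate is then found by the intermediate value theorem. *)
Lemma strongly_monotone_surj n c (T : 'rV[R]_n -> 'rV[R]_n) :
  0 < c -> strongly_monotone c T -> continuous T -> forall y, exists x, T x = y.
Proof.
elim: n T => [|n IH] T c0 mT cT y; first by exists 0; apply/rowP => -[].
have /choice[s sE] (z : 'rV[R]_n.+1) : exists v,
    col' ord0 (T (consr (v, z 0 ord0))) = col' ord0 z.
  exact: (IH _ c0 (strongly_monotone_fiber mT (z 0 ord0)) (@continuous_fiber _ _ _ cT _)).
pose Th (z : 'rV[R]_n.+1) : 'rV[R]_n.+1 := consr (s z, z 0 ord0).
by apply: (@fiber_surj R n c T c0 mT cT Th) => z; rewrite /Th ?consr0.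
Qed.

Lemma has_jac_fiber n (T : 'rV[R]_n.+1 -> 'rV[R]_n.+1) v a J :
  has_jac T (consr (v, a)) J ->
  has_jac (fun v => col' ord0 (T (consr (v, a)))) v (row' ord0 (col' ord0 J)).
Proof.
move=> TJ e e0; have [r r0 H] := TJ _ e0; exists r => // w wv.
have D : `|consr (w, a) - consr (v, a)| <= `|w - v|.
  apply: norm_le_coord => // i; rewrite !mxE; case: (unlift ord0 i) => [j|] /=.
    by have := coord_le_norm (w - v) j; rewrite !mxE; congr (`|w _ _ - v _ _| <= _).
  by rewrite subrr normr0.
have {}H := H (consr (w, a)) (le_lt_trans D wv).
apply: (@le_trans _ _ (e * `|consr (w, a) - consr (v, a)|)); last first.
  by rewrite ler_pM2l.
apply: le_trans H; apply: le_trans (norm_col'_le _).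
rewrite le_eqVlt; apply/orP; left; apply/eqP; congr (`| _ |).
apply/rowP => j; rewrite !mxE; congr (_ - _).
rewrite big_ord_recl !mxE unlift_none/= subrr mul0r add0r.
by apply: eq_bigr => i _; rewrite !mxE liftK.
Qed.

(* Induction on [n]: apply the induction hypothesis to the fiber of [T] above each
   value of the first coordinate, then substitute in the first coordinate along
   [T \o Th], whose derivative is the quotient of [\det J] by the fiber determinant. *)
Lemma integral_substitution_monotone n (c : R) (T : 'rV[R]_n -> 'rV[R]_n)
    (J : 'rV[R]_n -> 'M[R]_n) :
  0 < c -> strongly_monotone c T -> (forall x, has_jac T x (J x)) ->
  (forall i j, continuous (fun x => J x i j)) ->
  (forall x, c ^+ n <= \det (J x)) /\
  (forall F : 'rV[R]_n -> \bar R,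
    measurable_fun [set: 'rV[R]_n] F -> (forall x, 0 <= F x)%E ->
    (\int[leb n]_x (F (T x) * (\det (J x))%:E) = \int[leb n]_x F x)%E).
Proof.
elim: n T J => [|n IH] T J c0 mT TJ cJ.
  split=> [x|F mF F0]; first by rewrite det_mx00 expr0.
  apply: eq_integral => x _; rewrite det_mx00 mule1.
  by congr F; apply/rowP => -[].
have cT : continuous T by move=> x; exact: has_jac_continuous (TJ x).
pose JP x := row' ord0 (col' ord0 (J x)).
have cconsr a : continuous (fun v : 'rV[R]_n => consr (v, a)).
  apply: continuous_row => i; under eq_fun do rewrite mxE.
  case: (unlift ord0 i) => [j|] /=; first exact: coord_continuous.
  exact: cst_continuous.
have {}IH a := IH _ (fun v => JP (consr (v, a))) c0
  (strongly_monotone_fiber mT a) (fun v => has_jac_fiber (TJ (consr (v, a)))).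
have cJP a i j : continuous (fun v => JP (consr (v, a)) i j).
  move=> v; under eq_fun do rewrite !mxE.
  exact: (continuous_comp (cconsr a v) (cJ _ _ _)).
have {}IH a := IH a (cJP a).
(* The determinant bound is carried through the induction because the fiber determinant has to be
   positive to be divided by. *)
have detJP x : c ^+ n <= \det (JP x) by rewrite -(consrK x); exact: (IH _).1.
have detJP0 x : 0 < \det (JP x) by rewrite (lt_le_trans _ (detJP x))// exprn_gt0.
have /choice[s sE] (z : 'rV[R]_n.+1) : exists v,
    col' ord0 (T (consr (v, z 0 ord0))) = col' ord0 z.
  exact: strongly_monotone_surj c0 (strongly_monotone_fiber mT (z 0 ord0))
    (@continuous_fiber _ _ _ cT _) _.
pose Th (z : 'rV[R]_n.+1) : 'rV[R]_n.+1 := consr (s z, z 0 ord0).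
have Th0 z : Th z 0 ord0 = z 0 ord0 by rewrite /Th consr0.
have ThT z : col' ord0 (T (Th z)) = col' ord0 z by rewrite sE.
have cTh := continuous_fiber_inverse c0 mT cT Th0 ThT.
(* [Th] undoes the fiber map, so that quantities at a source point can be written in terms of its
   image in the fiber. *)
have ThK v a : Th (consr (col' ord0 (T (consr (v, a))), a)) = consr (v, a).
  rewrite /Th consr0; congr (consr (_, _)).
  apply: (strongly_monotone_inj c0 (strongly_monotone_fiber mT a)) => /=.
  by have := sE (consr (col' ord0 (T (consr (v, a))), a)); rewrite consr0 col'_consr.
(* The derivative of the first coordinate of T composed with [Th] along a line. Being at least [c],
   it supplies the last factor of the determinant bound. *)
pose k x := \det (J x) / \det (JP x).
have dline u a := fiber_line_derive c0 mT Th0 ThT (TJ (Th (consr (u, a)))) (detJP0 _).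
have k_ge x : c <= k x.
  rewrite -(consrK x) -ThK.
  apply: (is_derive_ge (dline _ _)) => b; exact: fiber_line_incr.
have ck : continuous k.
  move=> x; apply: (@continuousM R _ (fun x => \det (J x))
    (fun x => (\det (JP x))^-1)); first exact: det_continuous.
  apply: (@continuousV R _ (fun x => \det (JP x))); first by rewrite gt_eqF.
  by apply: det_continuous => i j y; under eq_fun do rewrite !mxE; exact: cJ.
split=> [x|F mF F0].
  rewrite exprS -[leRHS](@divfK _ (\det (JP x))) ?gt_eqF//.
  by rewrite ler_pM ?(ltW c0) ?exprn_ge0 ?(ltW c0)//; exact: k_ge.
have mdet : measurable_fun setT (fun x => \det (J x)).
  by apply: continuous_measurable_mxreal; exact: det_continuous.
have det0 x : 0 <= \det (J x).
  rewrite -[leRHS](@divfK _ (\det (JP x))) ?gt_eqF// mulr_ge0 ?(ltW (detJP0 _))//.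
  by rewrite (le_trans (ltW c0))// k_ge.
have mT' : measurable_fun setT T by exact: continuous_measurable_mx.
rewrite integral_lebS_col//; last 2 first.
- apply: emeasurable_funM; last exact/measurable_EFinP.
  exact: measurableT_comp.
- by move=> x; rewrite mule_ge0// lee_fin.
(* The integrand after substitution in the fibers: [z.1] is already a target variable, [z.2] is
   still the first coordinate of the source. *)
pose G (z : 'rV[R]_n * R) : \bar R :=
  (F (consr (z.1, T (Th (consr z)) 0%R ord0)) * (k (Th (consr z)))%:E)%E.
have G0 z : (0 <= G z)%E.
  by rewrite mule_ge0// lee_fin (le_trans (ltW c0))// k_ge.
have mThc : measurable_fun setT (fun z : 'rV[R]_n * R => Th (consr z)).
  apply: measurableT_comp (@measurable_consr R n).
  exact: continuous_measurable_mx.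
have mG : measurable_fun setT G.
  apply: emeasurable_funM.
    apply: (measurableT_comp mF); apply: (measurableT_comp (@measurable_consr R n)).
    apply: measurable_fun_pair => //=.
    apply: (measurableT_comp (measurable_coord 0 ord0)).
    exact: measurableT_comp.
  apply/measurable_EFinP; apply: measurableT_comp mThc; exact: continuous_measurable_mxreal.
transitivity (\int[@lebesgue_measure R]_a \int[leb n]_u G (u, a))%E.
  apply: eq_integral => a _.
  rewrite -[RHS](IH a).2; last 2 first.
  - exact: measurable_fun_pair1 mG.
  - by move=> u.
  apply: eq_integral => v _; rewrite /G/= ThK -muleA -EFinM divfK ?gt_eqF//.
  by congr (F _ * _)%E; exact/esym/consrK.
rewrite integral_swap_leb// integral_lebS_row//.
apply: eq_integral => u _.
pose Fu b := F (consr (u, b)).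
have mFu : measurable_fun setT Fu.
  apply: (measurableT_comp mF); apply: (measurableT_comp (@measurable_consr R n)).
  exact: pair1_measurable.
rewrite -(@integral_substitution_line R _ (fun a => k (Th (consr (u, a)))) c c0 (dline u) _ _ Fu)//.
- move=> a.
  have cu : continuous (fun a : R => consr (u, a)).
    apply: (@continuous_row R R) => i; under eq_fun do rewrite mxE.
    case: (unlift ord0 i) => [j|] /=; first exact: cst_continuous.
    by move=> b; exact: cvg_id.
  exact: (@continuous_comp _ _ _ (fun a : R => consr (u, a)) (k \o Th) a (cu a)
    (continuous_comp (cTh _) (ck _))).
- by move=> b; exact: F0.
Qed.

End strongly_monotone_substitution.

(** * Mean value formula and chain rule for partial derivatives *)

Section partial_derivatives.
Context {R : realType} {d : nat}.
Implicit Types (g : 'rV[R]_d -> R) (x y : 'rV[R]_d).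
Local Notation "'e_ i" := (delta_mx 0 i : 'rV[R]_d) (at level 8, i at level 2).

Lemma is_derive_line g v x (t : R) k :
  is_derive (x + t *: v) v g k ->
  is_derive t (1 : R) (fun s : R => g (x + s *: v)) k.
Proof.
move=> /is_derive_epsP H; apply/is_derive_epsP => e /H[r r0 {}H].
by exists r => // h /H; rewrite [h *: 1]mulr1 scalerDl addrA.
Qed.

Lemma mvt_abs (q dq : R -> R) (h : R) :
  (forall s : R, is_derive s (1 : R) q (dq s)) ->
  exists2 t, `|t| <= `|h| & q h - q 0 = dq t * h.
Proof.
move=> q_dq.
have cq : continuous q.
  move=> x; apply: differentiable_continuous; apply/derivable1_diffP.
  by have [] := q_dq x.
have [h0|h0] := leP 0 h.
  have [t /[!in_itv]/= /andP[t0 th] E] := MVT_segment h0 (fun s _ => q_dq s)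
    (continuous_subspaceT cq).
  by exists t; rewrite ?E ?subr0// !ger0_norm.
have [t /[!in_itv]/= /andP[t0 th] E] := MVT_segment (ltW h0) (fun s _ => q_dq s)
  (continuous_subspaceT cq).
exists t; first by rewrite !ler0_norm ?(ltW h0)// lerN2.
by rewrite -[LHS]opprB E sub0r mulrN opprK.
Qed.

(* Moves from [x] to [y] one coordinate at a time. *)
Lemma partial_mvt g (dg : 'I_d -> 'rV[R]_d -> R) x y :
  (forall i z, is_derive z 'e_i g (dg i z)) ->
  exists2 p : 'I_d -> 'rV[R]_d, (forall i, `|p i - x| <= `|y - x|) &
    g y - g x = \sum_i (y - x) 0 i * dg i (p i).
Proof.
move=> g_dg.
pose z (k : nat) : 'rV[R]_d := \row_i (if (i < k)%N then y 0 i else x 0 i).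
have zS (i : 'I_d) : z i.+1 = z i + (y - x) 0 i *: 'e_i.
  apply/rowP => j; rewrite !mxE eqxx/=; have [->|ji] := eqVneq j i.
    by rewrite ltnSn ltnn mulr1 addrC subrK.
  by rewrite ltnS leq_eqVlt (inj_eq val_inj) (negbTE ji)/= mulr0 addr0.
have /choice[p pE] (i : 'I_d) : exists w, `|w - x| <= `|y - x| /\
    g (z i.+1) - g (z i) = (y - x) 0 i * dg i w.
  have [t tle tE] := mvt_abs ((y - x) 0 i)
    (fun s => is_derive_line (g_dg i (z i + s *: 'e_i))).
  exists (z i + t *: 'e_i); split; last first.
    by rewrite zS mulrC -tE scale0r addr0.
  apply: norm_le_coord => // j; rewrite !mxE eqxx/=.
  have [->|ji] := eqVneq j i.
    rewrite ltnn mulr1 addrAC subrr add0r (le_trans tle)//.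
    exact: coord_le_norm.
  rewrite mulr0 addr0; case: ifP => _; last by rewrite subrr normr0.
  by have := coord_le_norm (y - x) j; rewrite !mxE.
exists p => [i|]; first by case: (pE i).
transitivity (\sum_(i < d) (g (z i.+1) - g (z i))).
  rewrite -(big_mkord xpredT (fun i => g (z i.+1) - g (z i))) telescope_sumr//.
  by congr (g _ - g _); apply/rowP => i; rewrite mxE ?ltn_ord.
by apply: eq_bigr => i _; case: (pE i).
Qed.

(** The intermediate points of [partial_mvt] are as close to [x] as [y] is, and there continuity
    controls the partial derivatives. *)
Lemma total_derivative g (dg : 'I_d -> 'rV[R]_d -> R) x :
  (forall i z, is_derive z 'e_i g (dg i z)) -> (forall i, continuous (dg i)) ->
  forall e : R, 0 < e -> exists2 r : R, 0 < r & forall y, `|y - x| < r ->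
    `|g y - g x - \sum_i (y - x) 0 i * dg i x| <= e * `|y - x|.
Proof.
move=> g_dg cdg e e0.
(* Dividing by d + 1 rather than d keeps [e1] positive when d = 0. *)
pose e1 := e / d.+1%:R.
have e10 : 0 < e1 by rewrite divr_gt0.
have /choice[r rE] (i : 'I_d) : exists r : R, 0 < r /\
    forall y, `|y - x| < r -> `|dg i y - dg i x| < e1.
  by have /continuous_atP/(_ _ e10)[r r0 H] := cdg i x; exists r.
exists (\big[Num.min/1]_i r i).
  by apply/bigmin_gtP; split => // i _; case: (rE i).
move=> y /bigmin_gtP[_ yr].
have [p px ->] := partial_mvt x y g_dg.
rewrite -sumrB (le_trans (ler_norm_sum _ _ _))//.
apply: (@le_trans _ _ (\sum_(i < d) e1 * `|y - x|)).
  apply: ler_sum => i _; rewrite -mulrBr normrM mulrC.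
  apply: ler_pM => //; last exact: coord_le_norm.
  by apply/ltW; have [_] := rE i; apply; exact: le_lt_trans (px i) (yr i isT).
rewrite sumr_const card_ord -mulr_natl mulrA ler_wpM2r//.
rewrite /e1 mulrCA ler_piMr ?(ltW e0)//.
by rewrite ler_pdivrMr ?ltr0Sn// mul1r ler_nat.
Qed.

(** Of [S] only derivatives along [v] are asked; the uniform expansion that a chain rule requires is
    that of [g], from [total_derivative]. *)
Lemma is_derive_comp_row (m : nat) (g : 'rV[R]_d -> R)
    (dg : 'I_d -> 'rV[R]_d -> R) (S : 'rV[R]_m -> 'rV[R]_d) (y v : 'rV[R]_m)
    (ds : 'I_d -> R) :
  (forall i z, is_derive z 'e_i g (dg i z)) -> (forall i, continuous (dg i)) ->
  (forall j, is_derive y v (fun z => S z 0 j) (ds j)) ->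
  is_derive y v (g \o S) (\sum_j ds j * dg j (S y)).
Proof.
move=> g_dg cdg S_ds; apply/is_derive_epsP => e e0.
pose M := 1 + \sum_j (`|ds j| + 1).
have M0 : 0 < M by rewrite ltr_pwDl// sumr_ge0// => j _; rewrite addr_ge0.
pose N := 1 + \sum_j `|dg j (S y)|.
have N0 : 0 < N by rewrite ltr_pwDl// sumr_ge0.
have e10 : 0 < e / 2 / M by rewrite !divr_gt0.
have [r1 r10 H1] := total_derivative (S y) g_dg cdg e10.
have e20 : 0 < Num.min 1 (e / 2 / N) by rewrite lt_min ltr01 !divr_gt0.
have /choice[r rE] (j : 'I_d) : exists r : R, 0 < r /\ forall h : R, `|h| < r ->
    `|S (y + h *: v) 0 j - S y 0 j - h * ds j| <= Num.min 1 (e / 2 / N) * `|h|.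
  by have /is_derive_epsP/(_ _ e20)[r r0 H] := S_ds j; exists r.
exists (Num.min (r1 / M) (\big[Num.min/1]_j r j)).
  by rewrite lt_min divr_gt0//=; apply/bigmin_gtP; split => // j _; case: (rE j).
move=> h; rewrite lt_min => /andP[hr1 /bigmin_gtP[_ hr]].
have {rE}H2 j := (rE j).2 h (hr j isT).
set D := S (y + h *: v) - S y.
have DM : `|D| <= M * `|h|.
  apply: norm_le_coord => [|j]; first by rewrite mulr_ge0// ltW.
  rewrite rowB -(subrK (h * ds j) (_ - _)) (le_trans (ler_normD _ _))//.
  apply: (@le_trans _ _ ((`|ds j| + 1) * `|h|)); last first.
    rewrite ler_wpM2r// /M (bigD1 j)//= addrCA lerDl addr_ge0// sumr_ge0//.
  rewrite addrC mulrDl lerD//; first by rewrite normrM mulrC.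
  by rewrite (le_trans (H2 j))// ler_wpM2r// ge_min lexx.
have Dr1 : `|D| < r1 by rewrite (le_lt_trans DM)// mulrC -ltr_pdivlMr.
have {}H1 := H1 _ Dr1.
rewrite /= -(subrK (\sum_i D 0 i * dg i (S y)) (g _ - _)) -addrA.
rewrite (le_trans (ler_normD _ _))// (splitr e) mulrDl lerD//.
  rewrite (le_trans H1)// (le_trans (ler_wpM2l (ltW e10) DM))//.
  by rewrite mulrA divfK// gt_eqF.
rewrite big_distrr/= -sumrB (le_trans (ler_norm_sum _ _ _))//.
apply: (@le_trans _ _ (\sum_j (e / 2 / N * `|h|) * `|dg j (S y)|)).
  apply: ler_sum => j _; rewrite mulrA -mulrBl normrM ler_wpM2r// rowB.
  by rewrite (le_trans (H2 j))// ler_wpM2r// ge_min lexx orbT.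
rewrite -mulr_sumr; apply: (@le_trans _ _ (e / 2 / N * `|h| * N)).
  by rewrite ler_wpM2l ?mulr_ge0 ?invr_ge0 ?(ltW e0) ?(ltW N0)// lerDr.
by rewrite mulrAC divfK// gt_eqF.
Qed.

End partial_derivatives.

(** * Locally Hoelder differentiable functions *)

Section holder_class.
Context {R : realType} {d : nat} (alpha : R).
Hypotheses (alpha0 : 0 < alpha) (alpha1 : alpha <= 1).
Implicit Types (f g : 'rV[R]_d -> R) (x y : 'rV[R]_d).
Local Notation "'e_ i" := (delta_mx 0 i : 'rV[R]_d) (at level 8, i at level 2).

Definition loc_holder g := forall r : R, exists2 C : R, 0 <= C &
  forall x y, `|x| <= r -> `|y| <= r ->
    `|g x - g y| <= C * enorm (x - y) `^ alpha.

Lemma loc_holder_bounded g : loc_holder g ->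
  forall r : R, exists2 C : R, 0 <= C & forall x, `|x| <= r -> `|g x| <= C.
Proof.
move=> hg r; have [r0|r0] := leP 0 r; last first.
  by exists 0 => // x xr; have := le_lt_trans xr r0; rewrite normr_lt0.
have [C C0 H] := hg r.
exists (C * (Num.sqrt d%:R * r) `^ alpha + `|g 0|) => [|x xr].
  by rewrite addr_ge0 ?mulr_ge0 ?powR_ge0.
rewrite -[X in `|X|](subrK (g 0)) (le_trans (ler_normD _ _))// lerD2r.
rewrite (le_trans (H _ _ xr _)) ?normr0// ler_wpM2l//.
rewrite ge0_ler_powR ?nnegrE ?enorm_ge0 ?mulr_ge0 ?sqrtr_ge0 ?(ltW alpha0)//.
by rewrite subr0 (le_trans (enorm_le_norm _))// ler_wpM2l ?sqrtr_ge0.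
Qed.

Lemma loc_holder_continuous g : loc_holder g -> continuous g.
Proof.
move=> hg x; apply/continuous_atP => e e0.
have [C C0 H] := hg (`|x| + 1).
have C10 : 0 < C + 1 by rewrite ltr_pwDr.
have eC : 0 < e / (C + 1) by rewrite divr_gt0.
pose s := (e / (C + 1)) `^ alpha^-1.
have s0 : 0 < s by rewrite powR_gt0.
have s10 : 0 < s / (Num.sqrt d%:R + 1).
  by rewrite divr_gt0// ltr_pwDr ?sqrtr_ge0.
exists (Num.min 1 (s / (Num.sqrt d%:R + 1))) => [|y]; first by rewrite lt_min ltr01.
rewrite lt_min => /andP[y1 ys].
have yx : `|y| <= `|x| + 1.
  rewrite -(subrK x y) (le_trans (ler_normD _ _))// addrC lerD2l.
  exact: ltW.
have xx : `|x| <= `|x| + 1 by rewrite lerDl.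
apply: (le_lt_trans (H _ _ yx xx)).
have ps : enorm (y - x) `^ alpha <= e / (C + 1).
  have -> : e / (C + 1) = s `^ alpha.
    by rewrite /s -powRrM mulVf ?gt_eqF// powRr1 ?ltW.
  rewrite ge0_ler_powR ?nnegrE ?enorm_ge0 ?(ltW alpha0) ?(ltW s0)//.
  rewrite (le_trans (enorm_le_norm _))//.
  apply: (@le_trans _ _ ((Num.sqrt d%:R + 1) * `|y - x|)).
    by rewrite ler_wpM2r// lerDl.
  by rewrite mulrC -ler_pdivlMr ?ltr_pwDr ?sqrtr_ge0// ltW.
rewrite (le_lt_trans (ler_wpM2l C0 ps))// mulrCA gtr_pMr//.
by rewrite ltr_pdivrMr// mul1r ltrDl.
Qed.

(** On a set of diameter at most K, a distance t satisfies t = t^(1 - alpha) t^alpha <= K^(1 -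
    alpha) t^alpha. *)
Lemma lip_loc_holder g :
  (forall r : R, exists2 C : R, 0 <= C &
    forall x y, `|x| <= r -> `|y| <= r -> `|g x - g y| <= C * enorm (x - y)) ->
  loc_holder g.
Proof.
move=> lg r; have [C C0 H] := lg r.
pose K := Num.sqrt d%:R * (`|r| + `|r|).
have K0 : 0 <= K by rewrite mulr_ge0 ?sqrtr_ge0 ?addr_ge0.
exists (C * K `^ (1 - alpha)) => [|x y xr yr]; first by rewrite mulr_ge0 ?powR_ge0.
rewrite (le_trans (H _ _ xr yr))// -mulrA ler_wpM2l//.
have xyK : enorm (x - y) <= K.
  rewrite (le_trans (enorm_le_norm _))// ler_wpM2l ?sqrtr_ge0//.
  apply: (le_trans (ler_normB _ _)); apply: lerD;
    [exact: le_trans xr (ler_norm _)|exact: le_trans yr (ler_norm _)].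
have [->|xy0] := eqVneq (enorm (x - y)) 0; first by rewrite mulr_ge0 ?powR_ge0.
have {}xy0 : 0 < enorm (x - y) by rewrite lt_neqAle eq_sym xy0 enorm_ge0.
rewrite -[leLHS]powRr1 ?enorm_ge0// -{1}(subrK alpha 1) powRD; last first.
  by rewrite (gt_eqF xy0) implybT.
rewrite ler_wpM2r ?powR_ge0//.
by rewrite ge0_ler_powR ?nnegrE ?enorm_ge0// subr_ge0.
Qed.

Lemma loc_holder_cst (c : R) : loc_holder (fun=> c).
Proof.
by move=> r; exists 0 => // x y _ _; rewrite subrr normr0 mul0r.
Qed.

Lemma loc_holder_coord i : loc_holder (fun x => x 0 i).
Proof.
apply: lip_loc_holder => r; exists 1 => // x y _ _.
by rewrite -rowB mul1r (le_trans (coord_le_norm _ _))// norm_le_enorm.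
Qed.

Lemma loc_holderD f g :
  loc_holder f -> loc_holder g -> loc_holder (fun x => f x + g x).
Proof.
move=> hf hg r; have [C C0 HC] := hf r; have [D D0 HD] := hg r.
exists (C + D) => [|x y xr yr]; first exact: addr_ge0.
rewrite opprD addrACA (le_trans (ler_normD _ _))// mulrDl lerD//.
  exact: HC.
exact: HD.
Qed.

Lemma loc_holderM f g :
  loc_holder f -> loc_holder g -> loc_holder (fun x => f x * g x).
Proof.
move=> hf hg r; have [C C0 HC] := hf r; have [D D0 HD] := hg r.
have [C' C'0 HC'] := loc_holder_bounded hf r.
have [D' D'0 HD'] := loc_holder_bounded hg r.
exists (C * D' + C' * D) => [|x y xr yr]; first by rewrite addr_ge0 ?mulr_ge0.
have -> : f x * g x - f y * g y = (f x - f y) * g x + f y * (g x - g y) by ring.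
rewrite (le_trans (ler_normD _ _))// [leRHS]mulrDl !normrM lerD//.
  by rewrite mulrAC ler_pM// ?HC ?HD'.
by rewrite -mulrA ler_pM// ?HC' ?HD.
Qed.

Lemma loc_holderV g (m : R) : 0 < m -> (forall x, m <= g x) ->
  loc_holder g -> loc_holder (fun x => (g x)^-1).
Proof.
move=> m0 mg hg r; have [C C0 HC] := hg r.
have g0 x : 0 < g x by rewrite (lt_le_trans m0).
exists (C / (m * m)) => [|x y xr yr]; first by rewrite divr_ge0// ltW// mulr_gt0.
have -> : (g x)^-1 - (g y)^-1 = (g y - g x) * ((g x)^-1 * (g y)^-1).
  by field; rewrite !gt_eqF.
rewrite normrM distrC mulrAC; apply: ler_pM => //; first exact: HC.
rewrite ger0_norm ?mulr_ge0 ?invr_ge0 ?(ltW (g0 _))// invfM.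
by rewrite ler_pM ?invr_ge0 ?(ltW (g0 _))// lef_pV2 ?posrE.
Qed.

(* Local variant of [Cholder] on the whole space. Derivatives are existential
   witnesses rather than values of [pderiv], so that closure under algebraic
   operations and composition is a plain induction on [q]. *)
Fixpoint smooth (q : nat) g : Prop :=
  loc_holder g /\
  if q is q'.+1 then forall i, exists2 dg : 'rV[R]_d -> R,
    (forall x, is_derive x 'e_i g (dg x)) & smooth q' dg
  else True.

Lemma smooth_holder q g : smooth q g -> loc_holder g.
Proof. by case: q => [|q] []. Qed.

Lemma smooth_continuous q g : smooth q g -> continuous g.
Proof. by move=> /smooth_holder/loc_holder_continuous. Qed.

Lemma smoothW q g : smooth q.+1 g -> smooth q g.
Proof.
elim: q g => [|q IH] g; first by case.
case=> hg H; split=> // i; have [dg g_dg sdg] := H i.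
by exists dg => //; exact: IH.
Qed.

Lemma smooth_cst q (c : R) : smooth q (fun=> c).
Proof.
elim: q c => [|q IH] c /=; first by split=> //; exact: loc_holder_cst.
split=> [|i]; first exact: loc_holder_cst.
by exists (fun=> 0) => // x; exact: is_derive_cst.
Qed.

Lemma smooth_coord q i : smooth q (fun x => x 0 i).
Proof.
case: q => [|q]; first by split=> //; exact: loc_holder_coord.
split=> [|j]; first exact: loc_holder_coord.
exists (fun=> ('e_j) 0 i); last exact: smooth_cst.
move=> x; apply/is_derive_epsP => e e0; exists 1 => // h _.
rewrite (_ : _ - _ - _ = 0) ?normr0 ?mulr_ge0 ?(ltW e0)//.
by rewrite !mxE; ring.
Qed.

Lemma smoothD q f g : smooth q f -> smooth q g -> smooth q (fun x => f x + g x).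
Proof.
elim: q f g => [|q IH] f g; first by move=> [hf _] [hg _]; split=> //; exact: loc_holderD.
move=> [hf sf] [hg sg]; split=> [|i]; first exact: loc_holderD.
have [df f_df sdf] := sf i; have [dg g_dg sdg] := sg i.
exists (fun x => df x + dg x); last exact: IH.
by move=> x; exact: is_deriveD.
Qed.

Lemma smoothM q f g : smooth q f -> smooth q g -> smooth q (fun x => f x * g x).
Proof.
elim: q f g => [|q IH] f g; first by move=> [hf _] [hg _]; split=> //; exact: loc_holderM.
move=> sf1 sg1; have [hf sf] := sf1; have [hg sg] := sg1.
split=> [|i]; first exact: loc_holderM.
have [df f_df sdf] := sf i; have [dg g_dg sdg] := sg i.
exists (fun x => f x * dg x + g x * df x); last first.
  by apply: smoothD; apply: IH => //; exact: smoothW.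
by move=> x; exact: is_deriveM.
Qed.

Lemma smoothZ q (c : R) g : smooth q g -> smooth q (fun x => c * g x).
Proof. by apply: smoothM; exact: smooth_cst. Qed.

Lemma smooth_sum q (I : Type) (r : seq I) (P : pred I) (F : I -> 'rV[R]_d -> R) :
  (forall i, P i -> smooth q (F i)) ->
  smooth q (fun x => \sum_(i <- r | P i) F i x).
Proof.
move=> sF; elim: r => [|i r IH].
  by under eq_fun do rewrite big_nil; exact: smooth_cst.
under eq_fun do rewrite big_cons.
by case Pi : (P i) => //; apply: smoothD => //; exact: sF.
Qed.

Lemma smooth_prod q (I : Type) (r : seq I) (P : pred I) (F : I -> 'rV[R]_d -> R) :
  (forall i, P i -> smooth q (F i)) ->
  smooth q (fun x => \prod_(i <- r | P i) F i x).
Proof.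
move=> sF; elim: r => [|i r IH].
  by under eq_fun do rewrite big_nil; exact: smooth_cst.
under eq_fun do rewrite big_cons.
by case Pi : (P i) => //; apply: smoothM => //; exact: sF.
Qed.

Lemma smooth_det q n (A : 'rV[R]_d -> 'M[R]_n) :
  (forall i j, smooth q (fun x => A x i j)) -> smooth q (fun x => \det (A x)).
Proof.
move=> sA; apply: (@smooth_sum _ _ _ xpredT
  (fun (s : 'S_n) x => (-1) ^+ s * \prod_i A x i (s i))) => s _.
by apply: smoothZ; apply: smooth_prod => i _; exact: sA.
Qed.

Lemma smooth_adj q n (A : 'rV[R]_d -> 'M[R]_n) i j :
  (forall i j, smooth q (fun x => A x i j)) ->
  smooth q (fun x => (\adj (A x)) i j).
Proof.
move=> sA; under eq_fun do rewrite mxE /cofactor.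
apply: smoothZ; apply: smooth_det => k l.
by under eq_fun do rewrite !mxE; exact: sA.
Qed.

(** The derivative of 1/g contains 1/g again, but only to one order less, which the induction
    hypothesis provides. *)
Lemma smoothV q g (m : R) : 0 < m -> (forall x, m <= g x) ->
  smooth q g -> smooth q (fun x => (g x)^-1).
Proof.
move=> m0 mg; have g0 x : g x != 0 by rewrite gt_eqF// (lt_le_trans m0).
elim: q => [|q IH]; first by case=> hg _; split=> //; exact: (loc_holderV m0 mg).
move=> sg1; have [hg sg] := sg1; have sV := IH (smoothW sg1).
split=> [|i]; first exact: (loc_holderV m0 mg).
have [dg g_dg sdg] := sg i.
exists (fun x => -1 * ((g x)^-1 * (g x)^-1) * dg x); last first.
  by apply: smoothM => //; apply: smoothZ; exact: smoothM.
move=> x; have [Dg <-] := g_dg x; apply: DeriveDef.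
  exact: (derivableV (g0 x) Dg).
by rewrite (deriveV (g0 x) Dg) mulN1r -expr2 exprVn.
Qed.

Lemma partial_bounded_lip g (dg : 'I_d -> 'rV[R]_d -> R) :
  (forall i z, is_derive z 'e_i g (dg i z)) ->
  (forall i (r : R), exists C : R, forall x, `|x| <= r -> `|dg i x| <= C) ->
  loc_holder g.
Proof.
move=> g_dg dgC; apply: lip_loc_holder => r.
(* The intermediate points lie within |x - y| <= 2 |r| of [y], hence in the ball of radius 3 |r|. *)
have /choice[C CE] (i : 'I_d) := dgC i (`|r| + `|r| + `|r|).
exists (\sum_i `|C i|) => [|x y xr yr]; first by rewrite sumr_ge0.
have [p px ->] := partial_mvt y x g_dg.
rewrite (le_trans (ler_norm_sum _ _ _))// big_distrl/=; apply: ler_sum => i _.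
rewrite normrM mulrC ler_pM//; last first.
  by rewrite (le_trans (coord_le_norm _ _))// norm_le_enorm.
apply: le_trans (ler_norm _); apply: CE.
rewrite -(subrK y (p i)) (le_trans (ler_normD _ _))// lerD//; last first.
  exact: le_trans yr (ler_norm _).
rewrite (le_trans (px i))// (le_trans (ler_normB _ _))//.
by apply: lerD;
    [exact: le_trans xr (ler_norm _)|exact: le_trans yr (ler_norm _)].
Qed.

End holder_class.

Section smooth_composition.
Context {R : realType} {d : nat} (alpha : R).
Hypotheses (alpha0 : 0 < alpha) (alpha1 : alpha <= 1).
Implicit Types (f g : 'rV[R]_d -> R) (x y : 'rV[R]_d).
Local Notation "'e_ i" := (delta_mx 0 i : 'rV[R]_d) (at level 8, i at level 2).

Section lipschitz_map.
Variables (S : 'rV[R]_d -> 'rV[R]_d) (L : R).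
Hypotheses (L0 : 0 <= L)
  (SL : forall x y, enorm (S x - S y) <= L * enorm (x - y)).

Lemma lip_ball (r : R) : exists r' : R, forall x, `|x| <= r -> `|S x| <= r'.
Proof.
exists (L * (Num.sqrt d%:R * r) + `|S 0|) => x xr.
rewrite -[S x](subrK (S 0)) (le_trans (ler_normD _ _))// lerD2r.
rewrite (le_trans (norm_le_enorm _))// (le_trans (SL _ _))// ler_wpM2l//.
by rewrite subr0 (le_trans (enorm_le_norm _))// ler_wpM2l ?sqrtr_ge0.
Qed.

(** A Lipschitz inner map preserves the exponent, whereas an alpha-Hoelder one would only give
    alpha^2. *)
Lemma loc_holder_comp f : loc_holder alpha f -> loc_holder alpha (f \o S).
Proof.
move=> hf r; have [r' r'E] := lip_ball r; have [C C0 H] := hf r'.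
exists (C * L `^ alpha) => [|x y xr yr]; first by rewrite mulr_ge0 ?powR_ge0.
rewrite (le_trans (H _ _ (r'E _ xr) (r'E _ yr)))// -mulrA ler_wpM2l//.
rewrite -powRM ?enorm_ge0// ge0_ler_powR ?nnegrE ?enorm_ge0 ?mulr_ge0 ?enorm_ge0//.
exact: ltW.
Qed.

Lemma lip_map_loc_holder j : loc_holder alpha (fun x => S x 0 j).
Proof.
apply: lip_loc_holder => // r; exists L => // x y _ _.
by rewrite -rowB (le_trans (coord_le_norm _ _))// (le_trans (norm_le_enorm _)).
Qed.

Lemma smooth_comp q f :
  (forall j, smooth alpha q (fun x => S x 0 j)) -> smooth alpha q f ->
  smooth alpha q (f \o S).
Proof.
elim: q f => [|q IH] f sS; first by case=> hf _; split=> //; exact: loc_holder_comp.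
case=> hf sf; split=> [|i]; first exact: loc_holder_comp.
have {sf}/choice[df sf] j : exists dg : 'rV[R]_d -> R,
    (forall x, is_derive x 'e_j f (dg x)) /\ smooth alpha q dg.
  by have [dg] := sf j; exists dg.
have /choice[dS dSE] j : exists dg : 'rV[R]_d -> R,
    (forall x, is_derive x 'e_i (fun y => S y 0 j) (dg x)) /\ smooth alpha q dg.
  by have [_ /(_ i)[dg]] := sS j; exists dg.
exists (fun x => \sum_j dS j x * df j (S x)).
  move=> x; apply: is_derive_comp_row.
  - by move=> j z; case: (sf j).
  - by move=> j; case: (sf j) => _ /smooth_continuous; exact.
  - by move=> j; case: (dSE j).
apply: smooth_sum => // j _; apply: smoothM => //; first by case: (dSE j).
apply: IH => [k|]; last by case: (sf j).
exact: smoothW.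
Qed.

End lipschitz_map.

Section inverse_map.
Variables (c : R) (T S : 'rV[R]_d -> 'rV[R]_d) (J : 'rV[R]_d -> 'M[R]_d).
Hypotheses (c0 : 0 < c) (mT : strongly_monotone c T) (ST : forall y, T (S y) = y)
  (TJ : forall x, has_jac T x (J x)).

Lemma monotone_inverse_lip x y : enorm (S x - S y) <= c^-1 * enorm (x - y).
Proof.
by rewrite ler_pdivlMl// (le_trans (strongly_monotone_lip _ _ c0 mT))// !ST.
Qed.

(** The expansion of [T] at [S y], evaluated at S (y + h e_i), says that h e_i is the increment of
    [S] times [J] up to a remainder. Multiplying by the adjugate solves for the increment, and the
    Lipschitz bound on [S] makes the remainder o(h). *)
Lemma inverse_derive i j y : 0 < \det (J (S y)) ->
  is_derive y 'e_i (fun y => S y 0 j)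
    ((\det (J (S y)))^-1 * (\adj (J (S y))) i j).
Proof.
set x := S y; set D := \det _ => D0; apply/is_derive_epsP => e e0.
pose K := 1 + \sum_k `|(\adj (J x)) k j|.
have K0 : 0 < K by rewrite ltr_pwDl// sumr_ge0.
have e10 : 0 < e * D * c / K by rewrite divr_gt0 ?mulr_gt0.
have [r r0 H] := TJ x e10.
exists (r * c) => [|h hr]; first by rewrite mulr_gt0.
set x' := S (y + h *: 'e_i).
have Dx : `|x' - x| <= c^-1 * `|h|.
  rewrite (le_trans (norm_le_enorm _))// (le_trans (monotone_inverse_lip _ _))//.
  rewrite ler_pM2l ?invr_gt0// addrAC subrr add0r enormZ -[leRHS]mulr1.
  rewrite ler_wpM2l// /enorm /dotp (bigD1 i)//= big1 => [|k ki].
    by rewrite !mxE !eqxx mul1r addr0 sqrtr1.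
  by rewrite !mxE (negbTE ki) andbF mul0r.
have xr : `|x' - x| < r by rewrite (le_lt_trans Dx)// mulrC ltr_pdivrMr.
have {}H := H _ xr; rewrite !ST [y + _]addrC addrK in H.
set rem := _ - _ *m _ in H.
have E : h * (\adj (J x)) i j - (x' - x) 0 j * D = (rem *m \adj (J x)) 0 j.
  rewrite mulmxBl -mulmxA mul_mx_adj mul_mx_scalar [RHS]rowB !mxE (mulrC D).
  congr (_ - _); rewrite (bigD1 i)//= big1 => [|k ki].
    by rewrite !mxE !eqxx mulr1 addr0.
  by rewrite !mxE (negbTE ki) andbF mulr0 mul0r.
have adjK : `|(rem *m \adj (J x)) 0 j| <= K * `|rem|.
  rewrite mxE (le_trans (ler_norm_sum _ _ _))// mulrDl mul1r big_distrl/=.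
  rewrite -[leLHS]add0r lerD//; apply: ler_sum => k _.
  by rewrite normrM mulrC ler_wpM2l// coord_le_norm.
rewrite -(ler_pM2r D0) -[X in _ * X <= _](gtr0_norm D0) -normrM.
have -> : (x' 0 j - x 0 j - h * (D^-1 * (\adj (J x)) i j)) * D =
    - (h * (\adj (J x)) i j - (x' - x) 0 j * D).
  by rewrite rowB; field; rewrite gt_eqF.
rewrite normrN E (le_trans adjK)//.
apply: (@le_trans _ _ (K * (e * D * c / K * (c^-1 * `|h|)))).
  by rewrite ler_pM2l// (le_trans H)// ler_wpM2l// ltW.
rewrite le_eqVlt; apply/orP; left; apply/eqP; field.
by rewrite !gt_eqF.
Qed.

(* Bootstraps on [DS = (J \o S)^-1]. *)
Lemma smooth_inverse (m : R) : 0 < m -> (forall x, m <= \det (J x)) ->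
  (forall q i j, smooth alpha q (fun x => J x i j)) ->
  forall q j, smooth alpha q (fun y => S y 0 j).
Proof.
move=> m0 mJ sJ; have c0' : 0 <= c^-1 by rewrite invr_ge0 ltW.
elim=> [|q IH] j.
  by split=> //; apply: (lip_map_loc_holder c0'); exact: monotone_inverse_lip.
split=> [|i]; first by apply: (lip_map_loc_holder c0'); exact: monotone_inverse_lip.
exists ((fun x => (\det (J x))^-1 * (\adj (J x)) i j) \o S).
  by move=> y; apply: inverse_derive; rewrite (lt_le_trans m0).
apply: (smooth_comp c0' monotone_inverse_lip) => //.
apply: smoothM => //; last exact: smooth_adj.
by apply: (smoothV alpha0 m0) => //; exact: smooth_det.
Qed.

End inverse_map.
End smooth_composition.

Section smooth_holder_spaces.
Context {R : realType} {d : nat} (alpha : R).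
Hypotheses (alpha0 : 0 < alpha) (alpha1 : alpha <= 1).
Implicit Types (f g : 'rV[R]_d -> R) (x y : 'rV[R]_d).
Local Notation "'e_ i" := (delta_mx 0 i : 'rV[R]_d) (at level 8, i at level 2).

(** Induction on the number m of derivatives still to be taken: those of order q are Hoelder by
    hypothesis, and those of lower order are locally Lipschitz because the next partial derivatives
    are locally bounded. *)
Lemma smooth_of_Cholder_loc q f : Cholder_loc q alpha f -> smooth alpha q f.
Proof.
move=> hf.
have hball (r : R) : Cholder q alpha (ball (0 : 'rV[R]_d) (`|r| + 1)) f.
  apply: hf; first exact: ball_open.
  exists (`|r| + 1); split=> // M rM x; rewrite -ball_normE /ball_/= sub0r normrN.
  by move=> /lt_trans/(_ rM)/ltW.
have inball (r : R) x : `|x| <= r -> ball (0 : 'rV[R]_d) (`|r| + 1) x.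
  move=> xr; rewrite -ball_normE /ball_/= sub0r normrN.
  by rewrite (le_lt_trans xr)// (le_lt_trans (ler_norm r))// ltrDl.
suff H m s : (size s + m = q)%N -> smooth alpha m (pderiv s f) by exact: (H q [::]).
elim: m s => [|m IH] s sq.
  split=> // r; have [_ _ _ /(_ s)] := hball r; rewrite -sq addn0 => /(_ erefl)[C HC].
  exists `|C| => // x y /inball xr /inball yr.
  by rewrite (le_trans (HC _ _ xr yr))// ler_wpM2r ?powR_ge0// ler_norm.
have s_lt : (size s < q)%N by rewrite -sq addnS ltnS leq_addr.
have ds i x : is_derive x 'e_i (pderiv s f) (pderiv (i :: s) f x).
  apply: derivableP; have [_ [dsf _] _ _] := hball `|x|.
  by apply: dsf => //; exact: inball.
have IHs i : smooth alpha m (pderiv (i :: s) f) by apply: IH; rewrite /= addSnnS.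
split=> [|i]; last by exists (pderiv (i :: s) f).
apply: (partial_bounded_lip alpha1 ds) => i r.
have [_ _ /(_ (i :: s) s_lt)[C HC] _] := hball r.
by exists C => x /inball/HC.
Qed.

Lemma smooth_pderiv q g s : (size s <= q)%N -> smooth alpha q g ->
  smooth alpha (q - size s) (pderiv s g).
Proof.
move=> + sg; elim: s => [|i s IH] /= sq; first by rewrite subn0.
have := IH (ltnW sq).
have -> : (q - size s = (q - (size s).+1).+1)%N by rewrite subnSK.
case=> _ /(_ i)[dg g_dg].
by rewrite (_ : dg = 'D_('e_i) (pderiv s g))//; apply/funext => x; have [] := g_dg x.
Qed.

Lemma pderiv_eq_open (Y : set 'rV[R]_d) f g s : open Y ->
  (forall x, Y x -> f x = g x) -> forall x, Y x -> pderiv s f x = pderiv s g x.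
Proof.
move=> oY fg; elim: s => [//|i s IH] x Yx /=.
by apply: near_eq_derive; apply: filterS (open_nbhs_nbhs (conj oY Yx)) => y /IH.
Qed.

(** Meant for a density [f] cut off outside the closure of [Y], hence compared with the smooth [g]
    there only. Derivatives agree on the open set [Y], and its boundedness turns local bounds into
    bounds on all of [Y]. *)
Lemma smooth_Cholder q (Y : set 'rV[R]_d) f g : open Y -> bounded_set Y ->
  smooth alpha q g -> (forall x, closure Y x -> f x = g x) ->
  Cholder q alpha Y f.
Proof.
move=> oY bY sg fg.
have Yfg x : Y x -> f x = g x by move=> Yx; apply: fg; exact: subset_closure.
have pE s x : Y x -> pderiv s f x = pderiv s g x by exact: pderiv_eq_open.
have nE s x : Y x -> \forall y \near x, pderiv s g y = pderiv s f y.
  by move=> Yx; apply: filterS (open_nbhs_nbhs (conj oY Yx)) => y /pE.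
have [r rY] : exists r : R, forall x, Y x -> `|x| <= r.
  by have [M [_ MY]] := bY; exists (M + 1); apply: MY; rewrite ltrDl.
have ss s : (size s <= q)%N -> smooth alpha (q - size s) (pderiv s g).
  by move=> sq; exact: smooth_pderiv.
split.
- apply: (@subspace_eq_continuous _ (closure Y) _ g).
    by move=> x; rewrite inE => /fg.
  by apply: continuous_subspaceT; exact: smooth_continuous sg.
- split=> [s i x sq Yx|s x sq Yx].
    apply: near_eq_derivable (nE s x Yx) _.
    have := ss s (ltnW sq); have -> : (q - size s = (q - (size s).+1).+1)%N.
      by rewrite subnSK.
    by case=> _ /(_ i)[dg g_dg _]; have [] := g_dg x.
  have := smooth_continuous alpha0 (ss s sq).
  move=> /(_ x) cg; apply: cvg_trans; last first.
    by rewrite /= (pE s x Yx); exact: cg.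
  exact: (@near_eq_cvg _ _ (nbhs x) (nbhs_filter x) _ _ (nE s x Yx)).
- move=> s sq; have [C _ HC] := loc_holder_bounded alpha0 (smooth_holder (ss s sq)) r.
  by exists C => x Yx; rewrite pE// HC// rY.
- move=> s sq; have sq' : (size s <= q)%N by rewrite sq.
  have [C _ HC] := smooth_holder (ss s sq') r.
  by exists C => x y Yx Yy; rewrite !pE// HC// rY.
Qed.

End smooth_holder_spaces.

(** * Couplings and Kantorovich potentials *)

Section real_integrals.
Context dT (T : measurableType dT) (R : realType) (P : probability T R).
Implicit Types f g : T -> R.

Lemma integral_EFinE f : P.-integrable [set: T] (EFin \o f) ->
  (\int[P]_x (f x)%:E)%E = (\int[P]_x f x)%:E.
Proof. by move=> intf; rewrite fineK//; exact: integrable_fin_num. Qed.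

Lemma integrableT_D f g : P.-integrable [set: T] (EFin \o f) ->
  P.-integrable [set: T] (EFin \o g) ->
  P.-integrable [set: T] (EFin \o (fun x => f x + g x)).
Proof. by move=> intf intg; exact: (integrableD measurableT intf intg). Qed.

Lemma integrableT_Z (k : R) f : P.-integrable [set: T] (EFin \o f) ->
  P.-integrable [set: T] (EFin \o (fun x => k * f x)).
Proof. by move=> intf; exact: (integrableZl measurableT k intf). Qed.

Lemma integrableT_le f g : measurable_fun [set: T] f ->
  (forall x, `|f x| <= g x) -> P.-integrable [set: T] (EFin \o g) ->
  P.-integrable [set: T] (EFin \o f).
Proof.
move=> mf fg intg; apply: (le_integrable measurableT _ _ intg); first exact/measurable_EFinP.
by move=> x _ /=; rewrite lee_fin (le_trans (fg x))// ler_norm.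
Qed.

Lemma integrableT_sum (I : Type) (r : seq I) (F : I -> T -> R) :
  (forall i, P.-integrable [set: T] (EFin \o F i)) ->
  P.-integrable [set: T] (EFin \o (fun x => \sum_(i <- r) F i x)).
Proof.
move=> intF; rewrite (_ : _ \o _ = fun x => (\sum_(i <- r) (F i x)%:E)%E).
  by apply: (integrable_sum measurableT) => i _; exact: intF.
by apply/funext => x /=; rewrite sumEFin.
Qed.

Lemma integrableT_cst (k : R) : P.-integrable [set: T] (EFin \o (fun=> k)).
Proof. exact: finite_measure_integrable_cst. Qed.

Lemma Rintegral_sum (I : Type) (r : seq I) (F : I -> T -> R) :
  (forall i, P.-integrable [set: T] (EFin \o F i)) ->
  \int[P]_x (\sum_(i <- r) F i x) = \sum_(i <- r) \int[P]_x F i x.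
Proof.
move=> intF; elim: r => [|i r IH].
  rewrite big_nil; under eq_Rintegral do rewrite big_nil.
  by rewrite Rintegral_cst// mul0r.
under eq_Rintegral do rewrite big_cons.
by rewrite big_cons RintegralD ?IH//; exact: integrableT_sum.
Qed.

Lemma integrableT_lty f : measurable_fun [set: T] f -> (forall x, 0 <= f x) ->
  (\int[P]_x (f x)%:E < +oo)%E -> P.-integrable [set: T] (EFin \o f).
Proof.
move=> mf f0 fy; apply/integrableP; split; first exact/measurable_EFinP.
by under eq_integral do rewrite /= ger0_norm//.
Qed.
End real_integrals.

Section laws.
Context dT (T : measurableType dT) dU (U : measurableType dU) (R : realType).
Variables (P : probability T R) (X : T -> U) (mu : probability U R).

Definition has_law := measurable_fun [set: T] X /\
  forall A, measurable A -> P (X @^-1` A) = mu A.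

Hypothesis lawX : has_law.

Lemma law_integral (g : U -> \bar R) : measurable_fun [set: U] g ->
  (forall x, 0 <= g x)%E -> (\int[P]_x g (X x) = \int[mu]_x g x)%E.
Proof.
move=> mg g0; have [mX XE] := lawX.
have := @ge0_integral_pushforward _ _ _ _ R X mX P setT g measurableT mg
  (fun x _ => g0 x).
rewrite preimage_setT => <-.
by apply: eq_measure_integral => A mA _; exact: XE.
Qed.

Lemma law_integrable (g : U -> R) : mu.-integrable [set: U] (EFin \o g) ->
  P.-integrable [set: T] (EFin \o (fun x => g (X x))).
Proof.
move=> intg; have mg : measurable_fun setT g.
  by apply/measurable_EFinP; exact: measurable_int intg.
apply/integrableP; split.
  by apply/measurable_EFinP; apply: measurableT_comp mg _; case: lawX.
rewrite (@law_integral (fun x => `|(g x)%:E|%E)) ?abse_ge0//.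
  by have /integrableP[] := intg.
by apply: measurableT_comp => //; exact/measurable_EFinP.
Qed.

Lemma law_Rintegral (g : U -> R) : mu.-integrable [set: U] (EFin \o g) ->
  \int[P]_x g (X x) = \int[mu]_x g x.
Proof.
move=> intg; have mg : measurable_fun setT g.
  by apply/measurable_EFinP; exact: measurable_int intg.
have [mX XE] := lawX; congr fine.
have /= <- := @integral_pushforward _ _ _ _ R X mX P setT (EFin \o g).
- by apply: eq_measure_integral => A mA _; exact: XE.
- exact/measurable_EFinP.
- exact: law_integrable.
- exact: measurableT.
Qed.
End laws.

Section quadratic_bounds.
Context {R : realType} {d : nat}.
Local Notation E := 'rV[R]_d.
Implicit Types (g h : E -> R) (mu : probability E R).

(** Measurable functions of at most quadratic growth. They are integrable against every law in [P2],
    so that potentials and costs can be handled through real-valued integrals. *)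
Definition quadb g := measurable_fun [set: E] g /\
  exists C : R, forall x, `|g x| <= C * (1 + dotp x x).

Lemma quadb_cst (k : R) : quadb (fun=> k).
Proof.
split=> //; exists `|k| => x; rewrite mulrDr mulr1 lerDl.
by rewrite mulr_ge0 ?dotp_sqr_ge0.
Qed.

Lemma measurable_dotpp d' (U : measurableType d') (f g : U -> E) :
  measurable_fun [set: U] f -> measurable_fun [set: U] g ->
  measurable_fun [set: U] (fun x => dotp (f x) (g x)).
Proof.
move=> mf mg; apply: measurable_sum => i; apply: measurable_funM.
  exact: measurableT_comp (measurable_coord 0 i) mf.
exact: measurableT_comp (measurable_coord 0 i) mg.
Qed.

Lemma measurable_enorm2 d' (U : measurableType d') (f g : U -> E) :
  measurable_fun [set: U] f -> measurable_fun [set: U] g ->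
  measurable_fun [set: U] (fun x => enorm (f x - g x) ^+ 2).
Proof.
move=> mf mg; under eq_fun do rewrite enorm_sqr.
under eq_fun do rewrite dotpBl !dotpBr.
by apply: measurable_funB; apply: measurable_funB; exact: measurable_dotpp.
Qed.

Lemma quadb_enorm2 : quadb (fun x => enorm x ^+ 2).
Proof.
split.
  by under eq_fun do rewrite enorm_sqr; exact: measurable_dotpp.
by exists 1 => x; rewrite enorm_sqr mul1r ger0_norm ?dotp_sqr_ge0// lerDr.
Qed.

Lemma quadbD g h : quadb g -> quadb h -> quadb (fun x => g x + h x).
Proof.
move=> [mg [C HC]] [mh [D HD]]; split; first exact: measurable_funD.
exists (C + D) => x; rewrite mulrDl (le_trans (ler_normD _ _))//.
exact: lerD.
Qed.

Lemma quadbZ (k : R) g : quadb g -> quadb (fun x => k * g x).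
Proof.
move=> [mg [C HC]]; split; first exact: measurable_funM.
by exists (`|k| * C) => x; rewrite normrM -mulrA ler_wpM2l.
Qed.

Lemma quadb_comp g (T : E -> E) : quadb g -> measurable_fun [set: E] T ->
  quadb (fun x => enorm (T x) ^+ 2) -> quadb (fun x => g (T x)).
Proof.
move=> [mg [C HC]] mT [_ [D HD]]; split; first exact: measurableT_comp.
exists (`|C| * (1 + D)) => x; rewrite (le_trans (HC _))//.
apply: (@le_trans _ _ (`|C| * (1 + dotp (T x) (T x)))).
  by rewrite ler_wpM2r ?ler_norm// addr_ge0 ?dotp_sqr_ge0.
rewrite -mulrA ler_wpM2l// mulrDl mul1r lerD//.
  by rewrite lerDl dotp_sqr_ge0.
by rewrite -enorm_sqr (le_trans (ler_norm _)).
Qed.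

Lemma quadb_dotp (f g : E -> E) :
  measurable_fun [set: E] f -> measurable_fun [set: E] g ->
  quadb (fun x => enorm (f x) ^+ 2) -> quadb (fun x => enorm (g x) ^+ 2) ->
  quadb (fun x => dotp (f x) (g x)).
Proof.
move=> mf mg [_ [C HC]] [_ [D HD]]; split; first exact: measurable_dotpp.
exists (C + D) => x; have f0 := dotp_sqr_ge0 (f x); have g0 := dotp_sqr_ge0 (g x).
rewrite mulrDl (le_trans _ (lerD (HC x) (HD x)))//.
have := dotp_young (f x) (g x) ltr01; have := dotp_young (f x) (- g x) ltr01.
rewrite !dotpNr dotpNl opprK invr1 !mul1r !enorm_sqr (ger0_norm f0) (ger0_norm g0) => h1 h2.
by rewrite ler_norml; apply/andP; split; lra.
Qed.

Lemma quadb_integrable mu g : P2 mu -> quadb g ->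
  mu.-integrable [set: E] (EFin \o g).
Proof.
move=> mu2 [mg [C HC]]; apply: integrableT_le mg HC _.
apply: integrableT_Z; apply: integrableT_D; first exact: integrableT_cst.
apply: integrableT_lty; first exact: measurable_dotpp.
  exact: dotp_sqr_ge0.
by move: mu2; rewrite /P2; under eq_integral do rewrite enorm_sqr.
Qed.

Lemma quadb_law_P2 (P : probability E R) (T : E -> E) mu :
  P2 P -> has_law P T mu -> quadb (fun x => enorm (T x) ^+ 2) -> P2 mu.
Proof.
move=> P2P lT qT; rewrite /P2.
rewrite -(@law_integral _ _ _ _ _ _ _ _ lT (fun x => (enorm x ^+ 2)%:E)).
- by rewrite integral_EFinE ?ltry//; exact: quadb_integrable.
- by apply/measurable_EFinP; case: quadb_enorm2.
- by move=> x; rewrite lee_fin sqr_ge0.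
Qed.

End quadratic_bounds.

Section couplings.
Context {R : realType} {d : nat}.
Local Notation E := 'rV[R]_d.
Implicit Types (mu nu : probability E R).

Lemma coupling_law mu nu p : coupling mu nu p ->
  has_law p fst mu /\ has_law p snd nu.
Proof.
move=> [p1 p2]; split; split=> // A mA.
  by rewrite -p1//; congr (p _); apply/seteqP; split=> -[x y] //= [].
by rewrite -p2//; congr (p _); apply/seteqP; split=> -[x y] //= [].
Qed.

Lemma W2_sqr mu nu : (W2 mu nu ^+ 2 =
  ereal_inf [set \int[p]_z (enorm (z.1 - z.2) ^+ 2)%:E | p in coupling mu nu])%E.
Proof.
rewrite /W2; set m := ereal_inf _.
have : (0 <= m)%E.
  apply: le_ereal_inf_tmp => _ [p _ <-]; apply: integral_ge0 => z _.
  by rewrite lee_fin sqr_ge0.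
case: m => [r| |]// r0; last by rewrite poweRyr ?invr_eq0 ?pnatr_eq0// expe2.
rewrite lee_fin in r0; by rewrite poweR_EFin expe2 -EFinM -expr2 powR12_sqrt// sqr_sqrtr.
Qed.

(** The joint law of [X] and [Y] is a coupling, so a coupling may be given by two maps on whatever
    probability space is convenient. *)
Lemma W2_sqr_le dT (T : measurableType dT) (P : probability T R) (X Y : T -> E)
    mu nu : has_law P X mu -> has_law P Y nu ->
  (W2 mu nu ^+ 2 <= \int[P]_t (enorm (X t - Y t) ^+ 2)%:E)%E.
Proof.
move=> [mX XE] [mY YE]; rewrite W2_sqr.
have mXY : measurable_fun setT (fun t => (X t, Y t)) by exact: measurable_fun_pair.
pose XY : {mfun T >-> (E * E)%type} :=
  HB.pack (fun t => (X t, Y t)) (isMeasurableFun.Build _ _ _ _ _ mXY).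
pose p : probability (E * E)%type R := distribution P XY.
apply: ereal_inf_lbound; exists p.
  split=> A mA.
    rewrite -XE// /p /distribution /pushforward/=; congr (P _).
    by apply/seteqP; split=> t //= [].
  rewrite -YE// /p /distribution /pushforward/=; congr (P _).
  by apply/seteqP; split=> t //= [].
rewrite /p ge0_integral_distribution//.
  by apply/measurable_EFinP; apply: measurable_enorm2.
by move=> z; rewrite lee_fin sqr_ge0.
Qed.

Lemma enorm_sqr_leD (x y : E) : enorm (x - y) ^+ 2 <= 2 * enorm x ^+ 2 + 2 * enorm y ^+ 2.
Proof.
rewrite !enorm_sqr; have := dotp_sqr_ge0 (x + y).
rewrite !dotpDl !dotpDr !dotpNl !dotpNr (dotpC y x); lra.
Qed.

Lemma integrable_sqdist dT (T : measurableType dT) (P : probability T R)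
    (X Y : T -> E) mu nu :
  P2 mu -> P2 nu -> has_law P X mu -> has_law P Y nu ->
  P.-integrable [set: T] (EFin \o (fun t => enorm (X t - Y t) ^+ 2)).
Proof.
move=> mu2 nu2 lX lY.
apply: (@integrableT_le _ _ _ _ _
  (fun t => 2 * enorm (X t) ^+ 2 + 2 * enorm (Y t) ^+ 2)).
- by apply: measurable_enorm2; [case: lX|case: lY].
- by move=> t; rewrite ger0_norm ?sqr_ge0// enorm_sqr_leD.
apply: integrableT_D; apply: integrableT_Z.
  exact: (law_integrable lX (quadb_integrable mu2 quadb_enorm2)).
exact: (law_integrable lY (quadb_integrable nu2 quadb_enorm2)).
Qed.

(* By Markov's inequality [mu F] exceeds the mass under [nu] of a neighbourhood
   of [F] by at most the probability that [X] and [Y] are far apart. *)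
Lemma closed_le_of_near_laws mu nu (F : set E) : closed F ->
  (forall e : R, 0 < e -> exists (p : probability (E * E)%type R)
     (X Y : E * E -> E), [/\ has_law p X mu, has_law p Y nu &
     (\int[p]_t (enorm (X t - Y t) ^+ 2)%:E <= e%:E)%E]) ->
  (mu F <= nu F)%E.
Proof.
move=> cF near_laws.
have mF : measurable F.
  by rewrite -(setCK F); apply: measurableC; apply: open_measurable_mx; exact: closed_openC.
pose Fd (r : R) := \bigcup_(x in F) ball x r.
have oFd r : open (Fd r) by apply: bigcup_open => x _; exact: ball_open.
have mFd r : measurable (Fd r) by exact: open_measurable_mx.
have muFd (r : R) : 0 < r -> (mu F <= nu (Fd r))%E.
  move=> r0; apply/lee_addgt0Pr => e e0.
  have e20 : 0 < r ^+ 2 * e by rewrite mulr_gt0// exprn_gt0.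
  have [p [X [Y [lX lY XY]]]] := near_laws _ e20.
  have [mX XE] := lX; have [mY YE] := lY.
  have md := measurable_enorm2 mX mY.
  pose B := [set t | r ^+ 2 <= enorm (X t - Y t) ^+ 2].
  have mB : measurable B.
    rewrite -[B]setTI; apply: measurable_fun_le => //; exact: measurable_cst.
  have pB : (p B <= e%:E)%E.
    have r20 : (0 < (r ^+ 2)%:E)%E by rewrite lte_fin exprn_gt0.
    rewrite -(lee_pmul2l _ r20)// -EFinM; apply: le_trans XY.
    rewrite -integral_cst//.
    apply: (@le_trans _ _ (\int[p]_(t in B) (enorm (X t - Y t) ^+ 2)%:E)%E).
      apply: ge0_le_integral => //.
      + by move=> *; exact: ltW.
      + by apply/measurable_EFinP; exact: measurable_funTS.
    apply: ge0_subset_integral => //.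
    - exact/measurable_EFinP.
    - by move=> t _; rewrite lee_fin sqr_ge0.
  have mXF : measurable (X @^-1` F) by rewrite -[_ @^-1` _]setTI; exact: mX.
  have mYF : measurable (Y @^-1` Fd r) by rewrite -[_ @^-1` _]setTI; exact: mY.
  rewrite -XE// -YE//; apply: (@le_trans _ _ (p (Y @^-1` Fd r `|` B))).
    apply: le_measure; rewrite ?inE//; first exact: measurableU.
    move=> t /= Ft; have [h|h] := leP (r ^+ 2) (enorm (X t - Y t) ^+ 2); [by right|left].
    exists (X t) => //; rewrite -ball_normE /ball_/=.
    rewrite (le_lt_trans (norm_le_enorm _))//.
    by rewrite -(@ltr_pXn2r _ 2)// nnegrE ?enorm_ge0// ltW.
  by rewrite (le_trans (measureU2 _ _ _))// leeD2l.
have capE : \bigcap_n Fd n.+1%:R^-1 = F.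
  apply/seteqP; split=> x.
    move=> xF; rewrite ((closure_id F).1 cF) => B /nbhs_ballP[r /= r0 xrB].
    have [n _ nr] : \forall n \near \oo, n.+1%:R^-1 < r.
      exact: near_infty_natSinv_lt (PosNum r0).
    have [y Fy yx] := xF n Logic.I; exists y; split=> //.
    apply: xrB; apply: (@le_ball _ _ _ n.+1%:R^-1); first by apply/ltW/nr => /=.
    exact: ball_sym.
  by move=> Fx n _; exists x => //; apply: ballxx; rewrite invr_gt0.
have cv : nu (Fd n.+1%:R^-1) @[n --> \oo] --> nu F.
  rewrite -capE; apply: nonincreasing_cvg_mu => //.
  - by rewrite (le_lt_trans (probability_le1 _ _))// ltry.
  - by rewrite capE.
  - apply/nonincreasing_seqP => n; apply/subsetPset => x [y Fy yx].
    exists y => //; apply: le_ball yx.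
    by rewrite lef_pV2 ?posrE// ler_nat.
rewrite -(cvg_lim _ cv)//; apply: lime_ge; first by apply/cvg_ex; exists (nu F).
by apply: nearW => n; rewrite muFd// invr_gt0.
Qed.

(** By complement the laws agree on open sets, a generating class stable under intersection. *)
Lemma eq_probability_closed mu nu :
  (forall F : set E, closed F -> (mu F = nu F)%E) ->
  forall A, measurable A -> mu A = nu A.
Proof.
move=> munu A mA.
apply: (@measure_unique _ _ _ (@open E) (fun=> setT)) => //.
- by move=> B C; exact: openI.
- by move=> _; exact: openT.
- by rewrite bigcup_const//; exists 0%N.
- move=> U oU; have mU := open_measurable_mx oU.
  have UC (p : probability E R) : (p U = 1 - p (~` U))%E.
    by rewrite -probability_setC ?setCK//; exact: measurableC.
  by apply: etrans (UC mu) _; rewrite munu -?UC//; exact: open_closedC.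
- by move=> n; rewrite /= probability_setT ltry.
Qed.

End couplings.

(** * Potentials of a strongly convex gradient *)

Section brenier_maps.
Context {R : realType} {d : nat}.
Local Notation E := 'rV[R]_d.
Variables (c : R) (phi : E -> R) (T S : E -> E).

(** One subgradient inequality expresses both that [T] is the gradient of [phi] and that [phi] is
    strongly convex; the potentials are studied through it. *)
Definition strongly_convex_gradient := forall x z,
  phi x + dotp (T x) (z - x) + c / 2 * dotp (z - x) (z - x) <= phi z.

(** The convex conjugate of [phi], whose supremum is attained at the point [S y] where the gradient
    is [y]; see [conj_valueE]. *)
Definition conj_value y := dotp y (S y) - phi (S y).

(* Kantorovich potentials for the squared distance:
   [pot_src x + pot_dst y <= |x - y|^2], with equality when [y = T x]. *)
Definition pot_src x := enorm x ^+ 2 - 2 * phi x.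
Definition pot_dst y := enorm y ^+ 2 - 2 * conj_value y.

Hypotheses (c0 : 0 < c) (phi_T : strongly_convex_gradient)
  (TS : forall y, T (S y) = y).

Lemma gradient_strongly_monotone : strongly_monotone c T.
Proof.
move=> x z; have := phi_T x z; have := phi_T z x.
rewrite -(opprB x z) !dotpNl !dotpNr opprK dotpBl; lra.
Qed.

Lemma gradient_inverseK x : S (T x) = x.
Proof. by apply: (strongly_monotone_inj c0 gradient_strongly_monotone); rewrite TS. Qed.

(** Fenchel-Young with its quadratic remainder: twice the subgradient inequality at [S y], where the
    gradient is [y]. *)
Lemma sqdist_ge_potentials x y :
  pot_src x + pot_dst y + c * enorm (x - S y) ^+ 2 <= enorm (x - y) ^+ 2.
Proof.
have := phi_T (S y) x; rewrite TS /pot_src /pot_dst /conj_value !enorm_sqr.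
set D := dotp (x - S y) (x - S y).
rewrite [dotp y (x - _)]dotpBr [dotp (x - y) _]dotpBl !dotpBr (dotpC x y); lra.
Qed.

Lemma sqdist_eq_potentials x : enorm (x - T x) ^+ 2 = pot_src x + pot_dst (T x).
Proof.
rewrite /pot_src /pot_dst /conj_value gradient_inverseK !enorm_sqr.
rewrite dotpBl !dotpBr (dotpC x (T x)); lra.
Qed.

Lemma conj_valueE y :
  ereal_sup (range (fun x => (dotp y x - phi x)%:E)) = (conj_value y)%:E.
Proof.
apply/eqP; rewrite eq_le; apply/andP; split.
  apply: ge_ereal_sup => _ [x _ <-]; rewrite lee_fin /conj_value.
  have := phi_T (S y) x; rewrite TS dotpBr.
  have : 0 <= c / 2 * dotp (x - S y) (x - S y).
    by rewrite mulr_ge0 ?dotp_sqr_ge0// divr_ge0 ?ltW.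
  lra.
by apply: ereal_sup_ubound; exists (S y).
Qed.

Lemma gradient_inverse_lip x y : enorm (S x - S y) <= c^-1 * enorm (x - y).
Proof. exact: monotone_inverse_lip c0 gradient_strongly_monotone TS x y. Qed.

Lemma measurable_gradient_inverse : measurable_fun [set: E] S.
Proof.
apply: continuous_measurable_mx => x; apply/continuous_atP => e e0.
pose K := c^-1 * (Num.sqrt d%:R + 1).
have K0 : 0 < K by rewrite mulr_gt0 ?invr_gt0// ltr_pwDr ?sqrtr_ge0.
exists (e / K) => [|y yx]; first exact: divr_gt0.
rewrite (le_lt_trans (norm_le_enorm _))// (le_lt_trans (gradient_inverse_lip _ _))//.
apply: (@le_lt_trans _ _ (K * `|y - x|)); last by rewrite mulrC -ltr_pdivlMr.
rewrite /K -mulrA ler_pM2l ?invr_gt0// (le_trans (enorm_le_norm _))//.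
by rewrite ler_wpM2r// lerDl.
Qed.

Lemma quadb_gradient_inverse : quadb (fun y => enorm (S y) ^+ 2).
Proof.
split.
  under eq_fun do rewrite enorm_sqr.
  by apply: measurable_dotpp; exact: measurable_gradient_inverse.
exists (2 * c^-1 ^+ 2 + 2 * enorm (S 0) ^+ 2) => y.
rewrite ger0_norm ?sqr_ge0//.
have := enorm_sqr_leD (S y - S 0) (- S 0); rewrite opprK subrK enormN => h.
have k : enorm (S y - S 0) ^+ 2 <= c^-1 ^+ 2 * dotp y y.
  rewrite -enorm_sqr -exprMn ler_pXn2r ?nnegrE ?mulr_ge0 ?enorm_ge0 ?invr_ge0 ?(ltW c0)//.
  by rewrite -{2}(subr0 y); exact: gradient_inverse_lip.
have y0 := dotp_sqr_ge0 y.
have s0 := sqr_ge0 (enorm (S 0)); have c20 := sqr_ge0 c^-1.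
nra.
Qed.

Hypotheses (mphi : measurable_fun [set: E] phi) (mT : measurable_fun [set: E] T)
  (qT : quadb (fun x => enorm (T x) ^+ 2)).

Let qid : quadb (fun x : E => enorm x ^+ 2). Proof. exact: quadb_enorm2. Qed.

(** The subgradient inequality from 0 to x bounds phi x below by an affine function; the one from x
    to 0 bounds it above by phi 0 plus the product of T x and x, which is quadratic because T grows
    linearly. *)
Lemma quadb_potential : quadb phi.
Proof.
split=> //.
have [_ [C HC]] := quadb_dotp mT (@measurable_id _ _ setT) qT qid.
have [_ [D HD]] : quadb (dotp (T 0)).
  apply: (@quadb_dotp _ _ (fun=> T 0) id) => //; exact: quadb_cst.
exists (C + D + `|phi 0|) => x.
have N0 : 0 <= dotp x x by exact: dotp_sqr_ge0.
have cN : 0 <= c / 2 * dotp x x by rewrite mulr_ge0// divr_ge0// ltW.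
have := phi_T x 0; have := phi_T 0 x; rewrite subr0 sub0r !dotpNr !dotpNl opprK.
have := HC x; have := HD x; rewrite !ler_norml => /andP[h1 h2] /andP[h3 h4] h5 h6.
have p0 := ler_norm (phi 0); have p1 := ler_norm (- phi 0); rewrite normrN in p1.
have q0 : 0 <= `|phi 0| * dotp x x by rewrite mulr_ge0.
by apply/andP; split; lra.
Qed.

Lemma quadb_conj_value : quadb conj_value.
Proof.
have mS := measurable_gradient_inverse; have qS := quadb_gradient_inverse.
rewrite (_ : conj_value = fun y => dotp y (S y) + -1 * phi (S y)).
  apply: quadbD; first exact: quadb_dotp.
  by apply: quadbZ; apply: quadb_comp => //; exact: quadb_potential.
by apply/funext => y; rewrite mulN1r.
Qed.

Lemma quadb_pot_src : quadb pot_src.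
Proof.
rewrite (_ : pot_src = fun x => enorm x ^+ 2 + -2 * phi x).
  by apply: quadbD => //; apply: quadbZ; exact: quadb_potential.
by apply/funext => y; rewrite mulNr.
Qed.

Lemma quadb_pot_dst : quadb pot_dst.
Proof.
rewrite (_ : pot_dst = fun x => enorm x ^+ 2 + -2 * conj_value x).
  by apply: quadbD => //; apply: quadbZ; exact: quadb_conj_value.
by apply/funext => y; rewrite mulNr.
Qed.

Lemma W2_sqr_ge (mu nu : probability E R) : P2 mu -> P2 nu ->
  ((\int[mu]_x pot_src x + \int[nu]_y pot_dst y)%:E <= W2 mu nu ^+ 2)%E.
Proof.
move=> mu2 nu2; rewrite W2_sqr; apply: le_ereal_inf_tmp => _ [p pc <-].
have [l1 l2] := coupling_law pc.
have i1 := quadb_integrable mu2 quadb_pot_src.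
have i2 := quadb_integrable nu2 quadb_pot_dst.
have id := integrable_sqdist mu2 nu2 l1 l2.
have j1 := law_integrable l1 i1; have j2 := law_integrable l2 i2.
rewrite integral_EFinE// lee_fin -(law_Rintegral l1 i1) -(law_Rintegral l2 i2).
rewrite -RintegralD//; apply: le_Rintegral => //; first exact: integrableT_D.
move=> z _; apply: le_trans (sqdist_ge_potentials z.1 z.2).
by rewrite lerDl mulr_ge0 ?sqr_ge0// ltW.
Qed.

Section optimality.
Variables (mub pi : probability E R).
Hypotheses (mub2 : P2 mub) (lT : has_law mub T pi).

Lemma pushforward_P2 : P2 pi.
Proof. exact: quadb_law_P2 mub2 lT qT. Qed.

Lemma transport_cost_potentials : \int[mub]_x (enorm (x - T x) ^+ 2) =
  \int[mub]_x pot_src x + \int[pi]_y pot_dst y.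
Proof.
have i1 := quadb_integrable mub2 quadb_pot_src.
have i2 := quadb_integrable pushforward_P2 quadb_pot_dst.
rewrite -(law_Rintegral lT i2) -RintegralD//; last exact: (law_integrable lT i2).
by apply: eq_Rintegral => x _; exact: sqdist_eq_potentials.
Qed.

Lemma has_law_id : has_law mub id mub.
Proof. by split=> //. Qed.

Lemma integrable_transport_cost :
  mub.-integrable [set: E] (EFin \o (fun x => enorm (x - T x) ^+ 2)).
Proof. exact: integrable_sqdist mub2 pushforward_P2 has_law_id lT. Qed.

Lemma W2_sqr_optimal : (W2 mub pi ^+ 2 = (\int[mub]_x (enorm (x - T x) ^+ 2))%:E)%E.
Proof.
apply/eqP; rewrite eq_le; apply/andP; split.
  rewrite -integral_EFinE; first exact: W2_sqr_le has_law_id lT.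
  exact: integrable_transport_cost.
by rewrite transport_cost_potentials W2_sqr_ge//; exact: pushforward_P2.
Qed.

(* The gap in [sqdist_ge_potentials] makes [|x - S y|] small in mean square under
   a nearly optimal coupling, so [mu] is arbitrarily close to the law [mub] of [S y]. *)
Lemma optimal_source_unique (mu : probability E R) : P2 mu ->
  (W2 mu pi ^+ 2 <= (\int[mu]_x pot_src x + \int[pi]_y pot_dst y)%:E)%E ->
  forall A, measurable A -> mu A = mub A.
Proof.
move=> mu2 Wle.
have pi2 := pushforward_P2.
have mS := measurable_gradient_inverse.
have SE A : measurable A -> pi (S @^-1` A) = mub A.
  move=> mA; have [_ <-] := lT; last by rewrite -[_ @^-1` _]setTI; exact: mS.
  by congr (mub _); apply/seteqP; split=> x /=; rewrite gradient_inverseK.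
have i1 := quadb_integrable mu2 quadb_pot_src.
have i2 := quadb_integrable pi2 quadb_pot_dst.
have near (e : R) : 0 < e -> exists p : probability (E * E)%type R,
    [/\ has_law p fst mu, has_law p (S \o snd) mub &
      (\int[p]_t (enorm (t.1 - S t.2) ^+ 2)%:E <= e%:E)%E].
  move=> e0; have ce0 : 0 < c * e by rewrite mulr_gt0.
  set A := (_ + _)%R in Wle.
  have [_ [p pc <-] plt] : exists2 y,
      [set \int[p]_z (enorm (z.1 - z.2) ^+ 2)%:E | p in coupling mu pi]%E y &
      (y < (A + c * e)%:E)%E.
    apply: ereal_inf_lt; rewrite -W2_sqr (le_lt_trans Wle)//.
    by rewrite lte_fin ltrDl.
  have [l1 l2] := coupling_law pc.
  have l3 : has_law p (S \o snd) mub.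
    split; first by apply: measurableT_comp mS _; case: l2.
    move=> B mB; rewrite comp_preimage; have [_ ->] := l2; first exact: SE.
    by rewrite -[_ @^-1` _]setTI; exact: mS.
  exists p; split=> //.
  have j1 := law_integrable l1 i1; have j2 := law_integrable l2 i2.
  have id1 := integrable_sqdist mu2 pi2 l1 l2.
  have id2 := integrable_sqdist mu2 mub2 l1 l3.
  rewrite integral_EFinE// lte_fin in plt.
  rewrite integral_EFinE// lee_fin -(ler_pM2l c0) -RintegralZl//.
  suff : A + \int[p]_z (c * enorm (z.1 - S z.2) ^+ 2) <=
      \int[p]_z (enorm (z.1 - z.2) ^+ 2) by move=> /le_lt_trans/(_ plt)/ltW; rewrite lerD2l.
  rewrite /A -(law_Rintegral l1 i1) -(law_Rintegral l2 i2) -RintegralD//.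
  rewrite -RintegralD//; [|exact: integrableT_D|exact: integrableT_Z].
  apply: le_Rintegral => //.
    by apply: integrableT_D; [exact: integrableT_D|exact: integrableT_Z].
  by move=> z _; exact: sqdist_ge_potentials.
apply: eq_probability_closed => F cF; apply/eqP; rewrite eq_le; apply/andP; split.
  apply: closed_le_of_near_laws => // e /near[p [h1 h2 h3]].
  by exists p, fst, (S \o snd).
apply: closed_le_of_near_laws => // e /near[p [h1 h2 h3]].
exists p, (S \o snd), fst; split=> //.
by under eq_integral do rewrite enorm_distC.
Qed.

End optimality.
End brenier_maps.

Lemma enorm_sqr_young (R : realType) (d : nat) (u v : 'rV[R]_d) (t : R) : 0 < t ->
  enorm (u + v) ^+ 2 <= (1 + t) * enorm u ^+ 2 + (1 + t^-1) * enorm v ^+ 2.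
Proof.
move=> t0; have := dotp_young u v t0.
rewrite !enorm_sqr dotpDl !dotpDr (dotpC v u); lra.
Qed.

(** * Truncation *)

Section truncation.
Context {R : realType} {d : nat}.
Local Notation E := 'rV[R]_d.
Variables (pi : probability E R) (Y : set E).
Hypotheses (mY : measurable Y) (piY : 0 < fine (pi Y)).
Let p0 := fine (pi Y).
Let nu := truncate pi Y.

(** The function h_k of the statement. It dominates the distance to 1 of the density of the
    truncated law with respect to [pi]: that distance is 1 / pi(Y) - 1 on [Y] and 1 outside. *)
Definition trunc_weight (x : E) : R := (1 - fine (pi Y)) / fine (pi Y) + \1_(~` Y) x.

Lemma truncate_mass A : measurable A -> (nu A = pi (A `&` Y) * (p0^-1)%:E)%E.
Proof.
move=> mA; rewrite /nu truncateE//.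
by apply: contraTneq piY => ->; rewrite ltxx.
Qed.

Lemma fine_prob_le1 : p0 <= 1.
Proof.
rewrite -lee_fin fineK; first exact: probability_le1.
exact: fin_num_measure.
Qed.

Lemma trunc_weight_ge0 x : 0 <= trunc_weight x.
Proof.
by rewrite addr_ge0// divr_ge0 ?(ltW piY)// subr_ge0 fine_prob_le1.
Qed.

Let dens x : R := \1_Y x / p0.

Let dens_ge0 x : 0 <= dens x.
Proof. by rewrite divr_ge0// ltW. Qed.

Let mdens : measurable_fun [set: E] dens.
Proof. by apply: measurable_funM => //; exact: measurable_indic. Qed.

Lemma truncate_integral (g : E -> \bar R) : measurable_fun [set: E] g ->
  (forall x, 0 <= g x)%E ->
  (\int[nu]_x g x = \int[pi]_x (g x * (\1_Y x / p0)%:E))%E.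
Proof.
move=> mg g0; apply: (ge0_integral_density mdens dens_ge0) => // A mA.
apply: (etrans (truncate_mass mA)); rewrite /dens.
under eq_integral do rewrite EFinM.
rewrite ge0_integralZr//.
- by rewrite integral_indic// setIC.
- apply/measurable_EFinP; apply: measurable_funTS; exact: measurable_indic.
- by rewrite lee_fin invr_ge0 ltW.
Qed.

Lemma quadb_indicM (A : set E) (g : E -> R) : measurable A -> quadb g ->
  quadb (fun x => g x * \1_A x).
Proof.
move=> mA [mg [C HC]]; split.
  by apply: measurable_funM => //; exact: measurable_indic.
exists C => x; rewrite normrM (le_trans _ (HC x))// ler_piMr//.
by rewrite indicE ger0_norm// lern1 leq_b1.
Qed.

Lemma quadb_dens (g : E -> R) : quadb g -> quadb (fun x => g x * (\1_Y x / p0)).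
Proof.
move=> qg; rewrite (_ : (fun x => _) = fun x => p0^-1 * (g x * \1_Y x)).
  by apply: quadbZ; exact: quadb_indicM.
by apply/funext => x; rewrite mulrA mulrC.
Qed.

Lemma quadb_trunc_weight (g : E -> R) : quadb g -> quadb (fun x => g x * trunc_weight x).
Proof.
move=> qg; rewrite (_ : (fun x => _) = fun x => (1 - p0) / p0 * g x + g x * \1_(~` Y) x).
  by apply: quadbD; [exact: quadbZ|apply: quadb_indicM => //; exact: measurableC].
by apply/funext => x; rewrite /trunc_weight mulrDr [g x * (_ / _)]mulrC.
Qed.

Lemma quadb_norm (g : E -> R) : quadb g -> quadb (fun x => `|g x|).
Proof.
move=> [mg [C HC]]; split; first exact: measurableT_comp.
by exists C => x; rewrite normr_id.
Qed.

Hypothesis pi2 : P2 pi.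

Lemma truncate_P2 : P2 nu.
Proof.
rewrite /P2 truncate_integral; last 2 first.
- by apply/measurable_EFinP; case: (@quadb_enorm2 R d).
- by move=> x; rewrite lee_fin sqr_ge0.
under eq_integral do rewrite -EFinM.
rewrite integral_EFinE ?ltry//; apply: quadb_integrable => //.
by apply: quadb_dens; exact: quadb_enorm2.
Qed.

Lemma truncate_Rintegral (g : E -> R) : quadb g ->
  \int[nu]_x g x = \int[pi]_x (g x * (\1_Y x / p0)).
Proof.
have ge0 h : quadb h -> (forall x, 0 <= h x) ->
    \int[nu]_x h x = \int[pi]_x (h x * (\1_Y x / p0)).
  move=> qh h0; congr fine; rewrite truncate_integral//.
  - by apply/measurable_EFinP; case: qh.
move=> qg; have [mg [C HC]] := qg.
(* Adding [k] makes the integrand nonnegative, which reduces the claim to the case already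
   settled. *)
pose k (x : E) : R := `|C| * (1 + enorm x ^+ 2).
have qk : quadb k by apply: quadbZ; apply: quadbD; [exact: quadb_cst|exact: quadb_enorm2].
have k0 x : 0 <= k x by rewrite mulr_ge0// addr_ge0// sqr_ge0.
have qgk : quadb (fun x => g x + k x) by exact: quadbD.
have gk0 x : 0 <= g x + k x.
  have := HC x; rewrite ler_norml -enorm_sqr => /andP[h _].
  have : C * (1 + enorm x ^+ 2) <= k x.
    by rewrite ler_wpM2r ?ler_norm// addr_ge0// sqr_ge0.
  lra.
have -> : \int[nu]_x g x = \int[nu]_x (g x + k x) - \int[nu]_x k x.
  rewrite RintegralD//; [|exact: quadb_integrable truncate_P2 _..].
  by rewrite addrK.
rewrite !ge0// -RintegralB//; [|exact: quadb_integrable pi2 (quadb_dens _)..].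
by apply: eq_Rintegral => x _; rewrite mulrDl addrK.
Qed.

Lemma truncate_Rintegral_dist (g : E -> R) : quadb g ->
  `|\int[nu]_x g x - \int[pi]_x g x| <= \int[pi]_x (`|g x| * trunc_weight x).
Proof.
move=> qg; have qd := quadb_dens qg.
rewrite truncate_Rintegral// -RintegralB//; [|exact: quadb_integrable..].
have qb : quadb (fun x => g x * (\1_Y x / p0) - g x).
  rewrite (_ : (fun x => _) = fun x => g x * (\1_Y x / p0) + -1 * g x).
    by apply: quadbD => //; exact: quadbZ.
  by apply/funext => x; rewrite mulN1r.
rewrite (le_trans (le_normr_Rintegral _ _))//; first exact: quadb_integrable.
apply: le_Rintegral => //.
- by apply: quadb_integrable => //; exact: quadb_norm.
- by apply: quadb_integrable => //; apply: quadb_trunc_weight; exact: quadb_norm.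
move=> x _; rewrite -[X in _ - X]mulr1 -mulrBr normrM ler_wpM2l//.
rewrite /trunc_weight !indicE in_setC; case: (x \in Y) => /=.
  rewrite addr0 -[X in _ / _ - X](@divff _ p0) ?gt_eqF// -mulrBl.
  by rewrite ger0_norm// divr_ge0 ?(ltW piY)// subr_ge0 fine_prob_le1.
rewrite mul0r sub0r normrN normr1 lerDr divr_ge0 ?(ltW piY)// subr_ge0.
exact: fine_prob_le1.
Qed.

Section truncation_coupling.
Variables (mub : probability E R) (T : E -> E).
Hypotheses (mub2 : P2 mub) (lT : has_law mub T pi).
Local Notation P := (mub \x nu)%E.

Let switch (z : E * E) : E := if T z.1 \in Y then T z.1 else z.2.

Let mT : measurable_fun [set: E] T. Proof. by case: lT. Qed.

Let mTY : measurable (T @^-1` Y).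
Proof. by rewrite -[_ @^-1` _]setTI; exact: mT. Qed.

Let mswitch : measurable_fun [set: E * E] switch.
Proof.
apply: measurable_fun_ifT => //.
- apply: (measurable_fun_bool true).
  rewrite setTI [X in measurable X](_ : _ = (T \o fst) @^-1` Y); last first.
    by apply/seteqP; split=> z /= h; [exact: set_mem h|exact: mem_set].
  by rewrite comp_preimage -[_ @^-1` _]setTI; exact: measurable_fst.
- exact: measurableT_comp.
Qed.

Let prodE (A B : set E) : measurable A -> measurable B ->
  (P (A `*` B) = mub A * nu B)%E.
Proof. by move=> mA mB; exact: (@product_measure1E _ _ _ _ _ mub nu). Qed.

Let lfst : has_law P fst mub.
Proof.
split=> // A mA; rewrite (_ : _ @^-1` _ = A `*` [set: E]); last first.
  by apply/seteqP; split=> -[x y] //= [].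
by apply: (etrans (prodE mA measurableT)); rewrite probability_setT mule1.
Qed.

(** The kept part contributes pi(B and Y), and the redraw, of probability 1 - p0, contributes (1 -
    p0) pi(B and Y) / p0; together they make pi(B and Y) / p0. *)
Let lswitch : has_law P switch nu.
Proof.
split=> // B mB.
have mTYB : measurable (T @^-1` (Y `&` B)).
  by rewrite -[_ @^-1` _]setTI; apply: mT => //; exact: measurableI.
have -> : switch @^-1` B =
    (T @^-1` (Y `&` B)) `*` [set: E] `|` (T @^-1` (~` Y)) `*` B.
  apply/seteqP; split=> -[x y] /=; rewrite /switch/=.
    by case: ifPn => [/[!inE] h Bh|/negP h Bh]; [left|right]; split=> //; rewrite inE in h.
  by case=> [[[h Bh] _]|[h Bh]]; [rewrite mem_set|rewrite memNset].
have mTC : measurable (T @^-1` (~` Y)).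
  by rewrite preimage_setC; exact: measurableC.
rewrite measureU; last 3 first.
- exact: measurableX.
- exact: measurableX.
- by apply/seteqP; split=> -[x y] //= [[[h _] _] [h' _]].
have [_ TE] := lT.
rewrite [X in (X + _)%E](prodE mTYB measurableT) [X in (_ + X)%E](prodE mTC mB).
rewrite [X in (_ * X + _)%E]probability_setT mule1 !TE//; last 2 first.
- exact: measurableC.
- exact: measurableI.
rewrite truncate_mass// probability_setC// (setIC Y).
have -> : pi Y = p0%:E by rewrite fineK// fin_num_measure.
have [r ->] : exists r, pi (B `&` Y) = r%:E.
  by exists (fine (pi (B `&` Y))); rewrite fineK// fin_num_measure//; exact: measurableI.
by rewrite -EFinB -!EFinM -EFinD; congr EFin; field; rewrite gt_eqF.
Qed.

Let prod_Rintegral (f g : E -> R) : quadb f -> quadb g ->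
  (forall x, 0 <= f x) -> (forall x, 0 <= g x) ->
  P.-integrable setT (EFin \o (fun z => f z.1 * g z.2)) /\
  \int[P]_z (f z.1 * g z.2) = (\int[mub]_x f x) * (\int[nu]_x g x).
Proof.
move=> qf qg f0 g0; have [mf _] := qf; have [mg _] := qg.
have if_ := quadb_integrable mub2 qf; have ig := quadb_integrable truncate_P2 qg.
have m1 : measurable_fun setT (fun z : E * E => f z.1 * g z.2).
  by apply: measurable_funM; [exact: measurableT_comp mf _|exact: measurableT_comp mg _].
have fg0 z : 0 <= f z.1 * g z.2 by exact: mulr_ge0.
have IE : (\int[P]_z (f z.1 * g z.2)%:E =
    ((\int[mub]_x f x) * (\int[nu]_x g x))%:E)%E.
  rewrite fubini_tonelli1//=; last exact/measurable_EFinP.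
  rewrite /fubini_F/=.
  transitivity (\int[mub]_x ((f x)%:E * (\int[nu]_y g y)%:E))%E.
    apply: eq_integral => x _; under eq_integral do rewrite EFinM.
    rewrite ge0_integralZl//; first by rewrite integral_EFinE.
    - exact/measurable_EFinP.
    - by move=> y _; rewrite lee_fin.
    - by rewrite lee_fin.
  rewrite ge0_integralZr//; first by rewrite integral_EFinE// EFinM.
  - exact/measurable_EFinP.
  - by move=> x _; rewrite lee_fin.
  - by rewrite lee_fin; apply: Rintegral_ge0 => y _.
split; last by rewrite /Rintegral IE.
by apply: integrableT_lty => //; rewrite IE ltry.
Qed.

Let e1 := \int[pi]_x (2 * enorm x ^+ 2 * trunc_weight x).

(* The coupling keeps [T x] when it falls in [Y] and otherwise redraws the
   target independently from the truncated law; [t] is the parameter of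
   Young's inequality for [(x - T x) + (T x - y)]. *)
Lemma W2_sqr_truncate_young (t : R) : 0 < t ->
  (W2 mub nu ^+ 2 <= ((1 + t) * \int[mub]_x (enorm (x - T x) ^+ 2) +
    (1 + t^-1) * e1)%:E)%E.
Proof.
move=> t0; have tV0 : 0 < t^-1 by rewrite invr_gt0.
have nu2 := truncate_P2.
apply: (le_trans (W2_sqr_le lfst lswitch)).
have lid : has_law mub id mub by split.
have i0 := integrable_sqdist mub2 nu2 lfst lswitch.
rewrite integral_EFinE// lee_fin.
pose f1 (x : E) : R := enorm (x - T x) ^+ 2.
have q2 := @quadb_enorm2 R d.
have mYC : measurable (~` Y) by exact: measurableC.
pose f2 (x : E) : R := 2 * (enorm (T x) ^+ 2 * \1_(~` Y) (T x)).
pose f3 (x : E) : R := \1_(~` Y) (T x).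
pose f4 (x : E) : R := 2 * enorm x ^+ 2.
have i1 := integrable_sqdist mub2 pi2 lid lT.
have i2pi : pi.-integrable setT (EFin \o (fun x => 2 * (enorm x ^+ 2 * \1_(~` Y) x))).
  by apply: quadb_integrable => //; apply: quadbZ; exact: quadb_indicM.
have i2 := law_integrable lT i2pi.
have q3 : quadb f3.
  split; first exact: measurableT_comp (measurable_indic _) mT.
  exists 1 => x; rewrite /f3 indicE ger0_norm// mul1r.
  by rewrite (@le_trans _ _ 1) ?lern1 ?leq_b1// lerDl dotp_sqr_ge0.
have q4 : quadb f4 by exact: quadbZ.
have f30 x : 0 <= f3 x by rewrite /f3 indicE.
have f40 x : 0 <= f4 x by rewrite mulr_ge0// sqr_ge0.
have [i34 E34] := prod_Rintegral q3 q4 f30 f40.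
have j1 := law_integrable lfst i1; have j2 := law_integrable lfst i2.
have k1 := integrableT_Z (1 + t) j1.
have k2 := integrableT_Z (1 + t^-1) (integrableT_D j2 i34).
apply: (@le_trans _ _ (\int[P]_z ((1 + t) * f1 z.1 +
    (1 + t^-1) * (f2 z.1 + f3 z.1 * f4 z.2)))).
  apply: le_Rintegral => //; first exact: integrableT_D.
  move=> z _ /=; set u := z.1 - T z.1; set v := T z.1 - switch z.
  have -> : z.1 - switch z = u + v by rewrite /u /v addrA subrK.
  apply: (le_trans (enorm_sqr_young u v t0)); rewrite lerD2l ler_wpM2l//.
    by rewrite addr_ge0// ltW.
  rewrite /v /switch /f2 /f3 /f4 !indicE in_setC.
  case: (T z.1 \in Y) => /=.
    by rewrite subrr /enorm dotp0l sqrtr0 expr0n/= mulr0 mulr0 mul0r addr0.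
  by rewrite mulr1 mul1r enorm_sqr_leD.
rewrite RintegralD// !RintegralZl//; last exact: integrableT_D.
rewrite (law_Rintegral lfst i1) lerD2l ler_wpM2l//; first by rewrite addr_ge0// ltW.
rewrite RintegralD// E34 (law_Rintegral lfst i2) (law_Rintegral lT i2pi).
have -> : \int[mub]_x f3 x = 1 - p0.
  have i3 : pi.-integrable setT (EFin \o (\1_(~` Y) : E -> R)).
    apply: quadb_integrable => //.
    rewrite (_ : \1_(~` Y) = fun x => 1 * \1_(~` Y) x).
      by apply: quadb_indicM => //; exact: quadb_cst.
    by apply/funext => x; rewrite mul1r.
  have piC : (pi (~` Y) = (1 - p0)%:E)%E.
    by rewrite probability_setC// EFinB fineK// fin_num_measure.
  rewrite (law_Rintegral lT i3) /Rintegral integral_indic// setIT.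
  exact: (congr1 fine piC).
(* Origin of the constant term of [trunc_weight]: a redraw has probability 1 - p0, and truncation
   multiplies second moments by at most 1 / p0. *)
have M1 : \int[nu]_x f4 x <= p0^-1 * \int[pi]_x f4 x.
  have pV0 : 0 <= p0^-1 by rewrite invr_ge0 ltW.
  rewrite truncate_Rintegral// -RintegralZl//; last exact: quadb_integrable.
  apply: le_Rintegral => //.
  - by apply: quadb_integrable => //; exact: quadb_dens.
  - by apply: quadb_integrable => //; exact: quadbZ.
  move=> x _; rewrite mulrA mulrC ler_wpM2l// ler_piMr ?f40//.
have -> : e1 = \int[pi]_x (2 * (enorm x ^+ 2 * \1_(~` Y) x)) +
    (1 - p0) / p0 * \int[pi]_x f4 x.
  rewrite -RintegralZl//; last exact: quadb_integrable.
  rewrite -RintegralD//; last by apply: quadb_integrable => //; exact: quadbZ.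
  apply: eq_Rintegral => x _; rewrite /trunc_weight /f4 -/p0.
  by rewrite mulrDr addrC mulrA [X in _ + X]mulrC.
rewrite lerD2l -mulrA ler_wpM2l// subr_ge0; exact: fine_prob_le1.
Qed.

Lemma W2_sqr_truncate :
  (W2 mub nu ^+ 2 <= (\int[mub]_x (enorm (x - T x) ^+ 2) +
    2 * Num.sqrt (\int[mub]_x (enorm (x - T x) ^+ 2)) * Num.sqrt e1 + e1)%:E)%E.
Proof.
set A := \int[mub]_x _.
have A0 : 0 <= A by apply: Rintegral_ge0 => x _; exact: sqr_ge0.
have e10 : 0 <= e1.
  apply: Rintegral_ge0 => x _; rewrite mulr_ge0 ?trunc_weight_ge0//.
  by rewrite mulr_ge0// sqr_ge0.
set a := Num.sqrt A; set b := Num.sqrt e1.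
have a0 : 0 <= a by exact: sqrtr_ge0.
have b0 : 0 <= b by exact: sqrtr_ge0.
have AE : A = a ^+ 2 by rewrite sqr_sqrtr.
have BE : e1 = b ^+ 2 by rewrite sqr_sqrtr.
apply/lee_addgt0Pr => e e0.
(* The best parameter in Young's inequality is b / a. Adding [s] to both keeps it defined and
   positive when [a] or [b] vanishes, at the cost s (a + b) <= e. *)
pose s := e / (a + b + 1).
have ab0 : 0 < a + b + 1 by rewrite ltr_pwDr// addr_ge0.
have s0 : 0 < s by rewrite divr_gt0.
have as0 : 0 < a + s by rewrite ltr_pwDr.
have bs0 : 0 < b + s by rewrite ltr_pwDr.
have := W2_sqr_truncate_young (divr_gt0 bs0 as0).
move=> /le_trans; apply; rewrite -EFinD lee_fin -/A invf_div AE BE.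
have h1 : (b + s) / (a + s) * a ^+ 2 <= (b + s) * a.
  rewrite -mulrA ler_pM2l// mulrC ler_pdivrMr// expr2 ler_wpM2l// lerDl ltW//.
have h2 : (a + s) / (b + s) * b ^+ 2 <= (a + s) * b.
  rewrite -mulrA ler_pM2l// mulrC ler_pdivrMr// expr2 ler_wpM2l// lerDl ltW//.
have h3 : s * (a + b) <= e.
  rewrite /s mulrAC ler_pdivrMr// ler_pM2l// lerDl ler01//.
nra.
Qed.

End truncation_coupling.
End truncation.

(** * The generation procedure *)

Section largest_eigenvalue.
Context {R : realType} {d : nat}.
Implicit Types (M : 'M[R]_d) (v u : 'rV[R]_d).

Lemma dotp_mulmx m n (v : 'rV[R]_n) (w : 'rV[R]_m) (B : 'M[R]_(n, m)) :
  dotp v (w *m B^T) = dotp (v *m B) w.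
Proof.
have E k (x y : 'rV[R]_k) : dotp x y = (x *m y^T) 0 0.
  by rewrite mxE; apply: eq_bigr => i _; rewrite mxE.
by rewrite !E trmx_mul trmxK mulmxA.
Qed.

Lemma continuous_quadratic_form M : continuous (fun v => dotp v (v *m M)).
Proof.
have cM i : continuous (fun v : 'rV[R]_d => (v *m M) 0 i).
  rewrite (_ : (fun v => _) = fun v : 'rV[R]_d => \sum_j v 0 j * M j i); last first.
    by apply/funext => v; rewrite mxE.
  apply: (@sum_continuous R 'rV[R]_d _ _ xpredT (fun j v => v 0 j * M j i)) => j _ w.
  apply: (@continuousM R _ (fun v : 'rV[R]_d => v 0 j) (fun=> M j i)).
    exact: coord_continuous.
  exact: cst_continuous.
apply: (@sum_continuous R 'rV[R]_d _ _ xpredT (fun i v => v 0 i * (v *m M) 0 i)).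
move=> i _ v.
apply: (@continuousM R _ (fun v : 'rV[R]_d => v 0 i) (fun v => (v *m M) 0 i)).
  exact: coord_continuous.
exact: cM.
Qed.

Lemma compact_enorm_sphere : compact [set v : 'rV[R]_d | dotp v v = 1].
Proof.
apply: bounded_closed_compact.
  exists 1; split=> // M M1 v /= v1.
  by rewrite (le_trans (norm_le_enorm v))// /enorm v1 sqrtr1 ltW.
rewrite (_ : [set v | _] = (fun v => dotp v (v *m 1%:M)) @^-1` [set 1]).
  apply: closed_comp => [v _|]; first exact: continuous_quadratic_form.
  exact: closed_eq.
by apply/seteqP; split=> v /=; rewrite mulmx1.
Qed.

(* The quadratic form of [M] is maximal on the unit sphere at an eigenvector. *)
Lemma emax_quadratic_form M : (0 < d)%N -> M^T = M ->
  (forall v, dotp v (v *m M) <= emax M * dotp v v) /\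
  exists2 v, dotp v v = 1 & dotp v (v *m M) = emax M.
Proof.
move=> d0 Msym; pose f v := dotp v (v *m M).
pose A := [set v : 'rV[R]_d | dotp v v = 1].
have A0 : A !=set0.
  exists (delta_mx 0 (Ordinal d0)); rewrite /A/= /dotp (bigD1 (Ordinal d0))//=.
  rewrite big1 => [|i i0]; first by rewrite !mxE !eqxx mulr1 addr0.
  by rewrite !mxE (negbTE i0) mul0r.
have [v0 /[!inE] v01 v0max] := EVT_max_rV A0 compact_enorm_sphere
  (continuous_subspaceT (@continuous_quadratic_form M)).
set l := dotp v0 (v0 *m M) in v0max.
have fl v : f v <= l * dotp v v.
  have [->|v_neq0] := eqVneq v 0; first by rewrite /f !dotp0l mulr0.
  have vv0 : 0 < dotp v v by rewrite lt_neqAle eq_sym dotp_sqr_eq0 v_neq0 dotp_sqr_ge0.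
  have n0 : 0 < enorm v by rewrite sqrtr_gt0.
  have Av : A ((enorm v)^-1 *: v).
    by rewrite /A/= dotpZl dotpZr -enorm_sqr expr2 mulKf ?mulVf// gt_eqF.
  have h := v0max _ (mem_set Av).
  move: h; rewrite -scalemxAl dotpZl dotpZr mulrA -invfM -expr2 enorm_sqr.
  by rewrite mulrC ler_pdivrMr.
(* [u] is half the gradient at [v0] of l |v|^2 - f v, a nonnegative form vanishing at [v0]. Along v0
   + t u it is the polynomial in [quad]; at t = - |u|^2 / (a + 1) it is negative unless u = 0, the 1
   keeping the denominator positive. *)
have eig : v0 *m M = l *: v0.
  have [u uD] : exists u, u = l *: v0 - v0 *m M by eexists.
  have cross : dotp u (v0 *m M) = dotp v0 (u *m M).
    by rewrite -{2}Msym dotp_mulmx dotpC.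
  have uE : dotp u u = l * dotp v0 u - dotp u (v0 *m M).
    by rewrite {2}uD dotpBr dotpZr (dotpC u v0).
  pose a := l * dotp u u - f u.
  have a0 : 0 <= a by rewrite subr_ge0 fl.
  have quad t : 0 <= 2 * t * dotp u u + t ^+ 2 * a.
    have := fl (v0 + t *: u); rewrite /f mulmxDl -scalemxAl.
    rewrite !dotpDl !dotpDr !dotpZl !dotpZr -cross (dotpC u v0) v01 -/l -/(f u).
    move=> h; rewrite {1}uE /a.
    by move: (f u) (dotp u u) (dotp v0 u) (dotp u _) h => *; lra.
  have u0 : dotp u u = 0.
    apply/eqP; rewrite eq_le dotp_sqr_ge0 andbT.
    have a10 : 0 < a + 1 by rewrite ltr_pwDr.
    have := quad (- (dotp u u / (a + 1))).
    have -> : 2 * - (dotp u u / (a + 1)) * dotp u u + (- (dotp u u / (a + 1))) ^+ 2 * a =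
        - (dotp u u ^+ 2 * ((a + 2) / (a + 1) ^+ 2)).
      by field; rewrite gt_eqF.
    have a20 : 0 < (a + 2) / (a + 1) ^+ 2 by rewrite divr_gt0 ?exprn_gt0// ltr_pwDr.
    rewrite oppr_ge0 pmulr_lle0//.
    by rewrite expr2 => h; rewrite leNgt; apply/negP => p; have := mulr_gt0 p p; rewrite ltNge h.
  by apply/esym/eqP; rewrite -subr_eq0 -dotp_sqr_eq0 -uD u0.
have lub : ubound [set a | eigenvalue M a] l.
  move=> a /eigenvalueP[v va v_neq0]; have := fl v; rewrite /f va dotpZr.
  by rewrite ler_pM2r// lt_neqAle eq_sym dotp_sqr_eq0 v_neq0 dotp_sqr_ge0.
have leig : eigenvalue M l.
  apply/eigenvalueP; exists v0 => //.
  by rewrite -dotp_sqr_eq0 v01 oner_neq0.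
have emaxE : emax M = l.
  apply/eqP; rewrite eq_le; apply/andP; split.
    by apply: ge_sup => //; exists l.
  by apply: ub_le_sup => //; exists l.
by rewrite emaxE; split=> //; exists v0.
Qed.

End largest_eigenvalue.

Lemma taylor2_le (R : realType) (F F1 F2 : R -> R) (M : R) :
  (forall t : R, is_derive t (1 : R) F (F1 t)) ->
  (forall t : R, is_derive t (1 : R) F1 (F2 t)) ->
  (forall t, F2 t <= M) -> F 1 <= F 0 + F1 0 + M / 2.
Proof.
move=> dF dF1 F2M.
have cdiff (f df : R -> R) : (forall t : R, is_derive t (1 : R) f (df t)) -> continuous f.
  move=> h x; apply: differentiable_continuous; apply/derivable1_diffP.
  by have [] := h x.
have F1M t : 0 <= t -> F1 t <= F1 0 + M * t.
  move=> t0; have [s _ sE] := MVT_segment t0 (fun x _ => dF1 x)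
    (continuous_subspaceT (cdiff _ _ dF1)).
  by rewrite -lerBlDl sE subr0 ler_wpM2r.
(* By [F1M] the derivative of [G] is nonpositive for t >= 0, and G 1 <= G 0 is the claim. *)
pose G t := F t - F1 0 * t - M / 2 * t ^+ 2.
have dG t : is_derive t (1 : R) G (F1 t - F1 0 - M * t).
  apply: is_derive_eq; rewrite /GRing.scale/=.
  by rewrite !mulr1; lra.
have [s /[!in_itv]/= /andP[s0 _] sE] := MVT_segment ler01 (fun x _ => dG x)
  (continuous_subspaceT (cdiff _ _ dG)).
have : G 1 - G 0 <= 0.
  by rewrite sE subr0 mulr1; have := F1M s s0; lra.
rewrite /G; lra.
Qed.

(** * Log-sum-exp and softmax along a line *)

Section softmax_line.
Context {R : realType} {n : nat}.
Variables (b a : 'I_n -> R) (n0 : (0 < n)%N).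

Let s j (t : R) : R := expR (b j + t * a j).
(** Unnormalized moments of the slopes under the softmax weights. Differentiation raises the order
    by one, so mean and variance come out of the quotient rule. *)
Let Z k (t : R) : R := \sum_j a j ^+ k * s j t.

Let Z_derive k (t : R) : is_derive t (1 : R) (Z k) (Z k.+1 t).
Proof.
have sE j : is_derive t (1 : R) (s j) (a j * s j t).
  rewrite mulrC; apply: is_derive1_comp.
  apply: is_derive_eq; rewrite /GRing.scale/=; lra.
rewrite (_ : Z k = \sum_j (fun t => a j ^+ k * s j t)); last first.
  by apply/funext => x; rewrite fct_sumE.
rewrite (_ : Z k.+1 t = \sum_j a j ^+ k * (a j * s j t)); last first.
  by apply: eq_bigr => j _; rewrite exprSr mulrA.
by apply: is_derive_sum => j; apply: is_deriveZ.
Qed.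

Lemma softmax_sum_gt0 (t : R) : 0 < \sum_j s j t.
Proof.
rewrite (bigD1 (Ordinal n0))//= ltr_pwDl ?expR_gt0//.
by apply: sumr_ge0 => j _; exact: expR_ge0.
Qed.

Let Z0E t : Z 0 t = \sum_j s j t.
Proof. by apply: eq_bigr => j _; rewrite expr0 mul1r. Qed.

Let Z0_gt0 t : 0 < Z 0 t. Proof. by rewrite Z0E softmax_sum_gt0. Qed.

Lemma lnsumexp_derive (t : R) :
  is_derive t (1 : R) (fun t => ln (\sum_j s j t))
    (\sum_j s j t / (\sum_l s l t) * a j).
Proof.
rewrite (_ : (fun t => _) = @ln R \o Z 0); last by apply/funext => x /=; rewrite Z0E.
rewrite (_ : \sum_j _ = (Z 0 t)^-1 * Z 1 t).
  by exact: (@is_derive1_comp R (@ln R) (Z 0) t _ _ (is_derive1_ln (Z0_gt0 t)) (Z_derive 0 t)).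
rewrite big_distrr/=; apply: eq_bigr => j _; rewrite Z0E expr1.
by ring.
Qed.

Lemma softmax_mean_derive (t : R) :
  is_derive t (1 : R) (fun t => \sum_j s j t / (\sum_l s l t) * a j)
    (\sum_j s j t / (\sum_l s l t) * a j ^+ 2 -
     (\sum_j s j t / (\sum_l s l t) * a j) ^+ 2).
Proof.
have E k x : \sum_j s j x / (\sum_l s l x) * a j ^+ k = Z k x * (Z 0 x)^-1.
  by rewrite big_distrl/= Z0E; apply: eq_bigr => j _; rewrite mulrAC [_ * s j x]mulrC.
have E1 x : \sum_j s j x / (\sum_l s l x) * a j = Z 1 x * (Z 0 x)^-1.
  by rewrite -E; apply: eq_bigr => j _; rewrite expr1.
rewrite (_ : (fun t => _) = Z 1 * (fun x => (Z 0 x)^-1)); last first.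
  by apply/funext => x; exact: E1.
rewrite E E1; apply: (is_derive_eq (is_deriveM (Z_derive 1 t)
  (is_deriveV (lt0r_neq0 (Z0_gt0 t)) (Z_derive 0 t)))).
by rewrite /GRing.scale/=; field; rewrite gt_eqF.
Qed.

Lemma softmax_derive j (t : R) :
  is_derive t (1 : R) (fun t => s j t / (\sum_l s l t))
    (s j t / (\sum_l s l t) * (a j - \sum_l s l t / (\sum_l s l t) * a l)).
Proof.
have E1 : \sum_l s l t / (\sum_l s l t) * a l = Z 1 t * (Z 0 t)^-1.
  by rewrite big_distrl/= Z0E; apply: eq_bigr => l _; rewrite expr1 mulrAC [_ * s l t]mulrC.
have sE : is_derive t (1 : R) (s j) (a j * s j t).
  rewrite mulrC; apply: is_derive1_comp.
  apply: is_derive_eq; rewrite /GRing.scale/=; lra.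
rewrite E1 (_ : (fun t => _) = s j * (fun x => (Z 0 x)^-1)); last first.
  by apply/funext => x; rewrite -Z0E.
rewrite -Z0E; apply: (is_derive_eq (is_deriveM sE
  (is_deriveV (lt0r_neq0 (Z0_gt0 t)) (Z_derive 0 t)))).
by rewrite /GRing.scale/=; field; rewrite gt_eqF.
Qed.

End softmax_line.

Section procedure_potentials.
Context {R : realType} {d : nat} (D : gen_input R d).
Hypotheses (d_gt0 : (0 < d)%N) (hD : gen_valid D).
Local Notation E := 'rV[R]_d.
Local Notation idx := ('I_(gKt D) + 'I_(gKt D))%type.
Implicit Types (x z v : E) (k : 'I_(gK D)) (i : 'I_(gKt D)).

Let gw_gt0 k : 0 < gw D k. Proof. by have [_ []] := hD. Qed.
Let glam_gt0 i : 0 < glam D i. Proof. by have [_ _ /(_ i)[]] := hD. Qed.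
Let ggam_gt0 i : 0 < ggam D i. Proof. by have [_ _ /(_ i)[]] := hD. Qed.
Let galp_gt0 i : 0 < galp D i. Proof. by have [_ _ /(_ i)[]] := hD. Qed.
Let gn_gt0 i : (0 < gn D i)%N. Proof. by have [_ _ /(_ i)[]] := hD. Qed.
Let gxi_ge0 : 0 <= gxi D. Proof. by have [_ _ _ _ [_ _ _ /andP[]]] := hD. Qed.
Let gxi_lt1 : gxi D < 1. Proof. by have [_ _ _ _ [_ _ _ /andP[]]] := hD. Qed.

Lemma score_sum_gt0 i x : 0 < \sum_(j < gn D i) score j x.
Proof.
rewrite (bigD1 (Ordinal (gn_gt0 i)))//= ltr_pwDl ?expR_gt0//.
by apply: sumr_ge0 => j _; exact: expR_ge0.
Qed.

Lemma eta_ge0 i x j : 0 <= eta i x 0 j.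
Proof. by rewrite mxE divr_ge0 ?expR_ge0// ltW// score_sum_gt0. Qed.

Lemma eta_sum i x : \sum_j eta i x 0 j = 1.
Proof.
under eq_bigr do rewrite mxE.
by rewrite -big_distrl/= divff// gt_eqF// score_sum_gt0.
Qed.

Lemma eta_le1 i x j : eta i x 0 j <= 1.
Proof.
rewrite -(eta_sum i x) (bigD1 j)//= lerDl.
by apply: sumr_ge0 => l _; exact: eta_ge0.
Qed.

Definition eta_mean i x : E := \sum_(j < gn D i) eta i x 0 j *: gy D i j.

Lemma dotp_eta_mean i x v :
  dotp (eta_mean i x) v = \sum_j eta i x 0 j * dotp (gy D i j) v.
Proof. by rewrite /eta_mean dotp_suml; apply: eq_bigr => j _; rewrite dotpZl. Qed.

(** [softcov] is the covariance matrix of the vectors y_(i,j) under the weights eta, so its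
    quadratic form is the variance of their component along [v]. *)
Lemma softcov_form i x v : dotp v (v *m softcov i x) =
  \sum_j eta i x 0 j * dotp (gy D i j) v ^+ 2 - dotp (eta_mean i x) v ^+ 2.
Proof.
have [a aD] : exists a, a = v *m Ymx i by eexists.
have aE j : a 0 j = dotp (gy D i j) v.
  by rewrite aD mxE; apply: eq_bigr => l _; rewrite mxE mulrC.
rewrite /softcov !mulmxA dotp_mulmx -aD mulmxBr dotpBr; congr (_ - _).
  apply: eq_bigr => j _; rewrite mul_mx_diag mxE aE; ring.
rewrite mulmxA.
have -> : a *m (eta i x)^T = (dotp (eta_mean i x) v)%:M.
  rewrite [LHS]mx11_scalar; congr _%:M; rewrite mxE dotp_eta_mean.
  by apply: eq_bigr => j _; rewrite aE mxE mulrC.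
rewrite mul_scalar_mx dotpZr expr2; congr (_ * _); rewrite dotp_eta_mean.
by apply: eq_bigr => j _; rewrite aE mulrC.
Qed.

Lemma softcov_sym i x : (softcov i x)^T = softcov i x.
Proof.
rewrite /softcov !trmx_mul trmxK mulmxA; congr (_ *m _ *m _).
by rewrite linearB/= tr_diag_mx trmx_mul trmxK.
Qed.

Lemma softcov_form_ge0 i x v : 0 <= dotp v (v *m softcov i x).
Proof.
rewrite softcov_form; set m := dotp _ _.
have -> : \sum_j eta i x 0 j * dotp (gy D i j) v ^+ 2 - m ^+ 2 =
    \sum_j eta i x 0 j * (dotp (gy D i j) v - m) ^+ 2.
  transitivity (\sum_j eta i x 0 j * dotp (gy D i j) v ^+ 2
      - 2 * m * (\sum_j eta i x 0 j * dotp (gy D i j) v)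
      + m ^+ 2 * \sum_j eta i x 0 j).
    rewrite -dotp_eta_mean -/m eta_sum. ring.
  rewrite (big_distrr (2 * m)) (big_distrr (m ^+ 2))/= -sumrB -big_split/=.
  by apply: eq_bigr => j _; ring.
by apply: sumr_ge0 => j _; rewrite mulr_ge0 ?eta_ge0 ?sqr_ge0.
Qed.

Lemma emax_softcov_ge0 i x : 0 <= emax (softcov i x).
Proof.
have [_ [v _ <-]] := emax_quadratic_form d_gt0 (softcov_sym i x).
exact: softcov_form_ge0.
Qed.

(** The [sup] of an unbounded set is a default value, so this bound is what gives content to the
    condition on [gLam]. A variance is at most the second moment, and each weight is at most 1. *)
Lemma emax_softcov_ub i : has_ubound (range (fun x => emax (softcov i x))).
Proof.
exists (\sum_j enorm (gy D i j) ^+ 2) => _ [x _ <-].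
have [_ [v v1 <-]] := emax_quadratic_form d_gt0 (softcov_sym i x).
rewrite softcov_form; apply: (@le_trans _ _ (\sum_j eta i x 0 j * dotp (gy D i j) v ^+ 2)).
  by rewrite lerBlDr lerDl sqr_ge0.
apply: ler_sum => j _; rewrite -[leRHS]mul1r.
apply: ler_pM; rewrite ?eta_ge0 ?sqr_ge0 ?eta_le1//.
have ev : enorm v = 1 by rewrite /enorm v1 sqrtr1.
rewrite -ler_sqrt ?exprn_gt0 ?sqr_ge0// ?sqrtr_sqr.
have h1 := dotp_le (gy D i j) v; have h2 := dotp_le (- gy D i j) v.
rewrite enormN dotpNl ev !mulr1 in h1 h2.
by rewrite (ger0_norm (enorm_ge0 _)) ler_norml h1 lerNl h2.
Qed.

Let Mi i := (ggam D i)^-1 * sup (range (fun x => emax (softcov i x))).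

Let softcov_form_le i x v : (ggam D i)^-1 * dotp v (v *m softcov i x) <= Mi i * dotp v v.
Proof.
rewrite /Mi -mulrA ler_pM2l ?invr_gt0//.
have [h _] := emax_quadratic_form d_gt0 (softcov_sym i x).
rewrite (le_trans (h v))// ler_wpM2r ?dotp_sqr_ge0//.
by apply: ub_le_sup; [exact: emax_softcov_ub|exists x].
Qed.

Lemma gLam_gt0 i : 0 < gLam D i.
Proof.
have [_ _ _ _ [_ _ _ _ /(_ i)]] := hD; apply: lt_le_trans.
rewrite ltr_pwDr ?mulr_gt0// mulr_ge0 ?invr_ge0 ?(ltW (ggam_gt0 i))//.
apply: le_trans (emax_softcov_ge0 i 0) _.
by apply: ub_le_sup; [exact: emax_softcov_ub|exists 0].
Qed.

Definition lse i x : R := ggam D i * ln (\sum_(j < gn D i) score j x).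

Let base i x (j : 'I_(gn D i)) := (gg D i j + dotp (gy D i j) x) / ggam D i.
Let slope i v (j : 'I_(gn D i)) := dotp (gy D i j) v / ggam D i.

Lemma score_line i (j : 'I_(gn D i)) x v (t : R) :
  score j (x + t *: v) = expR (base x j + t * slope v j).
Proof. by rewrite /score /base /slope dotpDr dotpZr; congr expR; ring. Qed.

Section along_line.
Variables (i : 'I_(gKt D)) (x v : E).

Let F t := lse i (x + t *: v).
Let F1 t := dotp (eta_mean i (x + t *: v)) v.
Let F2 t := (ggam D i)^-1 * dotp v (v *m softcov i (x + t *: v)).

Let sumE (t : R) : \sum_(j < gn D i) score j (x + t *: v) =
  \sum_(j < gn D i) expR (base x j + t * slope v j).
Proof. by apply: eq_bigr => j _; exact: score_line. Qed.

Let etaE (t : R) j : eta i (x + t *: v) 0 j =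
  expR (base x j + t * slope v j) / \sum_(l < gn D i) expR (base x l + t * slope v l).
Proof. by rewrite mxE score_line sumE. Qed.

Let slopeE (j : 'I_(gn D i)) : dotp (gy D i j) v = ggam D i * slope v j.
Proof. by rewrite /slope mulrC divfK// gt_eqF. Qed.

Let dF (t : R) : is_derive t (1 : R) F (F1 t).
Proof.
rewrite (_ : F = (fun t => ggam D i *: ln (\sum_(j < gn D i) expR (base x j + t * slope v j)))).
  rewrite (_ : F1 t = ggam D i *: \sum_(j < gn D i) expR (base x j + t * slope v j) /
      (\sum_(l < gn D i) expR (base x l + t * slope v l)) * slope v j).
    by apply: is_deriveZ; exact: lnsumexp_derive.
  rewrite /F1 dotp_eta_mean /GRing.scale/= big_distrr/=; apply: eq_bigr => j _.
  by rewrite etaE slopeE; ring.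
by apply/funext => s; rewrite /F /lse sumE.
Qed.

Let dF1 (t : R) : is_derive t (1 : R) F1 (F2 t).
Proof.
rewrite (_ : F1 = (fun t => ggam D i *: \sum_(j < gn D i) expR (base x j + t * slope v j) /
      (\sum_(l < gn D i) expR (base x l + t * slope v l)) * slope v j)).
  apply: (is_derive_eq (is_deriveZ _ (softmax_mean_derive _ _ (gn_gt0 i) t))).
  rewrite /F2 softcov_form dotp_eta_mean /GRing.scale/=.
  have g0 : ggam D i != 0 by rewrite gt_eqF.
  under [in RHS]eq_bigr do rewrite etaE slopeE exprMn mulrCA.
  under [X in _ = _ * (_ - X ^+ 2)]eq_bigr do rewrite etaE slopeE mulrCA.
  rewrite -!big_distrr/=; field; exact: g0.
apply/funext => s; rewrite /F1 dotp_eta_mean /GRing.scale/= big_distrr/=.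
by apply: eq_bigr => j _; rewrite etaE slopeE; ring.
Qed.

(** The second derivative along the line is the softmax variance divided by [ggam D i], at most
    [Mi i] times |v|^2. *)
Lemma lse_line_upper :
  lse i (x + v) <= lse i x + dotp (eta_mean i x) v + Mi i / 2 * dotp v v.
Proof.
have := taylor2_le dF dF1 (fun t => softcov_form_le i (x + t *: v) v).
by rewrite /F /F1 scale1r scale0r addr0 mulrAC.
Qed.

Lemma lse_line_lower : lse i x + dotp (eta_mean i x) v <= lse i (x + v).
Proof.
have dG t : is_derive t (1 : R) (- F) (- F1 t) by exact: is_deriveN.
have dG1 t : is_derive t (1 : R) (fun t => - F1 t) (- F2 t) by exact: is_deriveN.
have G2 t : - F2 t <= 0.
  by rewrite oppr_le0 mulr_ge0 ?softcov_form_ge0// invr_ge0 ltW.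
have := taylor2_le dG dG1 G2.
rewrite /F /F1 [(- _) 1]/GRing.opp/= [(- _) 0]/GRing.opp/= scale1r scale0r addr0; lra.
Qed.
End along_line.

Definition idx_lam (s : idx) : R := match s with inl i => glam D i | inr i => glam D i end.

(** For index -i, subtracting [phiplus] costs at most Mi i + glam D i of convexity, and gLam D i is
    at least Mi i + 2 glam D i: the modulus is again glam D i. *)
Lemma phitil_convex s : strongly_convex_gradient (idx_lam s) (phitil s) (Ttil s).
Proof.
have sq x z : dotp z z = dotp x x + 2 * dotp x (z - x) + dotp (z - x) (z - x).
  by rewrite dotpBl !dotpBr (dotpC z x); ring.
case: s => i x z /=; rewrite /phiplus -/(lse i x) -/(lse i z) /Tplus -/(eta_mean i x).
  have := lse_line_lower i x (z - x); rewrite (addrC x (z - x)) subrK => h.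
  by rewrite dotpDl dotpZl !enorm_sqr (sq x z); lra.
have := lse_line_upper i x (z - x); rewrite (addrC x (z - x)) subrK => h.
have [_ _ _ _ [_ _ _ _ /(_ i)]] := hD; rewrite -/(Mi i) => hL.
rewrite dotpBl dotpDl !dotpZl !enorm_sqr (sq x z).
have := dotp_sqr_ge0 (z - x); set Q := dotp (z - x) (z - x) in h *.
by nra.
Qed.

Lemma betaminus_gt0 i : 0 < betaminus i.
Proof.
rewrite divr_gt0 ?mulr_gt0 ?subr_gt0//.
have [[_ Kt2 _] _ _ _ _] := hD.
pose i0 : 'I_(gKt D) := Ordinal (ltnW Kt2).
rewrite (bigD1 i0)//= ltr_pwDl ?mulr_gt0 ?gLam_gt0//.
by apply: sumr_ge0 => j _; rewrite ltW// !mulr_gt0// gLam_gt0.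
Qed.

Lemma betaw_gt0 (s : idx) : 0 < betaw s.
Proof.
case: s => i /=; last exact: betaminus_gt0.
by rewrite mulr_gt0 ?betaminus_gt0// divr_gt0.
Qed.

(** The modulus is taken from the [phitil] alone since [gxi D] may be 0; the term in A_k enters
    through its convexity. *)
Definition phik_modulus k : R := \sum_(s : idx | gPhi D s == k) betaw s * idx_lam s.

Lemma phik_modulus_gt0 k : 0 < phik_modulus k.
Proof.
have [_ _ _ /(_ k)[s sk] _] := hD.
have lam0 s' : 0 < betaw s' * idx_lam s'.
  by rewrite mulr_gt0 ?betaw_gt0//; case: s'.
rewrite /phik_modulus (bigD1 s)/=; last exact/eqP.
by rewrite ltr_pwDl// sumr_ge0// => s' _; exact: ltW.
Qed.

Lemma phik_convex k :
  strongly_convex_gradient (phik_modulus k) (phik k) (Tmap k).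
Proof.
move=> x z; rewrite /phik /Tmap.
have [_ _ _ _ [/(_ k)[Asym Apos] _ _ _ _]] := hD.
set A := gA D k; set b := gb D k.
have h1 : \sum_(s : idx | gPhi D s == k) betaw s * phitil s x
    + dotp (\sum_(s : idx | gPhi D s == k) betaw s *: Ttil s x) (z - x)
    + phik_modulus k / 2 * dotp (z - x) (z - x)
    <= \sum_(s : idx | gPhi D s == k) betaw s * phitil s z.
  rewrite dotp_suml /phik_modulus -mulrA big_distrl/= -!big_split/=.
  apply: ler_sum => s _; rewrite dotpZl -mulrA -!mulrDr ler_pM2l ?betaw_gt0//.
  by rewrite mulrA; exact: phitil_convex.
have symA u v : dotp (mxact A u) v = dotp u (mxact A v).
  by rewrite /mxact dotp_mulmx Asym.
have h2 : dotp (2^-1 *: mxact A x + b) x + dotp (mxact A x + b) (z - x) <=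
    dotp (2^-1 *: mxact A z + b) z.
  have : 0 <= dotp (mxact A (z - x)) (z - x).
    rewrite dotpC; have [->|zx] := eqVneq (z - x) 0; first by rewrite dotp0l.
    by rewrite ltW// Apos.
  have -> : mxact A (z - x) = mxact A z - mxact A x by rewrite /mxact mulmxBl.
  have e : dotp (mxact A z) x = dotp (mxact A x) z by rewrite symA dotpC.
  rewrite dotpBl !dotpDl !dotpZl !dotpBr e; lra.
rewrite [X in _ + X + _ <= _]dotpDl dotpZl; have := ler_wpM2l gxi_ge0 h2; rewrite mulrDr => h3.
lra.
Qed.

(** Indices i and -i carry the same total weight w beta, so their potentials add up to gLam D i / 2
    |x|^2. The denominator in [betaminus] normalizes the sum to (1 - xi) / 2 |x|^2, and the averages
    of the A_k and b_k give the remaining xi / 2 |x|^2. *)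
Lemma phik_average x : \sum_k gw D k * phik k x = 2^-1 * enorm x ^+ 2.
Proof.
have [[_ Kt2 _] [_ wsum] _ _ [_ Asum bsum _ _]] := hD.
under eq_bigr do rewrite mulrDr.
rewrite big_split/=.
have -> : \sum_k gw D k * (\sum_(s : idx | gPhi D s == k) betaw s * phitil s x) =
    (1 - gxi D) / 2 * enorm x ^+ 2.
  transitivity (\sum_(s : idx) gw D (gPhi D s) * (betaw s * phitil s x)).
    rewrite (partition_big (gPhi D) xpredT)//=; apply: eq_bigr => k _.
    by rewrite big_distrr/=; apply: eq_bigr => s /eqP ->.
  rewrite big_sumType/= -big_split/=.
  transitivity (\sum_i (gw D (gPhi D (inr i)) * galp D i * gLam D i) *
      ((1 - gxi D) / 2 * enorm x ^+ 2 /
      \sum_i gw D (gPhi D (inr i)) * galp D i * gLam D i)).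
    apply: eq_bigr => i _; rewrite mulrA (mulrA (gw D (gPhi D (inl i)))).
    rewrite (mulrCA _ (_ / _)) mulrC.
    have w0 : gw D (gPhi D (inl i)) != 0 by rewrite gt_eqF.
    rewrite /betaminus; set S := \sum__ _.
    have : S != 0.
      apply: contraTneq (betaminus_gt0 i); rewrite /betaminus -/S => ->.
      by rewrite invr0 mulr0 ltxx.
    by move=> S0; field; rewrite S0 w0.
  rewrite -big_distrl/= mulrC divfK// gt_eqF//.
  pose i0 : 'I_(gKt D) := Ordinal (ltnW Kt2).
  rewrite (bigD1 i0)//= ltr_pwDl ?mulr_gt0 ?gLam_gt0//.
  by apply: sumr_ge0 => j _; rewrite ltW// !mulr_gt0// gLam_gt0.
have -> : \sum_k gw D k * (gxi D * dotp (2^-1 *: mxact (gA D k) x + gb D k) x) =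
    gxi D / 2 * enorm x ^+ 2.
  transitivity (gxi D * dotp (2^-1 *: mxact (\sum_k gw D k *: gA D k) x
      + \sum_k gw D k *: gb D k) x).
    rewrite dotpDl dotpZl dotp_suml /mxact linear_sum/= mulmx_sumr dotp_suml.
    rewrite big_distrr/= -big_split/= big_distrr/=; apply: eq_bigr => k _.
    rewrite dotpDl !dotpZl linearZ/= -scalemxAr dotpZl; ring.
  by rewrite Asum bsum addr0 dotpZl /mxact trmx1 mulmx1 -enorm_sqr mulrA.
ring.
Qed.

End procedure_potentials.

Section smooth_jacobian.
Context {R : realType} {d : nat} (alpha : R).
Hypotheses (alpha0 : 0 < alpha).
Local Notation "'e_ i" := (delta_mx 0 i : 'rV[R]_d) (at level 8, i at level 2).

Lemma is_derive_of_line (f : 'rV[R]_d -> R) x v (k : R) :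
  is_derive (0 : R) (1 : R) (fun t : R => f (x + t *: v)) k -> is_derive x v f k.
Proof.
move=> /is_derive_epsP H; apply/is_derive_epsP => e /H[r r0 {}H].
by exists r => // h /H; rewrite scale0r addr0 add0r [h *: 1]mulr1.
Qed.

Lemma smooth_derive q (g : 'rV[R]_d -> R) i : smooth alpha q.+1 g ->
  smooth alpha q ('D_('e_i) g) /\ forall x, is_derive x 'e_i g ('D_('e_i) g x).
Proof.
case=> _ /(_ i)[dg g_dg sdg].
have -> : 'D_('e_i) g = dg by apply/funext => x; have [] := g_dg x.
by [].
Qed.

Lemma smooth_has_jac (T : 'rV[R]_d -> 'rV[R]_d) :
  (forall q j, smooth alpha q (fun x => T x 0 j)) ->
  exists2 J : 'rV[R]_d -> 'M[R]_d, (forall x, has_jac T x (J x)) &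
    forall q i j, smooth alpha q (fun x => J x i j).
Proof.
move=> sT; pose dT i j := 'D_('e_i) (fun x => T x 0 j).
have sdT q i j : smooth alpha q (dT i j) by have [] := smooth_derive i (sT q.+1 j).
have T_dT i j x : is_derive x 'e_i (fun x => T x 0 j) (dT i j x).
  by have [_] := smooth_derive i (sT 1%N j).
exists (fun x => \matrix_(i, j) dT i j x) => [x e e0|q i j]; last first.
  by under eq_fun do rewrite mxE.
have /choice[r rE] (j : 'I_d) : exists r : R, 0 < r /\ forall y, `|y - x| < r ->
    `|T y 0 j - T x 0 j - \sum_i (y - x) 0 i * dT i j x| <= e * `|y - x|.
  have [r r0 H] := total_derivative x (fun i => T_dT i j)
    (fun i => smooth_continuous alpha0 (sdT 0%N i j)) e0.
  by exists r.
exists (\big[Num.min/1]_j r j).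
  by apply/bigmin_gtP; split => // j _; case: (rE j).
move=> y /bigmin_gtP[_ yr].
apply: norm_le_coord => [|j]; first by rewrite mulr_ge0// ltW.
have [_ /(_ y (yr j isT))] := rE j.
congr (`| _ | <= _); rewrite 2!rowB [X in _ = _ - X]mxE; congr (_ - _).
by apply: eq_bigr => i _; congr (_ * _); rewrite [RHS]mxE.
Qed.

End smooth_jacobian.

(** * Growth and smoothness of the maps T_k *)

Section procedure_maps.
Context {R : realType} {d : nat} (D : gen_input R d).
Hypotheses (hD : gen_valid D).
Local Notation E := 'rV[R]_d.
Implicit Types (x z v : E) (k : 'I_(gK D)) (i : 'I_(gKt D)).

Let gn_gt0 i : (0 < gn D i)%N. Proof. by have [_ _ /(_ i)[]] := hD. Qed.

Definition linear_growth (h : E -> R) :=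
  exists2 C : R, 0 <= C & forall x, `|h x| <= C * (1 + enorm x).

Let linear_growthD (f g : E -> R) : linear_growth f -> linear_growth g ->
  linear_growth (fun x => f x + g x).
Proof.
move=> [C C0 HC] [C' C'0 HC']; exists (C + C') => [|x]; first exact: addr_ge0.
by rewrite mulrDl (le_trans (ler_normD _ _))// lerD.
Qed.

Let linear_growthZ (c : R) (f : E -> R) : linear_growth f ->
  linear_growth (fun x => c * f x).
Proof.
move=> [C C0 HC]; exists (`|c| * C) => [|x]; first exact: mulr_ge0.
by rewrite normrM -mulrA ler_wpM2l.
Qed.

Let linear_growth_bounded (f : E -> R) (C : R) : (forall x, `|f x| <= C) ->
  linear_growth f.
Proof.
move=> fC; have C0 : 0 <= C by rewrite (le_trans _ (fC 0)).
exists C => // x; rewrite (le_trans (fC x))// ler_peMr// lerDl.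
exact: enorm_ge0.
Qed.

Let linear_growth_coord (a : 'I_d) : linear_growth (fun x => x 0 a).
Proof.
exists 1 => // x; rewrite mul1r (le_trans (coord_le_norm x a))//.
by rewrite (le_trans (norm_le_enorm x))// lerDr.
Qed.

Let linear_growth_sum (I : Type) (r : seq I) (P : pred I) (F : I -> E -> R) :
  (forall m, linear_growth (F m)) ->
  linear_growth (fun x => \sum_(m <- r | P m) F m x).
Proof.
move=> hF; elim: r => [|m r IH].
  under eq_fun do rewrite big_nil.
  by apply: (@linear_growth_bounded _ 0) => x; rewrite normr0.
under eq_fun do rewrite big_cons.
by case: (P m) => //; exact: linear_growthD.
Qed.

Let TtilE_inl i x a : Ttil (D := D) (inl i) x 0 a =
  \sum_(j < gn D i) gy D i j 0 a * eta i x 0 j + glam D i * x 0 a.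
Proof.
rewrite /= mxE summxE mxE; congr (_ + _).
by apply: eq_bigr => j _; rewrite mxE mulrC.
Qed.

Let TtilE_inr i x a : Ttil (D := D) (inr i) x 0 a =
  gLam D i * x 0 a + -1 * Ttil (D := D) (inl i) x 0 a.
Proof. by rewrite /= mxE [X in X + _]mxE [X in _ + X]mxE mulN1r. Qed.

Let TmapE k x a : Tmap k x 0 a =
  \sum_(s | gPhi D s == k) betaw s * Ttil s x 0 a +
  gxi D * (\sum_b gA D k a b * x 0 b + gb D k 0 a).
Proof.
rewrite mxE summxE mxE [in X in _ + _ * X]mxE; congr (_ + _ * (_ + _)).
  by apply: eq_bigr => s _; rewrite mxE.
by rewrite mxE; apply: eq_bigr => b _; rewrite mxE mulrC.
Qed.

Lemma quadb_Tmap k : quadb (fun x => enorm (Tmap k x) ^+ 2).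
Proof.
have lT a : linear_growth (fun x => Tmap k x 0 a).
  have l1 i : linear_growth (fun x => Ttil (D := D) (inl i) x 0 a).
    under eq_fun do rewrite TtilE_inl.
    apply: linear_growthD; last exact: linear_growthZ.
    apply: linear_growth_sum => j; apply: linear_growthZ.
    apply: (@linear_growth_bounded _ 1) => x.
    by rewrite ger0_norm ?eta_ge0// eta_le1.
  under eq_fun do rewrite TmapE.
  apply: linear_growthD.
    apply: linear_growth_sum => -[i|i]; apply: linear_growthZ; first exact: l1.
    under eq_fun do rewrite TtilE_inr.
    by apply: linear_growthD; exact: linear_growthZ.
  apply: linear_growthZ; apply: linear_growthD.
    by apply: linear_growth_sum => b; exact: linear_growthZ.
  exact: (@linear_growth_bounded _ `|gb D k 0 a|).
have mT := measurable_Tmap k.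
split.
  by under eq_fun do rewrite enorm_sqr; exact: measurable_dotpp.
have /choice[C CE] a : exists C : R, forall x, `|Tmap k x 0 a| <= C * (1 + enorm x).
  by have [C _ H] := lT a; exists C.
exists (\sum_a 2 * C a ^+ 2) => x; rewrite ger0_norm ?sqr_ge0// enorm_sqr.
rewrite [leLHS]/dotp big_distrl/=; apply: ler_sum => a _.
rewrite -expr2 -real_normK ?num_real//.
have e0 := enorm_ge0 x.
apply: (@le_trans _ _ ((C a * (1 + enorm x)) ^+ 2)).
  by rewrite ler_pXn2r ?nnegrE// (le_trans _ (CE a x)).
have h : (1 + enorm x) ^+ 2 <= 2 * (1 + enorm x ^+ 2).
  by have := sqr_ge0 (enorm x - 1); lra.
rewrite exprMn -enorm_sqr (le_trans (ler_wpM2l (sqr_ge0 _) h))//.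
by rewrite mulrA (mulrC _ 2).
Qed.

Section smoothness.
Variable alpha : R.
Hypotheses (alpha0 : 0 < alpha) (alpha1 : alpha <= 1).
Local Notation "'e_ a" := (delta_mx 0 a : E) (at level 8, a at level 2).

Let slope i (a : 'I_d) (j : 'I_(gn D i)) := dotp (gy D i j) 'e_a / ggam D i.

Let eta_derive i j a x : is_derive x 'e_a (fun x => eta i x 0 j)
  (eta i x 0 j * (slope a j + -1 * \sum_l slope a l * eta i x 0 l)).
Proof.
apply: is_derive_of_line.
pose b (l : 'I_(gn D i)) := (gg D i l + dotp (gy D i l) x) / ggam D i.
have sE (l : 'I_(gn D i)) (t : R) :
    score l (x + t *: 'e_a) = expR (b l + t * slope a l) by exact: score_line.
have eE (l : 'I_(gn D i)) (t : R) : eta i (x + t *: 'e_a) 0 l =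
    expR (b l + t * slope a l) / \sum_(l' < gn D i) expR (b l' + t * slope a l').
  rewrite mxE sE; congr (_ / _); apply: eq_bigr => l' _; exact: sE.
rewrite (_ : (fun t => _) = fun t : R => expR (b j + t * slope a j) /
    \sum_(l' < gn D i) expR (b l' + t * slope a l')); last first.
  by apply/funext => t; exact: eE.
apply: (is_derive_eq (softmax_derive b (@slope i a) (gn_gt0 i) j 0)).
have eE0 l := eE l 0; rewrite scale0r addr0 in eE0.
rewrite eE0 mulN1r; congr (_ * (_ - _)); apply: eq_bigr => l _.
by rewrite eE0 mulrC.
Qed.

(** The partial derivatives of the weights are polynomials in the weights, so the induction on q
    closes. It starts because the weights lie in [0, 1], which bounds these derivatives. *)
Lemma smooth_eta q i j : smooth alpha q (fun x => eta i x 0 j).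
Proof.
have hol l : loc_holder alpha (fun x => eta i x 0 l).
  apply: (partial_bounded_lip alpha1 (fun a x => eta_derive l a x)) => a r.
  exists (1 * (`|slope a l| + \sum_(m < gn D i) `|slope a m|)) => x _.
  rewrite normrM ler_pM//; first by rewrite ger0_norm ?eta_ge0// eta_le1.
  rewrite (le_trans (ler_normD _ _))// lerD2l mulN1r normrN.
  rewrite (le_trans (ler_norm_sum _ _ _))//; apply: ler_sum => m _.
  by rewrite normrM ler_piMr// ger0_norm ?eta_ge0// eta_le1.
elim: q j => [|q IH] j; first by [].
split=> // a; exists (fun x => eta i x 0 j *
    (slope a j + -1 * \sum_l slope a l * eta i x 0 l)).
  by move=> x; exact: eta_derive.
apply: smoothM => //.
apply: smoothD; first exact: smooth_cst.
by apply: smoothZ => //; apply: smooth_sum => l _; exact: smoothZ.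
Qed.

Lemma smooth_Tmap q k a : smooth alpha q (fun x => Tmap k x 0 a).
Proof.
have sl i : smooth alpha q (fun x => Ttil (D := D) (inl i) x 0 a).
  under eq_fun do rewrite TtilE_inl.
  apply: smoothD; last by apply: smoothZ => //; exact: smooth_coord.
  by apply: smooth_sum => j _; apply: smoothZ => //; exact: smooth_eta.
under eq_fun do rewrite TmapE.
apply: smoothD.
  apply: smooth_sum => -[i|i] _; apply: smoothZ => //.
  under eq_fun do rewrite TtilE_inr.
  apply: smoothD; apply: smoothZ => //; exact: smooth_coord.
apply: smoothZ => //; apply: smoothD; last exact: smooth_cst.
by apply: smooth_sum => b _; apply: smoothZ => //; exact: smooth_coord.
Qed.

End smoothness.

Lemma measurable_phik k : measurable_fun [set: E] (phik k).
Proof.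
have mplus i : measurable_fun [set: E] (phiplus i).
  apply: measurable_funD.
    apply: measurable_funM => //; apply: measurableT_comp; first exact: measurable_ln.
    by apply: measurable_sum => j; exact: measurable_score.
  apply: measurable_funM => //; under eq_fun do rewrite enorm_sqr.
  exact: measurable_dotpp.
apply: measurable_funD.
  under eq_fun do rewrite big_mkcond/=.
  apply: measurable_sum => s; case: (_ == _); last exact: measurable_cst.
  apply: measurable_funM => //; case: s => i /=; first exact: mplus.
  apply: measurable_funB; last exact: mplus.
  apply: measurable_funM => //; under eq_fun do rewrite enorm_sqr.
  exact: measurable_dotpp.
apply: measurable_funM => //; apply: measurable_dotpp => //.
apply: measurable_fun_rV => a.
under eq_fun do rewrite mxE [X in X + _]mxE.
apply: measurable_funD => //; apply: measurable_funM => //.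
under eq_fun do rewrite mxE.
by apply: measurable_sum => b; apply: measurable_funM => //; exact: measurable_coord.
Qed.

End procedure_maps.

(** * Density of the pushforward *)

Section pushforward_density.
Context {R : realType} {d : nat}.
Local Notation E := 'rV[R]_d.
Variables (c : R) (T S : E -> E) (J : E -> 'M[R]_d).
Hypotheses (c0 : 0 < c) (mT : strongly_monotone c T) (TS : forall y, T (S y) = y)
  (TJ : forall x, has_jac T x (J x)) (cJ : forall i j, continuous (fun x => J x i j)).
Variables (mub pi : probability E R).
Hypothesis lT : has_law mub T pi.

Lemma jac_det_ge x : c ^+ d <= \det (J x).
Proof. by have [h _] := integral_substitution_monotone c0 mT TJ cJ; exact: h. Qed.

Lemma jac_det_gt0 x : 0 < \det (J x).
Proof. by rewrite (lt_le_trans _ (jac_det_ge x))// exprn_gt0. Qed.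

Let mTf : measurable_fun [set: E] T. Proof. by case: lT. Qed.

Let mdet : measurable_fun [set: E] (fun x => \det (J x)).
Proof. by apply: continuous_measurable_mxreal; exact: det_continuous. Qed.

Let mpre A : measurable A -> measurable (T @^-1` A).
Proof. by move=> mA; rewrite -[_ @^-1` _]setTI; exact: mTf. Qed.

(** Substitution in the indicator of a null set A makes the integral of det J over the preimage of A
    vanish, and det J is at least c ^+ d > 0 there. *)
Lemma pushforward_dominates : mub `<< leb d -> pi `<< leb d.
Proof.
move=> /null_content_dominatesP mubl; apply/null_content_dominatesP => A mA A0.
have [_ <-] := lT; last exact: mA.
apply: mubl; first exact: mpre.
have [_ cov] := integral_substitution_monotone c0 mT TJ cJ.
have := cov (fun y => (\1_A y)%:E); rewrite integral_indic// setIT A0.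
have mI : measurable_fun setT (fun y : E => ((\1_A : E -> R) y)%:E).
  by apply/measurable_EFinP; exact: measurable_indic.
move=> /(_ mI) H; have {}H : (\int[leb d]_x ((\1_A (T x))%:E * (\det (J x))%:E) = 0)%E.
  by apply: H => x; rewrite lee_fin.
have cd0 : 0 < c ^+ d by rewrite exprn_gt0.
apply/eqP; rewrite eq_le measure_ge0 andbT.
rewrite -(@lee_pmul2l _ (c ^+ d)%:E)// mule0 -H.
rewrite -integral_cst; last exact: mpre.
rewrite integral_mkcond; apply: ge0_le_integral => //.
- by move=> x _; rewrite patchE; case: ifP => // _; rewrite lee_fin ltW.
- apply/(measurable_restrictT _ (mpre mA)); exact: measurable_cst.
- apply: emeasurable_funM; last exact/measurable_EFinP.
  exact: measurableT_comp mI mTf.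
move=> x _; rewrite patchE indicE; case: ifPn => xA.
  rewrite inE in xA; rewrite mem_set// mul1e lee_fin; exact: jac_det_ge.
by rewrite mule_ge0// lee_fin ltW// jac_det_gt0.
Qed.

Lemma continuous_monotone_inverse : continuous S.
Proof.
move=> x; apply/continuous_atP => e e0.
pose K := c^-1 * (Num.sqrt d%:R + 1).
have K0 : 0 < K by rewrite mulr_gt0 ?invr_gt0// ltr_pwDr ?sqrtr_ge0.
exists (e / K) => [|y yx]; first exact: divr_gt0.
rewrite (le_lt_trans (norm_le_enorm _))//.
rewrite (le_lt_trans (monotone_inverse_lip c0 mT TS _ _))//.
apply: (@le_lt_trans _ _ (K * `|y - x|)); last by rewrite mulrC -ltr_pdivlMr.
rewrite /K -mulrA ler_pM2l ?invr_gt0// (le_trans (enorm_le_norm _))//.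
by rewrite ler_wpM2r// lerDl.
Qed.

(** Substitution applied to the candidate density cut off to [A]: at T x its inverse determinant
    cancels the Jacobian factor, and f (S (T x)) = f x. *)
Lemma pushforward_density (f : E -> R) : is_density mub f ->
  forall A, measurable A ->
  (pi A = \int[leb d]_(y in A) (f (S y) * (\det (J (S y)))^-1)%:E)%E.
Proof.
move=> [mf f0 fE] A mA.
have mS := continuous_measurable_mx continuous_monotone_inverse.
have ST x : S (T x) = x by apply: (strongly_monotone_inj c0 mT); rewrite TS.
have [_ <-] := lT; last exact: mA.
rewrite fE; last exact: mpre.
have [_ cov] := integral_substitution_monotone c0 mT TJ cJ.
pose F y : \bar R := (f (S y) * (\det (J (S y)))^-1 * \1_A y)%:E.
have mF : measurable_fun setT F.
  apply/measurable_EFinP; apply: measurable_funM; last exact: measurable_indic.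
  apply: measurable_funM; first exact: measurableT_comp mf mS.
  apply: continuous_measurable_mxreal => y; apply: (@continuousV R _ (fun y => \det (J (S y)))).
    by rewrite gt_eqF// jac_det_gt0.
  apply: (@continuous_comp _ _ _ S (fun x => \det (J x))).
    exact: continuous_monotone_inverse.
  exact: det_continuous.
have F0 y : (0 <= F y)%E.
  by rewrite lee_fin !mulr_ge0// ?invr_ge0 ltW ?jac_det_gt0.
transitivity (\int[leb d]_y F y)%E; last first.
  rewrite [RHS]integral_mkcond; apply: eq_integral => y _.
  by rewrite patchE /F indicE; case: ifP => _; rewrite ?mulr1 ?mulr0.
rewrite -(cov F mF F0) [LHS]integral_mkcond; apply: eq_integral => x _.
rewrite patchE /F ST -EFinM indicE.
have -> : (x \in T @^-1` A) = (T x \in A).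
  by apply/idP/idP => /set_mem h; exact: mem_set.
case: ifP => _; last by rewrite mulr0 mul0r.
by rewrite mulr1 divfK// gt_eqF// jac_det_gt0.
Qed.

Lemma pushforward_open_gt0 : continuous T -> supp mub = setT ->
  forall U : set E, open U -> U !=set0 -> (0 < pi U)%E.
Proof.
move=> cT suppT U oU [y Uy]; have [_ <-] := lT; last exact: open_measurable_mx.
have : supp mub (S y) by rewrite suppT.
by apply; [move/continuousP : cT; exact|rewrite /= TS].
Qed.

End pushforward_density.

Section truncated_regularity.
Context {R : realType} {d : nat}.
Local Notation E := 'rV[R]_d.

Lemma closed_measurable_mx (Y : set E) : closed Y -> measurable Y.
Proof.
move=> cY; rewrite -(setCK Y); apply: measurableC; apply: open_measurable_mx.
exact: closed_openC.
Qed.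

Lemma closed_norm_le (M : R) : closed [set z : E | `|z| <= M].
Proof.
by apply: (@closed_comp _ _ (fun z : E => `|z|) [set r | r <= M]);
  [move=> z _; exact: norm_continuous|exact: closed_le].
Qed.

Lemma bounded_set_closure (A : set E) : bounded_set A -> bounded_set (closure A).
Proof.
move=> [M [Mreal MA]]; exists M; split=> // M' MM' y Ay.
have AB : A `<=` [set z : E | `|z| <= M'] by move=> z; exact: (MA _ MM').
by have := closureS AB Ay; rewrite -((closure_id _).1 (@closed_norm_le M')).
Qed.

Variables (pi : probability E R) (Y0 : set E).
Hypotheses (piU : forall U : set E, open U -> U !=set0 -> (0 < pi U)%E)
  (Y0_neq0 : Y0 !=set0) (oY0 : open Y0).

Let mY : measurable (closure Y0).
Proof. by apply: closed_measurable_mx; exact: closed_closure. Qed.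

Lemma fine_closure_gt0 : 0 < fine (pi (closure Y0)).
Proof.
apply: fine_gt0; apply/andP; split.
  apply: lt_le_trans (piU oY0 Y0_neq0) _.
  by apply: le_measure; rewrite ?inE//; [exact: open_measurable_mx|exact: subset_closure].
by rewrite (le_lt_trans (probability_le1 _ _))// ltry.
Qed.

Lemma supp_truncate : supp (truncate pi (closure Y0)) = closure Y0.
Proof.
have p0 := fine_closure_gt0.
apply/seteqP; split=> x.
  move=> xs; apply: contrapT => nx.
  have oC : open (~` closure Y0) by apply: closed_openC; exact: closed_closure.
  have := xs _ oC nx; rewrite truncate_mass//; last exact: measurableC.
  by rewrite setICl measure0 mul0e ltxx.
move=> xY U oU Ux; rewrite truncate_mass//; last exact: open_measurable_mx.
rewrite mule_gt0//; last by rewrite lte_fin invr_gt0.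
(* [U] meets the open set [Y0] itself, and the intersection is open, hence charged by [pi]; its
   intersection with the closure need not be open. *)
have /xY[y [Y0y Uy]] : nbhs x U by exact: open_nbhs_nbhs.
apply: (@lt_le_trans _ _ (pi (U `&` Y0))).
  by apply: piU; [exact: openI|exists y].
apply: le_measure; rewrite ?inE.
- by apply: measurableI; exact: open_measurable_mx.
- by apply: measurableI => //; exact: open_measurable_mx.
- by apply: setIS; exact: subset_closure.
Qed.

Lemma Mclass_truncate (q : nat) (alpha : R) (g : E -> R) :
  P2 pi -> pi `<< leb d -> 0 < alpha < 1 -> smooth alpha q g ->
  (forall y, 0 < g y) -> measurable_fun [set: E] g ->
  (forall A, measurable A -> (pi A = \int[leb d]_(y in A) (g y)%:E)%E) ->
  Sdom q Y0 -> Mclass q (truncate pi (closure Y0)).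
Proof.
move=> pi2 piac /andP[alpha0 alpha1] sg g0 mg gE SY.
have p0 := fine_closure_gt0; set p := fine (pi (closure Y0)) in p0.
have [_ _ bY _ _] := SY.
split.
  split; first exact: truncate_P2.
  apply/null_content_dominatesP => A mA A0; rewrite truncate_mass//.
  suff -> : pi (A `&` closure Y0) = 0%E by rewrite mul0e.
  move/null_content_dominatesP : piac => h; apply/eqP.
  rewrite eq_le measure_ge0 andbT -(h _ mA A0).
  by apply: le_measure; rewrite ?inE//; exact: measurableI.
pose f y : R := p^-1 * g y * \1_(closure Y0) y.
have sf : smooth alpha q (fun y => p^-1 * g y) by exact: smoothZ.
have fE y : closure Y0 y -> f y = p^-1 * g y.
  by move=> Yy; rewrite /f indicE mem_set// mulr1.
have cf := smooth_continuous alpha0 sf.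
have f0 y : 0 < p^-1 * g y by rewrite mulr_gt0// invr_gt0.
have cptY : compact (closure Y0).
  by apply: bounded_closed_compact; [exact: bounded_set_closure|exact: closed_closure].
have Yn0 : closure Y0 !=set0 by have [y Yy] := Y0_neq0; exists y; exact: subset_closure.
have [ymin /[!inE] Ymin fmin] := EVT_min_rV Yn0 cptY (continuous_subspaceT cf).
have [ymax /[!inE] Ymax fmax] := EVT_max_rV Yn0 cptY (continuous_subspaceT cf).
(* A sum of positive terms that is at least 1, the inverse of the minimum and the maximum of the
   density on the compact support. *)
pose zeta := 1 + (p^-1 * g ymin)^-1 + p^-1 * g ymax.
have V0 : 0 < (p^-1 * g ymin)^-1 by rewrite invr_gt0.
have zeta1 : 1 <= zeta by rewrite /zeta -addrA lerDl addr_ge0// ltW.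
exists Y0, f, alpha, zeta; split.
- by split=> //; exact: supp_truncate.
- split.
  + apply: measurable_funM; last exact: measurable_indic.
    exact: measurable_funM.
  + by move=> y; rewrite mulr_ge0// ltW.
  move=> A mA; rewrite truncate_mass// gE; last exact: measurableI.
  have gfin B y : B y -> (0 <= (g y)%:E)%E by rewrite lee_fin ltW.
  rewrite -(ge0_integralZr _ _ _ (gfin (A `&` closure Y0)));
    [|exact: measurableI| |by rewrite lee_fin invr_ge0 ltW]; last first.
    by apply/measurable_EFinP; exact: measurable_funTS.
  rewrite integral_mkcond [RHS]integral_mkcond; apply: eq_integral => y _.
  rewrite !patchE in_setI /f indicE; case: (y \in A) => //=.
  by case: (y \in closure Y0); rewrite ?mulr1 ?mulr0// -EFinM mulrC.
- split; first by rewrite alpha0 alpha1.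
  exact: (smooth_Cholder alpha0 oY0 bY sf fE).
- split=> // y; rewrite supp_truncate => Yy; rewrite fE//; apply/andP; split.
    have := fmin y (mem_set Yy); apply: le_trans.
    rewrite -[leRHS]invrK lef_pV2 ?posrE ?invr_gt0 ?(lt_le_trans ltr01 zeta1)//.
    by rewrite /zeta addrAC lerDr addr_ge0// ltW.
  apply: (le_trans (fmax y (mem_set Yy))).
  by rewrite /zeta lerDr addr_ge0// ltW.
Qed.

End truncated_regularity.

Section truncation_limit.
Context {R : realType} {d : nat}.
Local Notation E := 'rV[R]_d.
Variables (pi : probability E R) (Y : nat -> set E).
Hypotheses (pi2 : P2 pi) (mY : forall r, measurable (Y r))
  (piY : forall r, 0 < fine (pi (Y r)))
  (Y_incr : forall r, Y r `<=` Y r.+1) (Y_cover : \bigcup_r Y r = [set: E]).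

Let Y_le m n : (m <= n)%N -> Y m `<=` Y n.
Proof.
elim: n => [|n IH]; first by rewrite leqn0 => /eqP ->.
rewrite leq_eqVlt => /predU1P[->//|mn]; by move=> x /(IH mn); exact: Y_incr.
Qed.

(** The integral splits into (1 / pi(Y r) - 1) times a fixed integral, controlled by continuity from
    below, and the part of [g] outside [Y r], controlled by dominated convergence. *)
Lemma trunc_weight_cvg (g : E -> R) : quadb g -> (forall x, 0 <= g x) ->
  \int[pi]_x (g x * trunc_weight pi (Y r) x) @[r --> \oo] --> (0 : R).
Proof.
move=> qg g0; have ig := quadb_integrable pi2 qg.
have qi r : quadb (fun x => g x * \1_(~` Y r) x).
  by apply: quadb_indicM => //; exact: measurableC.
have -> : (fun r => \int[pi]_x (g x * trunc_weight pi (Y r) x)) =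
    (fun r => ((fine (pi (Y r)))^-1 - 1) * (\int[pi]_x g x) +
      \int[pi]_x (g x * \1_(~` Y r) x)).
  apply/funext => r; rewrite -RintegralZl// -RintegralD//.
  - apply: eq_Rintegral => x _; rewrite /trunc_weight.
    by field; rewrite gt_eqF.
  - exact: integrableT_Z.
  - exact: quadb_integrable.
have p1 : fine (pi (Y r)) @[r --> \oo] --> (1 : R).
  apply: fine_cvg; rewrite -[1%:E]/(1%E) -(probability_setT pi) -Y_cover.
  apply: nondecreasing_cvg_mu => //; first exact: bigcup_measurable.
  by move=> m n mn; apply/subsetPset; exact: Y_le.
have c1 : (fine (pi (Y r)))^-1 @[r --> \oo] --> (1 : R).
  by rewrite -[X in _ --> X]invr1; apply: cvgV => //; exact: oner_neq0.
have c2 : \int[pi]_x (g x * \1_(~` Y r) x) @[r --> \oo] --> (0 : R).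
  apply: fine_cvg.
  have [|||||_ _] := @dominated_convergence _ E R pi setT measurableT
    (fun r x => (g x * \1_(~` Y r) x)%:E) (fun=> 0%E) (EFin \o g).
  - by move=> r; apply/measurable_EFinP; case: (qi r).
  - exact: measurable_cst.
  - apply: aeW => x _; have [r _ xr] : (\bigcup_r Y r) x by rewrite Y_cover.
    apply: cvg_near_cst; exists r => // n /= rn.
    by rewrite indicE in_setC mem_set ?mulr0//; exact: Y_le xr.
  - exact: ig.
  - apply: aeW => x n _; rewrite /= lee_fin normrM ger0_norm//.
    by rewrite ler_piMr// indicE ger0_norm// lern1 leq_b1.
  by rewrite integral0.
rewrite -[X in _ --> X](_ : (1 - 1) * \int[pi]_x g x + 0 = 0); last first.
  by rewrite subrr mul0r addr0.
apply: cvgD => //; apply: cvgMl; apply: cvgB => //; exact: cvg_cst.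
Qed.

End truncation_limit.

(** * Barycenter objective, V_min and epsilon *)

Section procedure_values.
Context {R : realType} {d : nat} (D : gen_input R d) (mub : probability 'rV[R]_d R).
Hypotheses (d_gt0 : (0 < d)%N) (hD : gen_valid D) (mub2 : P2 mub).
Local Notation E := 'rV[R]_d.
Implicit Types (k : 'I_(gK D)).

Let w_gt0 k : 0 < gw D k. Proof. by have [_ []] := hD. Qed.
Let w_ge0 k : 0 <= gw D k. Proof. exact: ltW. Qed.

Lemma continuous_Tmap k : continuous (Tmap k).
Proof.
apply: continuous_row => a.
exact: (smooth_continuous ltr01 (smooth_Tmap hD ltr01 (lexx 1) 0 k a)).
Qed.

Let convT k := phik_convex d_gt0 hD k.
Let c0 k := phik_modulus_gt0 d_gt0 hD k.

Lemma Tmap_monotone k : strongly_monotone (phik_modulus k) (Tmap k).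
Proof. exact: gradient_strongly_monotone (convT k). Qed.

Lemma Tmap_inverse : exists S : 'I_(gK D) -> E -> E, forall k y, Tmap k (S k y) = y.
Proof.
have /choice[S SE] k : exists S : E -> E, forall y, Tmap k (S y) = y.
  have /choice[S SE] y : exists x, Tmap k x = y.
    exact: strongly_monotone_surj (c0 k) (Tmap_monotone k) (@continuous_Tmap k) y.
  by exists S.
by exists S.
Qed.

Lemma law_pik k : has_law mub (Tmap k) (pik mub k).
Proof. by split=> //; exact: measurable_Tmap. Qed.

Lemma pik_P2 k : P2 (pik mub k).
Proof. exact: quadb_law_P2 mub2 (law_pik k) (quadb_Tmap hD k). Qed.

Variable S : 'I_(gK D) -> E -> E.
Hypothesis TS : forall k y, Tmap k (S k y) = y.

Let mT k : measurable_fun [set: E] (Tmap k). Proof. exact: measurable_Tmap. Qed.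

Let b k := pot_dst (phik k) (S k).
Let A k := \int[mub]_x (enorm (x - Tmap k x) ^+ 2).

Let qa k : quadb (pot_src (phik k)).
Proof. exact: quadb_pot_src (c0 k) (convT k) (measurable_phik k) (mT k) (quadb_Tmap hD k). Qed.

Let qb k : quadb (b k).
Proof.
exact: quadb_pot_dst (c0 k) (convT k) (TS k) (measurable_phik k) (mT k) (quadb_Tmap hD k).
Qed.

Lemma sum_pot_src (mu : probability E R) : P2 mu ->
  \sum_k gw D k * (\int[mu]_x pot_src (phik k) x) = 0.
Proof.
move=> mu2; have ia k := quadb_integrable mu2 (qa k).
under eq_bigr do rewrite -RintegralZl//.
rewrite -Rintegral_sum; last by move=> k; exact: integrableT_Z.
rewrite (_ : (fun x => _) = fun=> 0); first by rewrite Rintegral_cst// mul0r.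
apply/funext => x; rewrite /pot_src.
have [_ [_ w1] _ _ _] := hD.
transitivity (enorm x ^+ 2 * (\sum_k gw D k) - 2 * \sum_k gw D k * phik k x).
  by rewrite !big_distrr/= -sumrB; apply: eq_bigr => k _; ring.
by rewrite w1 phik_average// mulr1 mulrA divff ?pnatr_eq0// mul1r subrr.
Qed.

Lemma transport_cost_sum :
  \sum_k gw D k * A k = \sum_k gw D k * \int[pik mub k]_y b k y.
Proof.
have AE k : A k = \int[mub]_x pot_src (phik k) x + \int[pik mub k]_y b k y.
  exact: (transport_cost_potentials (c0 k) (convT k) (TS k) (measurable_phik k)
    (mT k) (quadb_Tmap hD k) mub2 (law_pik k)).
under eq_bigr do rewrite AE mulrDr.
by rewrite big_split/= sum_pot_src// add0r.
Qed.

Let iA k : mub.-integrable [set: E] (EFin \o (fun x => enorm (x - Tmap k x) ^+ 2)).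
Proof. exact: (integrable_transport_cost (quadb_Tmap hD k) mub2 (law_pik k)). Qed.

Lemma VminE : Vmin D mub = (\sum_k gw D k * A k)%:E.
Proof.
rewrite /Vmin integral_EFinE.
  rewrite Rintegral_sum; last by move=> k; exact: integrableT_Z.
  by congr EFin; apply: eq_bigr => k _; rewrite RintegralZl.
by apply: integrableT_sum => k; exact: integrableT_Z.
Qed.

Lemma W2_sqr_pik k : (W2 mub (pik mub k) ^+ 2 = (A k)%:E)%E.
Proof.
exact: (W2_sqr_optimal (c0 k) (convT k) (TS k) (measurable_phik k) (mT k)
  (quadb_Tmap hD k) mub2 (law_pik k)).
Qed.

Lemma barycenter_obj_ge (nu : 'I_(gK D) -> probability E R) (mu : probability E R) :
  P2 mu -> (forall k, P2 (nu k)) ->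
  ((\sum_k gw D k * \int[nu k]_y b k y)%:E <= barycenter_obj (gw D) nu mu)%E.
Proof.
move=> mu2 nu2; rewrite -[X in X%:E]add0r -{1}(sum_pot_src mu2) -big_split/= -sumEFin.
apply: lee_sum => k _; rewrite -mulrDr EFinM lee_wpmul2l ?lee_fin//.
exact: (W2_sqr_ge (c0 k) (convT k) (TS k) (measurable_phik k) (mT k)
  (quadb_Tmap hD k) mu2 (nu2 k)).
Qed.

Lemma barycenter_obj_pik :
  barycenter_obj (gw D) (fun k => pik mub k) mub = (\sum_k gw D k * A k)%:E.
Proof.
by rewrite -sumEFin; apply: eq_bigr => k _; rewrite W2_sqr_pik EFinM.
Qed.

Lemma barycenter_pik : is_barycenter (gw D) (fun k => pik mub k) mub.
Proof.
split=> // mu mu2; rewrite barycenter_obj_pik transport_cost_sum.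
by apply: barycenter_obj_ge => // k; exact: pik_P2.
Qed.

(** For a minimizer the duality bounds [qW] add up to an equality, so each of them is one. A single
    index then determines the law, because every T_k has its own quadratic gap. *)
Lemma barycenter_pik_unique (mu : probability E R) :
  is_barycenter (gw D) (fun k => pik mub k) mu ->
  forall B, measurable B -> mu B = mub B.
Proof.
move=> [mu2 /(_ mub mub2)]; rewrite barycenter_obj_pik transport_cost_sum.
have [[K2 _ _] _ _ _ _] := hD; pose k0 : 'I_(gK D) := Ordinal (ltnW K2).
pose q k := \int[mu]_x pot_src (phik k) x + \int[pik mub k]_y b k y.
have qW k : ((q k)%:E <= W2 mu (pik mub k) ^+ 2)%E.
  exact: (W2_sqr_ge (c0 k) (convT k) (TS k) (measurable_phik k) (mT k)
    (quadb_Tmap hD k) mu2 (pik_P2 k)).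
have -> : \sum_k gw D k * (\int[pik mub k]_y b k y) = \sum_k gw D k * q k.
  under [RHS]eq_bigr do rewrite mulrDr.
  by rewrite big_split/= sum_pot_src// add0r.
rewrite /barycenter_obj (bigD1 k0)//= [in X in (_ <= X)%E](bigD1 k0)//= EFinD => h.
have h1 : ((gw D k0)%:E * W2 mu (pik mub k0) ^+ 2 <= (gw D k0 * q k0)%:E)%E.
  rewrite -(@leeD2rE _ (\sum_(k < gK D | k != k0) gw D k * q k)%:E)//.
  apply: le_trans h; rewrite leeD2l// -sumEFin; apply: lee_sum => k _.
  by rewrite EFinM lee_wpmul2l ?lee_fin.
move: h1; rewrite EFinM lee_pmul2l ?lte_fin// => h1.
exact: (optimal_source_unique (c0 k0) (convT k0) (TS k0) (measurable_phik k0)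
  (mT k0) (quadb_Tmap hD k0) mub2 (law_pik k0) mu2 h1).
Qed.

Section truncated.
Variable Y : 'I_(gK D) -> set E.
Hypotheses (mY : forall k, measurable (Y k))
  (piY : forall k, 0 < fine (pik mub k (Y k))).
Let h k := trunc_weight (pik mub k) (Y k).
Let e1 k := \int[pik mub k]_x (2 * enorm x ^+ 2 * h k x).
Let e2 k := \int[pik mub k]_x (`|b k x| * h k x).
Let nu k := truncate (pik mub k) (Y k).

Let e1_ge0 k : 0 <= e1 k.
Proof.
apply: Rintegral_ge0 => x _; rewrite mulr_ge0//; first by rewrite mulr_ge0// sqr_ge0.
exact: trunc_weight_ge0.
Qed.

Let e2_ge0 k : 0 <= e2 k.
Proof.
by apply: Rintegral_ge0 => x _; rewrite mulr_ge0//; exact: trunc_weight_ge0.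
Qed.

Lemma eps1E k : eps1 mub k (Y k) = (e1 k)%:E.
Proof.
rewrite /eps1 integral_EFinE//; apply: quadb_integrable; first exact: pik_P2.
by apply: quadb_trunc_weight => //; apply: quadbZ; exact: quadb_enorm2.
Qed.

Lemma eps2E k : eps2 mub k (Y k) = (e2 k)%:E.
Proof.
transitivity (\int[pik mub k]_x (`|b k x| * h k x)%:E)%E.
  apply: eq_integral => x _.
  by rewrite /phik_conj (conj_valueE (c0 k) (convT k) (TS k)).
rewrite integral_EFinE//; apply: quadb_integrable; first exact: pik_P2.
by apply: quadb_trunc_weight => //; apply: quadb_norm; exact: qb.
Qed.

Lemma W2_pikE k : W2 mub (pik mub k) = (Num.sqrt (A k))%:E.
Proof.
have := W2_sqr_pik k; rewrite W2_sqr /W2 => ->.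
by rewrite poweR_EFin powR12_sqrt//; apply: Rintegral_ge0 => x _; exact: sqr_ge0.
Qed.

Lemma epsilonE : epsilon mub Y =
  (\sum_k gw D k * (2 * Num.sqrt (A k) * Num.sqrt (e1 k) + e1 k + e2 k))%:E.
Proof.
rewrite /epsilon -sumEFin; apply: eq_bigr => k _.
by rewrite W2_pikE eps1E eps2E poweR_EFin powR12_sqrt// -!EFinM -!EFinD -EFinM.
Qed.

Let V := \sum_k gw D k * A k.
Let U1 := \sum_k gw D k * (2 * Num.sqrt (A k) * Num.sqrt (e1 k) + e1 k).
Let U2 := \sum_k gw D k * e2 k.

Let nu2 k : P2 (nu k).
Proof. by apply: truncate_P2 => //; exact: pik_P2. Qed.

Let obj_mub_le : (barycenter_obj (gw D) nu mub <= (V + U1)%:E)%E.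
Proof.
rewrite /V /U1 -big_split/= -sumEFin; apply: lee_sum => k _.
rewrite -mulrDr EFinM lee_wpmul2l ?lee_fin// addrA.
by apply: W2_sqr_truncate => //; exact: pik_P2.
Qed.

Let obj_ge mu : P2 mu -> ((V - U2)%:E <= barycenter_obj (gw D) nu mu)%E.
Proof.
move=> mu2; apply: le_trans (barycenter_obj_ge mu2 nu2).
rewrite lee_fin /V transport_cost_sum /U2 -sumrB; apply: ler_sum => k _.
rewrite -mulrBr ler_wpM2l// lerBlDr -lerBlDl.
have := truncate_Rintegral_dist (mY k) (piY k) (pik_P2 k) (qb k).
by apply: le_trans; rewrite distrC ler_norm.
Qed.

(** The infimum and the objective at [mub] lie between V - U2 and V + U1, where V is [Vmin] and U1 +
    U2 is epsilon. *)
Lemma truncated_bounds :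
  (barycenter_obj (gw D) nu mub <=
     ereal_inf [set barycenter_obj (gw D) nu mu | mu in [set mu | P2 mu]]
     + epsilon mub Y)%E /\
  (`| Vmin D mub -
     ereal_inf [set barycenter_obj (gw D) nu mu | mu in [set mu | P2 mu]] |
     <= epsilon mub Y)%E.
Proof.
have epsE : epsilon mub Y = (U1 + U2)%:E.
  rewrite epsilonE /U1 /U2 -big_split/=; congr EFin; apply: eq_bigr => k _.
  by rewrite -mulrDr.
rewrite epsE VminE -/V; set I := ereal_inf _.
have I_ge : ((V - U2)%:E <= I)%E.
  by apply: le_ereal_inf_tmp => _ [mu mu2 <-]; exact: obj_ge.
have I_le : (I <= barycenter_obj (gw D) nu mub)%E.
  by apply: ereal_inf_lbound; exists mub.
have U10 : 0 <= U1.
  apply: sumr_ge0 => k _; rewrite mulr_ge0// addr_ge0// !mulr_ge0//.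
have U20 : 0 <= U2 by apply: sumr_ge0 => k _; rewrite mulr_ge0.
have I_le' := le_trans I_le obj_mub_le.
have IE : I = (fine I)%:E.
  rewrite fineK// fin_numE; apply/andP; split; apply/eqP => E0.
    by move: I_ge; rewrite E0.
  by move: I_le'; rewrite E0.
move: I_ge I_le'; rewrite IE !lee_fin => I1 I2; split.
  by apply: le_trans obj_mub_le _; rewrite -EFinD lee_fin; lra.
by rewrite ler_norml; apply/andP; split; lra.
Qed.

(** As Y k does not have full mass, the weight is bounded below by a positive constant everywhere; a
    charged set [U k] away from the origin then makes eps_(1,k) positive. *)
Lemma epsilon_gt0 (U : 'I_(gK D) -> set E) :
  (forall k, [/\ measurable (U k), (0 < pik mub k (U k))%E &
     forall x, U k x -> 1 <= enorm x]) ->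
  (forall k, fine (pik mub k (Y k)) < 1) -> (0 < epsilon mub Y < +oo)%E.
Proof.
move=> hU pY1; rewrite epsilonE ltry andbT lte_fin.
have e1_gt0 k : 0 < e1 k.
  have [mU piU U1'] := hU k; rewrite -lte_fin -eps1E /eps1.
  pose s := (1 - fine (pik mub k (Y k))) / fine (pik mub k (Y k)).
  have s0 : 0 < s by rewrite divr_gt0// subr_gt0.
  have hs x : s <= h k x by rewrite lerDl.
  have i1 x : 0 <= 2 * enorm x ^+ 2 * h k x.
    by rewrite mulr_ge0 ?trunc_weight_ge0// mulr_ge0// sqr_ge0.
  have m1 : measurable_fun setT (fun x => 2 * enorm x ^+ 2 * h k x).
    have q2 := quadbZ 2 (@quadb_enorm2 R d).
    by have [] := quadb_trunc_weight (pik mub k) (mY k) q2.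
  apply: (@lt_le_trans _ _ (s%:E * pik mub k (U k))%E).
    by rewrite mule_gt0// lte_fin.
  rewrite -integral_cst//.
  apply: (@le_trans _ _ (\int[pik mub k]_(x in U k) (2 * enorm x ^+ 2 * h k x)%:E)%E).
    apply: ge0_le_integral => //.
    - by move=> x _; rewrite lee_fin ltW.
    - by apply/measurable_EFinP; exact: measurable_funTS.
    move=> x Ux; rewrite lee_fin; have x1 := U1' x Ux; have hx := hs x.
    have : 1 <= enorm x ^+ 2 by rewrite expr_ge1// enorm_ge0.
    nra.
  apply: ge0_subset_integral => //; first exact/measurable_EFinP.
  by move=> x _; rewrite lee_fin.
have [[K2 _ _] _ _ _ _] := hD; pose k0 : 'I_(gK D) := Ordinal (ltnW K2).
have t0 k : 0 < gw D k * (2 * Num.sqrt (A k) * Num.sqrt (e1 k) + e1 k + e2 k).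
  rewrite mulr_gt0// ltr_pwDl// ltr_wpDl// !mulr_ge0//.
rewrite (bigD1 k0)//= ltr_pwDl// sumr_ge0// => k _; exact: ltW.
Qed.

End truncated.

Lemma epsilon_cvg (Y : 'I_(gK D) -> nat -> set E) :
  (forall k r, measurable (Y k r)) -> (forall k r, 0 < fine (pik mub k (Y k r))) ->
  (forall k r, Y k r `<=` Y k r.+1) -> (forall k, \bigcup_r Y k r = [set: E]) ->
  epsilon mub (fun k => Y k r) @[r --> \oo] --> 0%E.
Proof.
move=> mY piY incY covY.
under eq_fun do rewrite epsilonE//.
apply: cvg_EFin; first by apply: nearW.
rewrite -[X in _ --> X](_ :
    \sum_k gw D k * (2 * Num.sqrt (A k) * Num.sqrt 0 + 0 + 0) = 0); last first.
  by apply: big1 => k _; rewrite sqrtr0 !mulr0 !addr0 mulr0.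
apply: (@cvg_big R 'I_(gK D) +%R 0 xpredT) => [|k _].
  by move=> x; exact: (@pseudometric_normed_Zmodule.add_continuous R R x).
apply: cvgMr; apply: cvgD; first apply: cvgD.
- apply: cvgMr; apply: continuous_cvg; first exact: sqrt_continuous.
  apply: trunc_weight_cvg => //; first exact: pik_P2.
    by apply: quadbZ; exact: quadb_enorm2.
  by move=> x; rewrite mulr_ge0// sqr_ge0.
- apply: trunc_weight_cvg => //; first exact: pik_P2.
    by apply: quadbZ; exact: quadb_enorm2.
  by move=> x; rewrite mulr_ge0// sqr_ge0.
- apply: trunc_weight_cvg => //; first exact: pik_P2.
  by apply: quadb_norm; exact: qb.
Qed.

End procedure_values.

(** * Regularity and bounds for the outputs *)

Section truncated_procedure.
Context {R : realType} {d : nat} (D : gen_input R d) (mub : probability 'rV[R]_d R).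
Hypotheses (d_gt0 : (0 < d)%N) (hD : gen_valid D) (mubac : P2ac mub).
Local Notation E := 'rV[R]_d.
Implicit Types (k : 'I_(gK D)).

Let mub2 : P2 mub. Proof. by case: mubac. Qed.

Let c0 k := phik_modulus_gt0 d_gt0 hD k.

Lemma pik_P2ac k : P2ac (pik mub k).
Proof.
split; first exact: pik_P2.
(* T_k is smooth for every exponent; 1 is picked because only continuity of the Jacobian matrix is
   extracted. *)
have [J TJ sJ] := smooth_has_jac ltr01 (fun q j => smooth_Tmap hD ltr01 (lexx 1) q k j).
apply: (pushforward_dominates (c0 k) (Tmap_monotone d_gt0 hD k) TJ _ (law_pik mub k)).
  by move=> i j; exact: (smooth_continuous ltr01 (sJ 0 i j)).
by case: mubac.
Qed.

Lemma pik_open_gt0 k : supp mub = setT ->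
  forall U : set E, open U -> U !=set0 -> (0 < pik mub k U)%E.
Proof.
move=> suppT; have [S TS] := Tmap_inverse d_gt0 hD.
exact: (pushforward_open_gt0 (TS k) (law_pik mub k) (@continuous_Tmap _ _ _ hD k) suppT).
Qed.

Lemma Sclass_measurable q (Y : set E) : Sclass q Y -> measurable Y.
Proof. by move=> [Y0 _ ->]; apply: closed_measurable_mx; exact: closed_closure. Qed.

Lemma Sclass_pik_gt0 q k (Y : set E) : supp mub = setT -> Sclass q Y ->
  0 < fine (pik mub k Y).
Proof.
move=> suppT [Y0 [Yn0 oY _ _ _] ->].
exact: (fine_closure_gt0 (pik_open_gt0 k suppT) Yn0 oY).
Qed.

Let norm_gt (M : R) : [set x : E | M < `|x|] !=set0.
Proof.
exists (const_mx (`|M| + 1)) => /=.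
apply: lt_le_trans (coord_le_norm _ (Ordinal d_gt0)); rewrite mxE.
by rewrite ger0_norm ?addr_ge0// (le_lt_trans (ler_norm M))// ltrDl.
Qed.

Let open_norm_gt (M : R) : open [set x : E | M < `|x|].
Proof.
rewrite (_ : [set x | _] = ~` [set x : E | `|x| <= M]); last first.
  by apply/seteqP; split=> x /=; rewrite ltNge => /negP.
exact/closed_openC/closed_norm_le.
Qed.

(** [Y] is closed and bounded, so its complement is open and, as d > 0, non-empty, hence charged. *)
Lemma Sclass_pik_lt1 q k (Y : set E) : supp mub = setT -> Sclass q Y ->
  fine (pik mub k Y) < 1.
Proof.
move=> suppT SY; have mY := Sclass_measurable SY.
have [Y0 [_ _ bY _ _] YE] := SY.
have [M [_ MY]] := bounded_set_closure bY.
have [x Mx] := @norm_gt (M + 1).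
have oC : open (~` Y) by rewrite YE; exact/closed_openC/closed_closure.
have : (0 < pik mub k (~` Y))%E.
  apply: (pik_open_gt0 k suppT oC); exists x; rewrite /= YE => xY.
  have : `|x| <= M + 1 by apply: MY xY; rewrite ltrDl.
  by rewrite leNgt Mx.
rewrite probability_setC// -(@fineK _ (pik mub k Y)); last exact: fin_num_measure.
by rewrite -EFinB lte_fin subr_gt0.
Qed.

(** T_k and its inverse are smooth to every order and det J stays above a positive constant, so the
    density of the pushforward inherits the order q and the exponent of the density of [mub]. *)
Lemma Mclass_truncate_pik q k (Y : set E) : Mfull q mub -> Sclass q Y ->
  Mclass q (truncate (pik mub k) Y).
Proof.
move=> [_ suppT [f [alpha [fd f0 alpha01 fC]]]] [Y0 SY ->].
have /andP[alpha0 /ltW alpha1] := alpha01.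
have [S TS] := Tmap_inverse d_gt0 hD.
have sT q' j := smooth_Tmap hD alpha0 alpha1 q' k j.
have [J TJ sJ] := smooth_has_jac alpha0 sT.
have cJ i j : continuous (fun x => J x i j) by exact: (smooth_continuous alpha0 (sJ 0 i j)).
have mT := Tmap_monotone d_gt0 hD k.
have detJ := jac_det_ge (c0 k) mT TJ cJ.
have cd0 : 0 < phik_modulus k ^+ d by rewrite exprn_gt0// c0.
have sS := smooth_inverse alpha0 alpha1 (c0 k) mT (TS k) TJ cd0 detJ sJ.
have lipS := monotone_inverse_lip (c0 k) mT (TS k).
have ic0 : 0 <= (phik_modulus k)^-1 by rewrite invr_ge0 ltW// c0.
pose g y := f (S k y) * (\det (J (S k y)))^-1.
have sg : smooth alpha q g.
  apply: smoothM => //.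
    exact: (smooth_comp alpha0 ic0 lipS (sS q) (smooth_of_Cholder_loc alpha1 fC)).
  apply: (smoothV alpha0 cd0) => [y|]; first exact: detJ.
  exact: (smooth_comp alpha0 ic0 lipS (sS q) (smooth_det alpha0 (sJ q))).
have [Yn0 oY _ _ _] := SY; have [pi2 piac] := pik_P2ac k.
apply: (Mclass_truncate (pik_open_gt0 k suppT) Yn0 oY pi2 piac alpha01 sg) => //.
- by move=> y; rewrite mulr_gt0// invr_gt0 (lt_le_trans cd0).
- by apply: continuous_measurable_mxreal; exact: (smooth_continuous alpha0 sg).
exact: (pushforward_density (c0 k) mT (TS k) TJ cJ (law_pik mub k) fd).
Qed.

Lemma truncated_procedure q (Y : 'I_(gK D) -> set E) : supp mub = setT ->
  (forall k, Sclass q (Y k)) ->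
  [/\ (0 < epsilon mub Y < +oo)%E,
      (Vobj mub true Y mub <= Vinf mub true Y + epsilon mub Y)%E &
      (`| Vmin D mub - Vinf mub true Y | <= epsilon mub Y)%E].
Proof.
move=> suppT SY; have [S TS] := Tmap_inverse d_gt0 hD.
have mY k := Sclass_measurable (SY k).
have pY k := Sclass_pik_gt0 k suppT (SY k).
have [h1 h2] := truncated_bounds d_gt0 hD mub2 TS mY pY; split=> //.
have [oU U0] := (@open_norm_gt 1, @norm_gt 1).
apply: (epsilon_gt0 d_gt0 hD mub2 TS mY pY (U := fun=> [set x : E | 1 < `|x|])).
  move=> k; split; first exact: open_measurable_mx.
    exact: (pik_open_gt0 k suppT oU U0).
  by move=> x /ltW x1; exact: (le_trans x1 (norm_le_enorm x)).
by move=> k; exact: (Sclass_pik_lt1 k suppT (SY k)).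
Qed.

End truncated_procedure.

Theorem proposition5p2 (R : realType) (d : nat) (D : gen_input R d)
    (mub : probability 'rV[R]_d R) :
  (0 < d)%N -> gen_valid D -> P2ac mub ->
  (* TRUNCATE = False *)
  (forall Y : 'I_(gK D) -> set 'rV[R]_d, (forall k, closed (Y k)) ->
    (* (i) *)
    [/\ (forall k, P2ac (nuk mub false Y k)),
        is_barycenter (gw D) (nuk mub false Y) mub &
        forall mu, is_barycenter (gw D) (nuk mub false Y) mu ->
          forall A, measurable A -> mu A = mub A] /\
    (* (ii) *)
    Vmin D mub = Vobj mub false Y mub) /\
  (* TRUNCATE = True *)
  (forall q : nat, Mfull q mub ->
    (forall Y : 'I_(gK D) -> set 'rV[R]_d, (forall k, Sclass q (Y k)) ->
      (* (iii) *)
      (forall k, Mclass q (nuk mub true Y k)) /\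
      (* (iv) *)
      [/\ (0 < epsilon mub Y < +oo)%E,
          (Vobj mub true Y mub <= Vinf mub true Y + epsilon mub Y)%E &
          (`| Vmin D mub - Vinf mub true Y | <= epsilon mub Y)%E]) /\
    (* (v) *)
    (forall Y : 'I_(gK D) -> nat -> set 'rV[R]_d,
      (forall k r, Sclass q (Y k r)) ->
      (forall k r, Y k r `<=` Y k r.+1) ->
      (forall k, \bigcup_r Y k r = [set: 'rV[R]_d]) ->
      epsilon mub (fun k => Y k r) @[r --> \oo] --> 0%E)).
Proof.
move=> d_gt0 hD mubac; have [mub2 _] := mubac.
have [S TS] := Tmap_inverse d_gt0 hD.
split=> [Y _|q hM].
  split; last by rewrite (VminE hD mub2) -(barycenter_obj_pik d_gt0 hD mub2 TS).
  split; first exact: pik_P2ac.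
    exact: (barycenter_pik d_gt0 hD mub2 TS).
  exact: (barycenter_pik_unique d_gt0 hD mub2 TS).
have suppT : supp mub = setT by case: hM.
split=> [Y SY|Y SY incY covY].
  split=> [k|]; first exact: (Mclass_truncate_pik d_gt0 hD mubac k hM (SY k)).
  exact: (truncated_procedure d_gt0 hD mubac suppT SY).
apply: (epsilon_cvg d_gt0 hD mub2 TS) => // k r.
  exact: (Sclass_measurable (SY k r)).
exact: (Sclass_pik_gt0 d_gt0 hD k suppT (SY k r)).
Qed.
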